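(* Let $\mathbb{V}$ be a $2$-Tate space and let $\mathbb{GL}(\mathbb{V})$ be its group of continuous automorphisms. Given a lattice $\mathbb{L}\subset\mathbb{V}$, one gets a $\mathbb{G}_m$-central extension of the discrete $2$-group associated to $\mathbb{GL}(\mathbb{V})$.
   Context: Tate spaces. A locally compact object of a category $C$ is an object of $\mathrm{Ind}(\mathrm{Pro}(C))$ isomorphic to one given by a diagram $F:I^{op}\times J\to C$, with $I,J$ countable linearly directed orders, such that for all $i\le i'$ in $I$ and $j\le j'$ in $J$ the square with horizontal arrows $F(i',j)\to F(i',j')$, $F(i,j)\to F(i,j')$ and vertical arrows $F(i',j)\to F(i,j)$, $F(i',j')\to F(i,j')$ is both cartesian and cocartesian, the vertical arrows are surjections and the horizontal arrows are injections. A compact object is a locally compact object isomorphic to one constant in the Ind direction. If $C$ is exact, a sequence of locally compact objects is called exact if it can be represented by maps of diagrams $F_1\to F_2\to F_3:I^{op}\times J\to C$ with all the arrows exact in $C$; this makes the category of locally compact objects exact. A $0$-Tate space is a finite dimensional vector space over a field; an $(n+1)$-Tate space is a locally compact object of the category of $n$-Tate spaces; a lattice of an $(n+1)$-Tate space is an admissible compact subobject. If $\mathbb{L}'\subset\mathbb{L}$ are lattices of a $2$-Tate space, then $\mathbb{L}/\mathbb{L}'$ is a $1$-Tate space. Determinant gerbe. A $\mathbb{G}_m$-gerbe is a connected groupoid in which every automorphism group is isomorphic to $\mathbb{G}_m$; $\otimes$ denotes the tensor product of $\mathbb{G}_m$-gerbes. For a $1$-Tate space $\mathcal{V}$, a determinant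 theory assigns to each lattice $\mathcal{L}$ a one-dimensional vector space $\Delta_{\mathcal{L}}$ and to each pair $\mathcal{L}_1\subset\mathcal{L}_2$ an isomorphism $\Delta_{\mathcal{L}_1}\otimes\mathrm{Det}(\mathcal{L}_2/\mathcal{L}_1)\to\Delta_{\mathcal{L}_2}$, such that for each triple $\mathcal{L}_1\subset\mathcal{L}_2\subset\mathcal{L}_3$ the two resulting maps $\Delta_{\mathcal{L}_1}\otimes\mathrm{Det}(\mathcal{L}_2/\mathcal{L}_1)\otimes\mathrm{Det}(\mathcal{L}_3/\mathcal{L}_2)\to\Delta_{\mathcal{L}_3}$ agree. Determinant theories on $\mathcal{V}$ form a $\mathbb{G}_m$-gerbe $\mathcal{D}_{\mathcal{V}}$. For each admissible exact sequence $0\to\mathcal{V}'\to\mathcal{V}\to\mathcal{V}''\to0$ of $1$-Tate spaces there is an equivalence $\mathcal{D}_{\mathcal{V}'}\otimes\mathcal{D}_{\mathcal{V}''}\to\mathcal{D}_{\mathcal{V}}$; for $\mathcal{V}_1\subset\mathcal{V}_2\subset\mathcal{V}_3$ there is a natural transformation between the two resulting equivalences $\mathcal{D}_{\mathcal{V}_1}\otimes\mathcal{D}_{\mathcal{V}_2/\mathcal{V}_1}\otimes\mathcal{D}_{\mathcal{V}_3/\mathcal{V}_2}\to\mathcal{D}_{\mathcal{V}_3}$; and for $\mathcal{V}_1\subset\mathcal{V}_2\subset\mathcal{V}_3\subset\mathcal{V}_4$ a cubical diagram of these natural transformations commutes. Gerbel theories. A gerbel theory $\mathbb{D}$ on a $2$-Tate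 space $\mathbb{V}$ consists of: a $\mathbb{G}_m$-gerbe $\mathbb{D}_{\mathbb{L}}$ for each lattice $\mathbb{L}\subset\mathbb{V}$; an equivalence $\phi_{\mathbb{L}\mathbb{L}'}:\mathbb{D}_{\mathbb{L}}\to\mathbb{D}_{\mathbb{L}'}\otimes\mathcal{D}_{\mathbb{L}/\mathbb{L}'}$ for lattices $\mathbb{L}'\subset\mathbb{L}$; for lattices $\mathbb{L}_1\subset\mathbb{L}_2\subset\mathbb{L}_3$ a natural transformation between the two resulting equivalences $\mathbb{D}_{\mathbb{L}_1}\otimes\mathcal{D}_{\mathbb{L}_2/\mathbb{L}_1}\otimes\mathcal{D}_{\mathbb{L}_3/\mathbb{L}_2}\to\mathbb{D}_{\mathbb{L}_3}$ (via $\mathbb{D}_{\mathbb{L}_2}\otimes\mathcal{D}_{\mathbb{L}_3/\mathbb{L}_2}$ and via $\mathbb{D}_{\mathbb{L}_1}\otimes\mathcal{D}_{\mathbb{L}_3/\mathbb{L}_1}$); such that for four nested lattices these natural transformations commute on a cubical diagram. Gerbel theories on $\mathbb{V}$ form a $2$-gerbe with band $\mathbb{G}_m$ (a connected $2$-groupoid, in the sense of bicategories, in which any two parallel $1$-arrows are connected by a $2$-arrow and every $1$-arrow has automorphism group isomorphic to $\mathbb{G}_m$), and $\mathbb{GL}(\mathbb{V})$ acts naturally (in fact strictly) on it; the central extension is the one associated to this action. Central extensions. A $2$-group is a monoidal groupoid whose set of connected components $\pi_0$, with the induced multiplication, is a group. The discrete $2$-group associated to a group $G$ has the elements of $G$ as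 objects, only identity morphisms, and monoidal structure given by multiplication. A $\mathbb{G}_m$-central extension of it is a $2$-group with $\pi_0\simeq G$ and with the automorphism group of the identity object isomorphic to $\mathbb{G}_m$.
   Formalization: A lattice is required to have discrete quotient V/L besides being an admissible compact subobject; otherwise 0 would be a lattice and L/0 = L need not be a 1-Tate space, so gerbel theories would be undefined. *)

(* Defs.v *)
(* [boolp] supplies function and proposition extensionality and choice.  Categories carry Leibniz equality of morphisms.  Throughout, k is the
   ground field and G_m is its multiplicative group k^*. *)
From mathcomp Require Import all_boot all_order all_algebra.
From mathcomp Require Import boolp.

Set Implicit Arguments.
Unset Strict Implicit.
Unset Printing Implicit Defensive.

Import GRing.Theory.
Local Open Scope ring_scope.

Record category : Type := Category {
  ob :> Type;
  hom : ob -> ob -> Type;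
  idm : forall a, hom a a;
  comp : forall x y z, hom y z -> hom x y -> hom x z;
  comp1m : forall a b (f : hom a b), comp (idm b) f = f;
  compm1 : forall a b (f : hom a b), comp f (idm a) = f;
  compA : forall a b c d (f : hom c d) (g : hom b c) (h : hom a b),
    comp f (comp g h) = comp (comp f g) h }.
Arguments hom {_} _ _.
Arguments idm {_} _.
Arguments comp {_ _ _ _} _ _.
Infix "\oc" := comp (at level 40, left associativity).

Definition opcat (C : category) : category :=
  @Category C (fun a b => @hom C b a) (@idm C) (fun a b c f g => @comp C c b a g f)
    (fun a b f => compm1 f) (fun a b f => comp1m f)
    (fun a b c d f g h => esym (compA h g f)).

Definition is_iso (C : category) (a b : C) (f : hom a b) : Prop :=
  exists g : hom b a, g \oc f = idm a /\ f \oc g = idm b.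

Definition isomorphic (C : category) (a b : C) : Prop :=
  exists f : hom a b, is_iso f.

(* The square   a --f--> b
                |g       |h
                c --k--> d   *)
Definition cartesian (C : category) (a b c d : C)
    (f : hom a b) (g : hom a c) (h : hom b d) (k : hom c d) : Prop :=
  h \oc f = k \oc g /\
  forall (t : C) (x : hom t b) (y : hom t c), h \oc x = k \oc y ->
    exists! z : hom t a, f \oc z = x /\ g \oc z = y.

Definition cocartesian (C : category) (a b c d : C)
    (f : hom a b) (g : hom a c) (h : hom b d) (k : hom c d) : Prop :=
  @cartesian (opcat C) d b c a h k f g.

Record dirset : Type := Dirset {
  dcar :> Type;
  dle : dcar -> dcar -> Prop;
  dle_refl : forall i, dle i i;
  dle_trans : forall i j l, dle i j -> dle j l -> dle i l;
  dinh : inhabited dcar;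
  ddir : forall i j, exists l, dle i l /\ dle j l }.

Record diagram (D : dirset) (C : category) : Type := Diagram {
  dob :> D -> C;
  dmap : forall i j, dle i j -> hom (dob i) (dob j);
  dmap_id : forall i (h : dle i i), dmap h = idm (dob i);
  dmap_comp : forall i j l (h : dle i j) (h' : dle j l) (h'' : dle i l),
    dmap h' \oc dmap h = dmap h'' }.

(* Ind-objects are presented by diagrams over directed preorders. *)
Record indobj (C : category) : Type := IndObj {
  iidx : dirset;
  idia :> diagram iidx C }.

Section Ind.
Variable C : category.
Implicit Types X Y Z : indobj C.

Definition germ_eq (A : C) Y (j : iidx Y) (f : hom A (Y j))
    (j' : iidx Y) (f' : hom A (Y j')) : Prop :=
  exists l (h : dle j l) (h' : dle j' l), dmap _ h \oc f = dmap _ h' \oc f'.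

(* [R i] is an equivalence class of germs, i.e. an element of
   colim_j Hom(X i, Y j), and [R] is compatible with the transition maps of X:
   thus Hom(X, Y) = lim_i colim_j Hom(X i, Y j). *)
Definition is_indhom X Y (R : forall i j, hom (X i) (Y j) -> Prop) : Prop :=
  [/\ forall i, exists j f, R i j f,
      forall i j f j' f', R i j f -> (R i j' f' <-> germ_eq f f') &
      forall i i' (h : dle i i') j f, R i' j f -> R i j (f \oc dmap _ h)].

Definition indhom X Y : Type :=
  {R : forall i j, hom (X i) (Y j) -> Prop | is_indhom R}.

Lemma indhom_ext X Y (R S : indhom X Y) :
  (forall i j f, sval R i j f -> sval S i j f) -> R = S.
Proof.
case: R S => [R [e1 e2 e3]] [S [f1 f2 f3]] /= h; apply: eq_exist.
apply: functional_extensionality_dep => i; apply: functional_extensionality_dep => j.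
apply: functional_extensionality_dep => f.
apply: propext; split; first exact: h.
have [j' [f' r]] := e1 i; have s := h _ _ _ r.
move=> sf; apply/(e2 _ _ _ _ f r); exact/(f2 _ _ _ _ f s).
Qed.

Lemma germ_refl (A : C) Y (j : iidx Y) (f : hom A (Y j)) : germ_eq f f.
Proof. by exists j, (dle_refl j), (dle_refl j). Qed.

Lemma germ_sym (A : C) Y (j j' : iidx Y) (f : hom A (Y j)) (f' : hom A (Y j')) :
  germ_eq f f' -> germ_eq f' f.
Proof. by move=> [l [h [h' e]]]; exists l, h', h. Qed.

Lemma germ_trans (A : C) Y (j j' j'' : iidx Y) (f : hom A (Y j))
    (f' : hom A (Y j')) (f'' : hom A (Y j'')) :
  germ_eq f f' -> germ_eq f' f'' -> germ_eq f f''.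
Proof.
move=> [l [h [h' e]]] [m [g [g' e']]].
have [n [ln mn]] := ddir l m.
exists n, (dle_trans h ln), (dle_trans g' mn).
rewrite -(dmap_comp _ h ln) -compA e compA (dmap_comp _ h' ln (dle_trans h' ln)).
rewrite (Prop_irrelevance (dle_trans h' ln) (dle_trans g mn)).
by rewrite -(dmap_comp _ g mn) -compA e' compA (dmap_comp _ g' mn (dle_trans g' mn)).
Qed.

Lemma germ_imap (A : C) Y (j j' : iidx Y) (h : dle j j') (f : hom A (Y j)) :
  germ_eq f (dmap _ h \oc f).
Proof.
exists j', h, (dle_refl j'); by rewrite dmap_id comp1m.
Qed.

Lemma germ_pre (A B : C) Y (j j' : iidx Y) (f : hom A (Y j)) (f' : hom A (Y j'))
  (g : hom B A) : germ_eq f f' -> germ_eq (f \oc g) (f' \oc g).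
Proof.
by move=> [l [h [h' e]]]; exists l, h, h'; rewrite !compA e.
Qed.

Lemma level_subproof X Y (s : iidx X -> iidx Y) (t : forall i, hom (X i) (Y (s i))) :
  (forall i i' (h : dle i i'), germ_eq (t i' \oc dmap _ h) (t i)) ->
  is_indhom (fun i j (f : hom (X i) (Y j)) => germ_eq (t i) f).
Proof.
move=> nat; split.
- by move=> i; exists (s i), (t i); exact: germ_refl.
- move=> i j f j' f' r; split; last exact: germ_trans.
  by apply: germ_trans; exact: germ_sym.
- move=> i i' h j f r; apply: germ_trans (germ_pre _ r).
  exact/germ_sym/nat.
Qed.

Definition indid X : indhom X X.
exists (fun i j (f : hom (X i) (X j)) => germ_eq (idm (X i)) f).
apply: (@level_subproof X X id (fun i => idm (X i))).
move=> i i' h; rewrite comp1m -[dmap _ h]compm1; exact/germ_sym/germ_imap.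
Defined.

Lemma indcomp_subproof X Y Z (S : indhom Y Z) (R : indhom X Y) :
  is_indhom (fun i l (f : hom (X i) (Z l)) =>
    exists j (r : hom (X i) (Y j)) l' (s : hom (Y j) (Z l')),
      [/\ sval R i j r, sval S j l' s & germ_eq (s \oc r) f]).
Proof.
case: R S => [R [R1 R2 R3]] [S [S1 S2 S3]] /=; split.
- move=> i; have [j [r Rr]] := R1 i; have [l [s Ss]] := S1 j.
  exists l, (s \oc r), j, r, l, s; split=> //; exact: germ_refl.
- move=> i l f l' f' [j [r [m [s [Rr Ss e]]]]]; split.
    move=> [j' [r' [m' [s' [Rr' Ss' e']]]]].
    apply: germ_trans (germ_sym e) _; apply: germ_trans e'.
    have [n [h [h' er]]] := (R2 _ _ _ _ r' Rr).1 Rr'.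
    have [p [q Sq]] := S1 n.
    have c1 := (S2 _ _ _ _ (q \oc dmap _ h) Ss).1 (S3 _ _ _ _ _ Sq).
    have c2 := (S2 _ _ _ _ (q \oc dmap _ h') Ss').1 (S3 _ _ _ _ _ Sq).
    apply: germ_trans (germ_pre r c1) _.
    rewrite -compA er compA; exact/germ_sym/germ_pre.
  move=> e'; exists j, r, m, s; split=> //; exact: germ_trans e'.
- move=> i i' h l f [j [r [m [s [Rr Ss e]]]]].
  exists j, (r \oc dmap _ h), m, s; split => //; first exact: R3.
  rewrite compA; exact: germ_pre.
Qed.

Definition indcomp X Y Z (S : indhom Y Z) (R : indhom X Y) : indhom X Z :=
  exist _ _ (indcomp_subproof S R).

Lemma indcomp1m X Y (R : indhom X Y) : indcomp (indid Y) R = R.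
Proof.
apply: indhom_ext => i l f [j [r [l' [s [Rr e1 e2]]]]].
have [_ R2 _] := proj2_sig R.
apply/(R2 _ _ _ _ f Rr); apply: germ_trans e2.
by move: (germ_pre r e1); rewrite comp1m.
Qed.

Lemma indcompm1 X Y (R : indhom X Y) : indcomp R (indid X) = R.
Proof.
apply: esym; apply: indhom_ext => i l f Rf.
exists i, (idm _), l, f; split => //; first exact: germ_refl.
by rewrite compm1; exact: germ_refl.
Qed.

Lemma indcompA W X Y Z (T : indhom Y Z) (S : indhom X Y) (R : indhom W X) :
  indcomp T (indcomp S R) = indcomp (indcomp T S) R.
Proof.
apply: esym; apply: indhom_ext.
move=> i l f [j [r [l' [st [Rr [m [s [n [t [Ss Tt e1]]]]] e2]]]]].
exists m, (s \oc r), n, t; split => //.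
  by exists j, r, m, s; split=> //; exact: germ_refl.
apply: germ_trans e2; rewrite compA; exact: germ_pre.
Qed.

Definition ind : category :=
  @Category (indobj C) indhom indid indcomp indcomp1m indcompm1 indcompA.

End Ind.

Definition pro (C : category) : category := opcat (ind (opcat C)).


Record dnat (D : dirset) (C : category) (F G : diagram D C) : Type := DNat {
  dcomp :> forall i, hom (F i) (G i);
  dcompP : forall i j (h : dle i j), dmap G h \oc dcomp i = dcomp j \oc dmap F h }.

Section Level.
Variables (D : dirset) (C : category).
Implicit Types F G H : diagram D C.

Lemma level_proof F G (t : dnat F G) :
  @is_indhom C (IndObj F) (IndObj G) (fun i j f => @germ_eq C (F i) (IndObj G) i (t i) j f).
Proof.
apply: (@level_subproof C (IndObj F) (IndObj G) id (fun i => t i)) => i i' h.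
by rewrite /= -dcompP; apply/germ_sym; apply: (@germ_imap C _ (IndObj G) i i' h).
Qed.

Definition level F G (t : dnat F G) : @hom (ind C) (IndObj F) (IndObj G) :=
  exist _ _ (level_proof t).

Lemma level_id F (t : dnat F F) : (forall i, t i = idm (F i)) -> level t = idm _.
Proof. by move=> e; apply: indhom_ext => i j f /=; rewrite e. Qed.

Lemma level_comp F G H (s : dnat G H) (t : dnat F G) (st : dnat F H) :
  (forall i, s i \oc t i = st i) -> level s \oc level t = level st.
Proof.
move=> e; apply: esym; apply: indhom_ext => i j f /= r.
exists i, (t i), i, (s i); split; rewrite ?e //; exact: germ_refl.
Qed.

End Level.

(* Countable nonempty linear orders; totality makes them directed. *)
Record corder : Type := COrder {
  ccar :> Type;
  cle : ccar -> ccar -> Prop;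
  cle_refl : forall i, cle i i;
  cle_trans : forall i j l, cle i j -> cle j l -> cle i l;
  cle_anti : forall i j, cle i j -> cle j i -> i = j;
  cle_total : forall i j, cle i j \/ cle j i;
  cinh : inhabited ccar;
  ccount : exists f : ccar -> nat, injective f }.

Lemma corder_dir (I : corder) (i j : I) : exists l, cle i l /\ cle j l.
Proof.
by case: (cle_total i j) => h; [exists j | exists i]; split=> //; exact: cle_refl.
Qed.

Definition dir_of (I : corder) : dirset :=
  @Dirset I (@cle I) (@cle_refl I) (@cle_trans I) (cinh I) (@corder_dir I).

(* A category with a class of short exact sequences.  The axioms of an exact category
   are not bundled: none of the constructions below uses them, and for the categories
   [tate k n], the only ones to which they are applied, they are a theorem. *)
Record excat : Type := ExCat {
  ecat :> category;
  ses : forall a b c : ecat, hom a b -> hom b c -> Prop }.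

Definition inflation (C : excat) (a b : C) (f : hom a b) : Prop :=
  exists (c : C) (p : hom b c), ses f p.
Definition deflation (C : excat) (b c : C) (p : hom b c) : Prop :=
  exists (a : C) (f : hom a b), ses f p.

(* Diagrams F : I^op x J -> C as in the definition of locally compact objects; [lver]
   are the (contravariant) vertical arrows, [lhor] the horizontal ones. *)
Record lcdiag (C : excat) (I J : corder) : Type := LcDiag {
  lob :> I -> J -> C;
  lver : forall i i' j, cle i i' -> hom (lob i' j) (lob i j);
  lhor : forall i j j', cle j j' -> hom (lob i j) (lob i j');
  lver_id : forall i j (h : cle i i), lver j h = idm (lob i j);
  lhor_id : forall i j (h : cle j j), lhor i h = idm (lob i j);
  lver_comp : forall i i' i'' j (h : cle i i') (h' : cle i' i'') (h'' : cle i i''),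
    lver j h \oc lver j h' = lver j h'';
  lhor_comp : forall i j j' j'' (h : cle j j') (h' : cle j' j'') (h'' : cle j j''),
    lhor i h' \oc lhor i h = lhor i h'';
  lcart : forall i i' j j' (h : cle i i') (k : cle j j'),
    cartesian (lhor i' k) (lver j h) (lver j' h) (lhor i k);
  lcocart : forall i i' j j' (h : cle i i') (k : cle j j'),
    cocartesian (lhor i' k) (lver j h) (lver j' h) (lhor i k);
  lver_defl : forall i i' j (h : cle i i'), deflation (lver j h);
  lhor_infl : forall i j j' (h : cle j j'), inflation (lhor i h) }.

Record lcmap (C : excat) (I J : corder) (F G : lcdiag C I J) : Type := LcMap {
  lcomp :> forall i j, hom (F i j) (G i j);
  lcomp_ver : forall i i' j (h : cle i i'),
    lver G j h \oc lcomp i' j = lcomp i j \oc lver F j h;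
  lcomp_hor : forall i j j' (h : cle j j'),
    lhor G i h \oc lcomp i j = lcomp i j' \oc lhor F i h }.

Section IndPro.
Variables (C : excat) (I J : corder).
Implicit Types F G : lcdiag C I J.

Definition lrow F (j : J) : diagram (dir_of I) (opcat C) :=
  @Diagram (dir_of I) (opcat C) (fun i => F i j) (fun i i' h => lver F j h)
    (fun i h => lver_id F j h) (fun i i' i'' h h' h'' => lver_comp F j h h' h'').

Definition lrow_obj F (j : J) : pro C := IndObj (lrow F j).

Definition lrow_nat F (j j' : J) (h : cle j j') : dnat (lrow F j') (lrow F j) :=
  @DNat _ (opcat C) (lrow F j') (lrow F j) (fun i => lhor F i h)
    (fun i i' k => esym (proj1 (lcart F k h))).

Definition lrow_map F (j j' : J) (h : cle j j') : hom (lrow_obj F j) (lrow_obj F j') :=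
  level (lrow_nat F h).

Lemma lrow_map_id F (j : J) (h : cle j j) : lrow_map F h = idm (lrow_obj F j).
Proof. apply: level_id => i; exact: (lhor_id F). Qed.

Lemma lrow_map_comp F j j' j'' (h : cle j j') (h' : cle j' j'') (h'' : cle j j'') :
  lrow_map F h' \oc lrow_map F h = lrow_map F h''.
Proof. apply: level_comp => i; exact: (lhor_comp F). Qed.

Definition indpro_dia F : diagram (dir_of J) (pro C) :=
  @Diagram (dir_of J) (pro C) (lrow_obj F) (lrow_map F) (@lrow_map_id F) (@lrow_map_comp F).

Definition indpro F : ind (pro C) := IndObj (indpro_dia F).

Definition lcmap_row F G (t : lcmap F G) (j : J) : hom (lrow_obj F j) (lrow_obj G j) :=
  level (@DNat _ (opcat C) (lrow G j) (lrow F j) (fun i => t i j)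
    (fun i i' h => esym (lcomp_ver t j h))).

Lemma lcmap_row_nat F G (t : lcmap F G) (j j' : J) (h : cle j j') :
  lrow_map G h \oc lcmap_row t j = lcmap_row t j' \oc lrow_map F h.
Proof.
have nat i i' (k : cle i i') : lver G j' k \oc (lhor G i' h \oc t i' j) =
    (lhor G i h \oc t i j) \oc lver F j k.
  by rewrite -compA -(lcomp_ver t) !compA (lcart G k h).1.
pose st := @DNat _ (opcat C) (lrow G j') (lrow F j) (fun i => lhor G i h \oc t i j)
  (fun i i' k => esym (nat i i' k)).
transitivity (level st : hom (lrow_obj F j) (lrow_obj G j')).
  exact: level_comp.
symmetry; apply: level_comp => i; exact/esym/(lcomp_hor t).
Qed.

Definition indpro_map F G (t : lcmap F G) : hom (indpro F) (indpro G) :=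
  level (@DNat _ _ (indpro_dia F) (indpro_dia G) (lcmap_row t) (lcmap_row_nat t)).

End IndPro.

Definition pt_dir : dirset :=
  @Dirset unit (fun _ _ => True) (fun _ => I) (fun _ _ _ _ _ => I) (inhabits tt)
    (fun _ _ => ex_intro _ tt (conj I I)).

Definition cdiag (C : category) (a : C) : diagram pt_dir C.
exists (fun _ => a) (fun _ _ _ => idm a); by [move=> * | move=> *; rewrite comp1m].
Defined.

Definition cnat (C : category) (a b : C) (f : hom a b) : dnat (cdiag a) (cdiag b).
exists (fun _ => f) => i j h /=; by rewrite comp1m compm1.
Defined.

Definition cpro (C : category) (a : C) : pro C := IndObj (@cdiag (opcat C) a).
Definition cpro_map (C : category) (a b : C) (f : hom a b) : hom (cpro a) (cpro b) :=
  level (@cnat (opcat C) b a f).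
Definition const (C : category) (a : C) : ind (pro C) := IndObj (cdiag (cpro a)).
Definition const_map (C : category) (a b : C) (f : hom a b) : hom (const a) (const b) :=
  level (cnat (cpro_map f)).

Section LocallyCompact.
Variable C : excat.

Definition is_lc (X : ind (pro C)) : Prop :=
  exists (I J : corder) (F : lcdiag C I J), isomorphic X (indpro F).

(* Constant in the Ind direction, i.e. J is one point; dually for discrete objects. *)
Definition is_compact (X : ind (pro C)) : Prop :=
  exists (I J : corder) (F : lcdiag C I J),
    (forall j j' : J, j = j') /\ isomorphic X (indpro F).

Definition is_discrete (X : ind (pro C)) : Prop :=
  exists (I J : corder) (F : lcdiag C I J),
    (forall i i' : I, i = i') /\ isomorphic X (indpro F).

(* Exact sequences are those represented by maps of diagrams that are exact in C
   at every place. *)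
Definition lc_ses (X Y Z : ind (pro C)) (f : hom X Y) (g : hom Y Z) : Prop :=
  exists (I J : corder) (F1 F2 F3 : lcdiag C I J) (s : lcmap F1 F2) (t : lcmap F2 F3),
    (forall i j, ses (s i j) (t i j)) /\
    exists (a : hom X (indpro F1)) (b : hom Y (indpro F2)) (c : hom Z (indpro F3)),
      [/\ is_iso a, is_iso b & is_iso c] /\
      (b \oc f = indpro_map s \oc a /\ c \oc g = indpro_map t \oc b).

Definition lc_cat : category :=
  @Category {X : ind (pro C) | is_lc X} (fun X Y => hom (sval X) (sval Y))
    (fun X => idm (sval X)) (fun X Y Z f g => f \oc g)
    (fun X Y f => comp1m f) (fun X Y f => compm1 f)
    (fun W X Y Z f g h => compA f g h).

Definition lc : excat :=
  @ExCat lc_cat (fun X Y Z f g => @lc_ses (sval X) (sval Y) (sval Z) f g).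

End LocallyCompact.

Section FinVect.
Variable k : fieldType.

Definition finvect_cat : category.
refine (@Category (vectType k) (fun U V => 'Hom(U, V)) (fun U => \1%VF)
  (fun U V W f g => (f \o g)%VF) _ _ _).
- by move=> U V f; exact: comp_lfun1l.
- by move=> U V f; exact: comp_lfun1r.
- by move=> U V W Z f g h; exact: comp_lfunA.
Defined.

Definition finvect : excat :=
  @ExCat finvect_cat (fun (U V W : vectType k) (f : 'Hom(U, V)) (g : 'Hom(V, W)) =>
    [/\ lker f = 0%VS, limg f = lker g & limg g = fullv]).

Fixpoint tate (n : nat) : excat := if n is n'.+1 then lc (tate n') else finvect.

End FinVect.

Record group : Type := Group {
  gcar :> Type;
  gone : gcar;
  gmul : gcar -> gcar -> gcar;
  ginv : gcar -> gcar;
  gmul1 : forall x, gmul gone x = x;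
  gmulV : forall x, gmul (ginv x) x = gone;
  gmulA : forall x y z, gmul x (gmul y z) = gmul (gmul x y) z }.
Arguments gone {_}.
Arguments gmul {_} _ _.
Arguments ginv {_} _.

Section Aut.
Variables (C : category) (a : C).

Lemma iso_comp (b c d : C) (f : hom c d) (g : hom b c) :
  is_iso f -> is_iso g -> is_iso (f \oc g).
Proof.
move=> [f' [e1 e2]] [g' [e3 e4]]; exists (g' \oc f'); split.
  by rewrite compA -(compA g') e1 compm1.
by rewrite compA -(compA f) e4 compm1.
Qed.

Lemma iso_id (b : C) : is_iso (idm b).
Proof. by exists (idm b); rewrite comp1m. Qed.

Definition aut : Type := {f : hom a a | is_iso f}.
Definition aut1 : aut := exist _ (idm a) (iso_id a).
Definition autM (f g : aut) : aut := exist _ (sval f \oc sval g) (iso_comp (svalP f) (svalP g)).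

Definition autV (f : aut) : aut.
exists (sval (cid (svalP f))); exists (sval f).
by case: (svalP (cid (svalP f))).
Defined.

Lemma aut_ext (f g : aut) : sval f = sval g -> f = g.
Proof. by case: f g => [f pf] [g pg] /= e; apply: eq_exist. Qed.

Definition Aut : group.
refine (@Group aut aut1 autM autV _ _ _).
- by move=> x; apply: aut_ext; exact: comp1m.
- by move=> x; apply: aut_ext => /=; case: (svalP (cid (svalP x))).
- by move=> x y z; apply: aut_ext; exact: compA.
Defined.

End Aut.

Section Gerbes.
Variable k : fieldType.

Definition gm : Type := {t : k | t != 0}.
Lemma gm1_proof : (1 : k) != 0. Proof. exact: oner_neq0. Qed.
Definition gm1 : gm := exist _ 1 gm1_proof.
Definition gmM (s t : gm) : gm := exist _ (sval s * sval t) (mulf_neq0 (svalP s) (svalP t)).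
Lemma gmV_proof (s : gm) : (sval s)^-1 != 0.
Proof. by rewrite invr_eq0 (svalP s). Qed.
Definition gmV (s : gm) : gm := exist _ (sval s)^-1 (gmV_proof s).

Lemma gm_ext (s t : gm) : sval s = sval t -> s = t.
Proof. by case: s t => [s ps] [t pt] /= e; apply: eq_exist. Qed.

Definition Gm : group.
refine (@Group gm gm1 gmM gmV _ _ _).
- by move=> x; apply: gm_ext; rewrite /= mul1r.
- by move=> x; apply: gm_ext; rewrite /= mulVf // (svalP x).
- by move=> x y z; apply: gm_ext; rewrite /= mulrA.
Defined.

Lemma gmC (s t : Gm) : gmul s t = gmul t s.
Proof. by apply: gm_ext; rewrite /= mulrC. Qed.

(* Groupoids with a central action of G_m by automorphisms.  Such a G is a G_m-gerbe
   when it is nonempty and connected and the action identifies G_m with every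
   automorphism group. *)
Record gpd : Type := Gpd {
  gcat :> category;
  gpd_iso : forall (a b : gcat) (f : hom a b), is_iso f;
  scal : Gm -> forall a : gcat, hom a a;
  scal1 : forall a, scal gone a = idm a;
  scalM : forall s t a, scal (gmul s t) a = scal s a \oc scal t a;
  scal_nat : forall t (a b : gcat) (f : hom a b), scal t b \oc f = f \oc scal t a }.
Arguments scal {_} _ _.

Definition is_gerbe (G : gpd) : Prop :=
  [/\ inhabited G, forall a b : G, inhabited (hom a b) &
      forall (a : G) (f : hom a a), exists! t : Gm, scal t a = f].

(* Functors compatible with the band G_m. *)
Record gfun (G H : gpd) : Type := GFun {
  fob :> G -> H;
  fmap : forall a b, hom a b -> hom (fob a) (fob b);
  fmap_id : forall a, fmap (idm a) = idm (fob a);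
  fmap_comp : forall a b c (f : hom b c) (g : hom a b),
    fmap (f \oc g) = fmap f \oc fmap g;
  fmap_scal : forall t a, fmap (scal t a) = scal t (fob a) }.
Arguments fmap {G H} _ {a b} _.

Definition is_equiv (G H : gpd) (F : gfun G H) : Prop :=
  (forall a b, bijective (@fmap G H F a b)) /\
  (forall b : H, exists a : G, inhabited (hom (F a) b)).

Definition gfun_id (G : gpd) : gfun G G :=
  @GFun G G (fun a => a) (fun a b f => f) (fun a => erefl) (fun a b c f g => erefl)
    (fun t a => erefl).

Definition gfun_comp (G H K : gpd) (F : gfun H K) (E : gfun G H) : gfun G K.
refine (@GFun G K (fun a => F (E a)) (fun a b f => fmap F (fmap E f)) _ _ _).
- by move=> a; rewrite !fmap_id.
- by move=> a b c f g; rewrite !fmap_comp.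
- by move=> t a; rewrite !fmap_scal.
Defined.

Definition gfun_cast (G H : gpd) (e : G = H) : gfun G H :=
  match e in _ = H' return gfun G H' with erefl => gfun_id G end.

(* A (x) B: the objects are pairs, written a (x) b, and Hom(a (x) b, a' (x) b') is the
   quotient of Hom(a, a') x Hom(b, b') by the antidiagonal action of G_m; [tens f g] is
   the class of (f, g). *)
Section Tensor.
Variables A B : gpd.
Implicit Types (a : A) (b : B).

(* the orbit of (f, g) under t . (f, g) = (t f, t^-1 g) *)
Definition tcls a a' b b' (f : hom a a') (g : hom b b') (x : hom a a' * hom b b') : Prop :=
  exists t : Gm, f = scal t a' \oc x.1 /\ x.2 = scal t b' \oc g.

Definition thom (x y : A * B) : Type :=
  {P : hom x.1 y.1 * hom x.2 y.2 -> Prop | exists f g, P = tcls f g}.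

Definition tens (x y : A * B) (f : hom x.1 y.1) (g : hom x.2 y.2) : thom x y :=
  exist _ (tcls f g) (ex_intro _ f (ex_intro _ g erefl)).

Lemma scalV (G : gpd) (t : Gm) (a : G) : scal (ginv t) a \oc scal t a = idm a.
Proof. by rewrite -scalM gmulV scal1. Qed.

Lemma scalVr (G : gpd) (t : Gm) (a : G) : scal t a \oc scal (ginv t) a = idm a.
Proof. by rewrite -scalM gmC gmulV scal1. Qed.

Lemma tens_scal (x y : A * B) (f : hom x.1 y.1) (g : hom x.2 y.2) (t : Gm) :
  @tens x y (scal t _ \oc f) g = @tens x y f (scal t _ \oc g).
Proof.
apply: eq_exist; apply: funext => -[f' g']; apply: propext; split.
  move=> [s /= [e1 e2]]; exists (gmul (ginv t) s) => /=; split.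
    by rewrite scalM -compA -e1 compA scalV comp1m.
  rewrite e2 compA -scalM; congr (scal _ _ \oc _).
  by apply: gm_ext; rewrite /= mulrAC mulVf ?(svalP t) // mul1r.
move=> [s /= [e1 e2]]; exists (gmul t s) => /=; split.
  by rewrite scalM -compA e1.
by rewrite e2 compA -scalM gmC.
Qed.

Lemma tensP (x y : A * B) (P : thom x y) : exists f g, P = tens f g.
Proof.
case: P => P [f [g e]]; exists f, g; exact: eq_exist.
Qed.

Lemma tens_inj (x y : A * B) (f f' : hom x.1 y.1) (g g' : hom x.2 y.2) :
  @tens x y f g = @tens x y f' g' ->
  exists t, f = scal t _ \oc f' /\ g' = scal t _ \oc g.
Proof.
move=> e; have := (erefl : sval (tens f g) = _); rewrite {2}e /= => e'.
have : tcls f' g' (f', g') by exists gone; rewrite /= !scal1 !comp1m.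
by rewrite -e' => -[t [/= e1 e2]]; exists t.
Qed.

Lemma tensP2 (x y : A * B) (P : thom x y) :
  exists p : hom x.1 y.1 * hom x.2 y.2, P = tens p.1 p.2.
Proof. by have [f [g e]] := tensP P; exists (f, g). Qed.

Definition thom_comp (x y z : A * B) (P : thom y z) (Q : thom x y) : thom x z :=
  let p := sval (cid (tensP2 P)) in let q := sval (cid (tensP2 Q)) in
  tens (p.1 \oc q.1) (p.2 \oc q.2).

Lemma thom_compE (x y z : A * B) (f : hom y.1 z.1) (g : hom y.2 z.2)
    (f' : hom x.1 y.1) (g' : hom x.2 y.2) :
  thom_comp (tens f g) (tens f' g') = tens (f \oc f') (g \oc g').
Proof.
rewrite /thom_comp.
case: (cid (tensP2 (tens f g))) => -[f1 g1] /= e1.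
case: (cid (tensP2 (tens f' g'))) => -[f2 g2] /= e2.
have [t [-> ->]] := tens_inj e1; have [s [-> ->]] := tens_inj e2.
have scalMM (G : gpd) (a b c : G) (u : hom b c) (v : hom a b) :
    (scal t c \oc u) \oc (scal s b \oc v) = scal (gmul t s) c \oc (u \oc v).
  by rewrite scalM -!compA; congr comp; rewrite !compA (scal_nat s u).
by rewrite !scalMM tens_scal.
Qed.

Definition gtens_cat : category.
refine (@Category (A * B) thom (fun x => tens (idm x.1) (idm x.2)) thom_comp _ _ _).
- by move=> x y P; have [f [g ->]] := tensP P; rewrite thom_compE !comp1m.
- by move=> x y P; have [f [g ->]] := tensP P; rewrite thom_compE !compm1.
- move=> x y z w P Q R; have [f [g ->]] := tensP P; have [f' [g' ->]] := tensP Q.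
  by have [f2 [g2 ->]] := tensP R; rewrite !thom_compE !compA.
Defined.

Definition gtens : gpd.
refine (@Gpd gtens_cat _ (fun t x => tens (scal t x.1) (idm x.2)) _ _ _).
- move=> x y P; have [f [g ->]] := tensP P.
  have [f' [e1 e2]] := gpd_iso f; have [g' [e3 e4]] := gpd_iso g.
  by exists (tens f' g'); rewrite /= !thom_compE e1 e2 e3 e4.
- by move=> x; rewrite scal1.
- by move=> s t x; rewrite /= thom_compE scalM comp1m.
- move=> t x y P; have [f [g ->]] := tensP P.
  by rewrite /= !thom_compE scal_nat comp1m compm1.
Defined.

End Tensor.
End Gerbes.

Section Lattices.
Variables (C : excat) (V : ind (pro C)).

(* Discreteness of the quotient V / L must be required: 0 is always an admissible
   compact subobject of V, but the quotient of a lattice L by 0 is L itself, whereas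
   quotients of nested lattices of an (n+1)-Tate space must be n-Tate spaces. *)
Definition is_lattice (L : ind (pro C)) (i : hom L V) : Prop :=
  is_compact L /\
  exists (Q : ind (pro C)) (q : hom V Q), is_discrete Q /\ lc_ses i q.

(* Lattices with underlying object L. *)
Definition lat (L : ind (pro C)) : Type := {i : hom L V | is_lattice i}.

(* p exhibits the object W of C as the quotient X1 / X0, u being the inclusion. *)
Definition quo (L0 L1 : ind (pro C)) (X0 : lat L0) (X1 : lat L1) (u : hom L0 L1)
    (W : C) (p : hom L1 (const W)) : Prop :=
  sval X1 \oc u = sval X0 /\ lc_ses u p.

(* i : X1/X0 -> X2/X0 and q : X2/X0 -> X2/X1 are the canonical maps. *)
Definition qtri (L1 L2 : ind (pro C)) (u12 : hom L1 L2) (W01 W02 W12 : C)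
    (p01 : hom L1 (const W01)) (p02 : hom L2 (const W02)) (p12 : hom L2 (const W12))
    (i : hom W01 W02) (q : hom W02 W12) : Prop :=
  [/\ ses i q, const_map i \oc p01 = p02 \oc u12 & const_map q \oc p02 = p12].

End Lattices.

Section Determinants.
Variable k : fieldType.

(* The top exterior power of W, realised as the line k^o together with the universal
   alternating map [wedge] : W^n -> Det W, n = dim W, which is the determinant of
   coordinates in the basis [vbasis] chosen by the library. *)
Definition Det (W : vectType k) : vectType k := k^o.

Definition wedge (W : vectType k) (w : seq W) : Det W :=
  \det (\matrix_(i < \dim {:W}, j < \dim {:W}) coord (vbasis {:W}) j w`_i).

Section DetTheory.
Variable V : tate k 1.
Notation lt := (@lat (finvect k) (sval V)).

(* A linear map Dl(X0) (x) Det W -> Dl(X1) is given by a bilinear map; since all the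
   spaces are lines, it is an isomorphism iff it satisfies [dphi_iso].  Quotients are
   only defined up to isomorphism, so the isomorphism is given for every choice (W, p)
   of X1 / X0.  [dphi_comp] compares the two maps
     Dl(X0) (x) Det W01 (x) Det W12 -> Dl(X2)
   through the isomorphism Det W01 (x) Det W12 -> Det W02 sending
   (v1 ^ .. ^ vm) (x) (q w1 ^ .. ^ q wn) to i v1 ^ .. ^ i vm ^ w1 ^ .. ^ wn. *)
Record dettheory : Type := DetTheory {
  dl : forall L, lt L -> vectType k;
  dl1 : forall L (X : lt L), \dim {: dl X} = 1%N;
  dphi : forall (L0 L1 : ind (pro (finvect k))) (X0 : lt L0) (X1 : lt L1)
      (u : hom L0 L1) (W : vectType k) (p : hom L1 (const (W : finvect k))),
    quo X0 X1 u p -> 'Hom(dl X0, 'Hom(Det W, dl X1));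
  dphi_iso : forall (L0 L1 : ind (pro (finvect k))) (X0 : lt L0) (X1 : lt L1)
      (u : hom L0 L1) (W : vectType k) (p : hom L1 (const (W : finvect k)))
      (H : quo X0 X1 u p) (x : dl X0) (d : Det W),
    x != 0 -> d != 0 -> dphi H x d != 0;
  dphi_comp : forall (L0 L1 L2 : ind (pro (finvect k)))
      (X0 : lt L0) (X1 : lt L1) (X2 : lt L2)
      (u01 : hom L0 L1) (u02 : hom L0 L2) (u12 : hom L1 L2) (W01 W02 W12 : vectType k)
      (p01 : hom L1 (const (W01 : finvect k))) (p02 : hom L2 (const (W02 : finvect k)))
      (p12 : hom L2 (const (W12 : finvect k)))
      (i : 'Hom(W01, W02)) (q : 'Hom(W02, W12))
      (H01 : quo X0 X1 u01 p01) (H02 : quo X0 X2 u02 p02) (H12 : quo X1 X2 u12 p12),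
    @qtri (finvect k) L1 L2 u12 W01 W02 W12 p01 p02 p12 i q ->
    forall (x : dl X0) (v : (\dim {:W01}).-tuple W01) (w : (\dim {:W12}).-tuple W02),
    dphi H12 (dphi H01 x (wedge v)) (wedge (map q w)) =
    dphi H02 x (wedge (map i v ++ w)) }.

Implicit Types D E F : dettheory.

Record detmor D E : Type := DetMor {
  dmor : forall L (X : lt L), 'Hom(dl D X, dl E X);
  dmor_iso : forall L (X : lt L), lker (dmor X) = 0%VS;
  dmor_phi : forall (L0 L1 : ind (pro (finvect k))) (X0 : lt L0) (X1 : lt L1)
      (u : hom L0 L1) (W : vectType k) (p : hom L1 (const (W : finvect k)))
      (H : quo X0 X1 u p) (x : dl D X0) (d : Det W),
    dmor X1 (dphi D H x d) = dphi E H (dmor X0 x) d }.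

Lemma detmor_ext D E (f g : detmor D E) :
  (forall L (X : lt L) x, dmor f X x = dmor g X x) -> f = g.
Proof.
case: f g => [f f1 f2] [g g1 g2] /= e.
have e' : f = g.
  apply: functional_extensionality_dep => L; apply: functional_extensionality_dep => X.
  by apply/lfunP => x; exact: e.
by subst g; congr DetMor; apply: Prop_irrelevance.
Qed.

Definition detmor_id D : detmor D D.
exists (fun L X => \1%VF).
- by move=> L X; apply/eqP/lker0P => x y; rewrite !id_lfunE.
- by move=> *; rewrite !id_lfunE.
Defined.

Definition detmor_comp D E F (g : detmor E F) (f : detmor D E) : detmor D F.
exists (fun L X => (dmor g X \o dmor f X)%VF).
- move=> L X; apply/eqP/lker0P => x y; rewrite !comp_lfunE => e.
  have /eqP/lker0P gi := dmor_iso g X; have /eqP/lker0P fi := dmor_iso f X.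
  exact/fi/gi.
- by move=> *; rewrite !comp_lfunE !dmor_phi.
Defined.

Definition detmor_scal (t : Gm k) D : detmor D D.
exists (fun L X => (sval t *: \1)%VF).
- move=> L X; apply/eqP/lker0P => x y; rewrite !scale_lfunE !id_lfunE.
  exact/scalerI/(svalP t).
- by move=> *; rewrite !scale_lfunE !id_lfunE !linearZ scale_lfunE.
Defined.

Lemma dl_surj D E L (X : lt L) (f : 'Hom(dl D X, dl E X)) : lker f = 0%VS -> limg f = fullv.
Proof.
move=> e; apply/eqP; rewrite eqEdim subvf /= dl1 -(dl1 D X).
by rewrite limg_dim_eq ?e ?capv0 // capfv e.
Qed.

Lemma detmor_inv D E (f : detmor D E) : exists g : detmor E D,
  detmor_comp g f = detmor_id D /\ detmor_comp f g = detmor_id E.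
Proof.
have inj L (X : lt L) := introT eqP (dmor_iso f X).
have K1 L (X : lt L) x : ((dmor f X)^-1)%VF (dmor f X x) = x.
  exact: lker0_lfunK.
have K2 L (X : lt L) y : dmor f X (((dmor f X)^-1)%VF y) = y.
  by apply: limg_lfunVK; rewrite dl_surj ?memvf // (dmor_iso f X).
have h1 L (X : lt L) : lker ((dmor f X)^-1)%VF = 0%VS.
  by apply/eqP/lker0P => x y e; rewrite -(K2 _ X x) e K2.
have h2 (L0 L1 : ind (pro (finvect k))) (X0 : lt L0) (X1 : lt L1)
      (u : hom L0 L1) (W : vectType k) (p : hom L1 (const (W : finvect k)))
      (H : quo X0 X1 u p) (x : dl E X0) (d : Det W) :
    ((dmor f X1)^-1)%VF (dphi E H x d) = dphi D H (((dmor f X0)^-1)%VF x) d.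
  by rewrite -{1}(K2 _ X0 x) -dmor_phi K1.
exists (@DetMor E D (fun L X => (dmor f X)^-1)%VF h1 h2); split;
  apply: detmor_ext => L X x /=; by rewrite comp_lfunE id_lfunE ?K1 ?K2.
Qed.

Definition det_cat : category.
refine (@Category dettheory detmor detmor_id detmor_comp _ _ _).
- by move=> *; apply: detmor_ext => * /=; rewrite comp_lfunE id_lfunE.
- by move=> *; apply: detmor_ext => * /=; rewrite comp_lfunE id_lfunE.
- by move=> *; apply: detmor_ext => * /=; rewrite !comp_lfunE.
Defined.

Definition det_gerbe : gpd k.
refine (@Gpd k det_cat (@detmor_inv) (fun t D => detmor_scal t D) _ _ _).
- by move=> D; apply: detmor_ext => * /=; rewrite scale_lfunE id_lfunE scale1r.
- move=> s t D; apply: detmor_ext => * /=.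
  by rewrite comp_lfunE !scale_lfunE !id_lfunE scalerA.
- move=> t D E f; apply: detmor_ext => * /=.
  by rewrite !comp_lfunE !scale_lfunE !id_lfunE linearZ.
Defined.

End DetTheory.

End Determinants.

Section Bifunctors.
Variables (k : fieldType) (A B G : gpd k) (F : gfun (gtens A B) G).

(* F (a (x) b) and F (f (x) g). *)
Definition bob (a : A) (b : B) : G := F (a, b).

Definition bmap (a a' : A) (b b' : B) (f : hom a a') (g : hom b b') :
    hom (bob a b) (bob a' b') :=
  fmap F (@tens k A B (a, b) (a', b') f g : @hom (gtens A B) (a, b) (a', b')).

End Bifunctors.

Section DetMult.
Variable k : fieldType.
Notation T1 := (tate k 1).
Notation DD := (@det_gerbe k).

(* The objects A i j are the subquotients V_j / V_i of a filtration
   0 = V_0, V_1, V_2, V_3 of V_3 = A 0 3. *)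
Definition tet (A01 A02 A03 A12 A13 A23 : T1)
    (i012 : hom A01 A02) (p012 : hom A02 A12) (i013 : hom A01 A03) (p013 : hom A03 A13)
    (i023 : hom A02 A03) (p023 : hom A03 A23) (i123 : hom A12 A13) (p123 : hom A13 A23) : Prop :=
  [/\ i023 \oc i012 = i013, p123 \oc p013 = p023 & p013 \oc i023 = i123 \oc p012].

(* The multiplicative structure of the determinant gerbes [DD]: an equivalence
     DD(V') (x) DD(V'') -> DD(V)
   for each exact sequence, for V_1 < V_2 < V_3 a natural transformation between the
   two equivalences
     DD(V_1) (x) DD(V_2/V_1) (x) DD(V_3/V_2) -> DD(V_3),
   and for V_1 < V_2 < V_3 < V_4 the commutation of the cube formed by these (one of
   its six faces is an interchange identity, whence a pentagon).  All morphisms of a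
   tensor product are pure tensors, so [da_nat] is naturality on the triple tensor.  No formula for these data is fixed: every
   choice of them is allowed. *)
Record detmult : Type := DetMult {
  dm : forall (A B C : T1) (i : hom A B) (p : hom B C),
    ses i p -> gfun (gtens (DD A) (DD C)) (DD B);
  dm_equiv : forall (A B C : T1) (i : hom A B) (p : hom B C) (s : ses i p),
    is_equiv (dm s);
  da : forall (A01 A02 A03 A12 A13 A23 : T1)
      (i012 : hom A01 A02) (p012 : hom A02 A12) (i013 : hom A01 A03) (p013 : hom A03 A13)
      (i023 : hom A02 A03) (p023 : hom A03 A23) (i123 : hom A12 A13) (p123 : hom A13 A23)
      (s012 : ses i012 p012) (s013 : ses i013 p013)
      (s023 : ses i023 p023) (s123 : ses i123 p123),
    tet i012 p012 i013 p013 i023 p023 i123 p123 ->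
    forall (a : DD A01) (b : DD A12) (c : DD A23),
    hom (bob (dm s023) (bob (dm s012) a b) c) (bob (dm s013) a (bob (dm s123) b c));
  da_nat : forall (A01 A02 A03 A12 A13 A23 : T1)
      (i012 : hom A01 A02) (p012 : hom A02 A12) (i013 : hom A01 A03) (p013 : hom A03 A13)
      (i023 : hom A02 A03) (p023 : hom A03 A23) (i123 : hom A12 A13) (p123 : hom A13 A23)
      (s012 : ses i012 p012) (s013 : ses i013 p013)
      (s023 : ses i023 p023) (s123 : ses i123 p123)
      (t : tet i012 p012 i013 p013 i023 p023 i123 p123)
      (a a' : DD A01) (b b' : DD A12) (c c' : DD A23)
      (f : hom a a') (g : hom b b') (h : hom c c'),
    da s012 s013 s023 s123 t a' b' c' \oc bmap (dm s023) (bmap (dm s012) f g) h =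
    bmap (dm s013) f (bmap (dm s123) g h) \oc da s012 s013 s023 s123 t a b c;
  da_cube : forall (A01 A02 A03 A04 A12 A13 A14 A23 A24 A34 : T1)
      (i012 : hom A01 A02) (p012 : hom A02 A12) (i013 : hom A01 A03) (p013 : hom A03 A13)
      (i014 : hom A01 A04) (p014 : hom A04 A14) (i023 : hom A02 A03) (p023 : hom A03 A23)
      (i024 : hom A02 A04) (p024 : hom A04 A24) (i034 : hom A03 A04) (p034 : hom A04 A34)
      (i123 : hom A12 A13) (p123 : hom A13 A23) (i124 : hom A12 A14) (p124 : hom A14 A24)
      (i134 : hom A13 A14) (p134 : hom A14 A34) (i234 : hom A23 A24) (p234 : hom A24 A34)
      (s012 : ses i012 p012) (s013 : ses i013 p013) (s014 : ses i014 p014)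
      (s023 : ses i023 p023) (s024 : ses i024 p024) (s034 : ses i034 p034)
      (s123 : ses i123 p123) (s124 : ses i124 p124) (s134 : ses i134 p134)
      (s234 : ses i234 p234)
      (t0123 : tet i012 p012 i013 p013 i023 p023 i123 p123)
      (t0124 : tet i012 p012 i014 p014 i024 p024 i124 p124)
      (t0134 : tet i013 p013 i014 p014 i034 p034 i134 p134)
      (t0234 : tet i023 p023 i024 p024 i034 p034 i234 p234)
      (t1234 : tet i123 p123 i124 p124 i134 p134 i234 p234)
      (a : DD A01) (b : DD A12) (c : DD A23) (d : DD A34),
    bmap (dm s014) (idm a) (da s123 s124 s134 s234 t1234 b c d)
      \oc (da s013 s014 s034 s134 t0134 a (bob (dm s123) b c) d
      \oc bmap (dm s034) (da s012 s013 s023 s123 t0123 a b c) (idm d)) =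
    da s012 s014 s024 s124 t0124 a b (bob (dm s234) c d)
      \oc da s023 s024 s034 s234 t0234 (bob (dm s012) a b) c d }.

End DetMult.

Section Gerbel.
Variables (k : fieldType) (M : detmult k) (V : tate k 2).
Notation T1 := (tate k 1).
Notation DD := (@det_gerbe k).
Notation IP := (ind (pro T1)).
Notation lt := (@lat T1 (sval V)).

(* The equivalence D(X1) -> D(X0) (x) DD(X1/X0) attached to lattices X0 < X1 is
   given by its inverse [gphi]; as for determinant theories, it is given for every
   choice (W, p) of the quotient.  [gnat] compares the two equivalences
     D(X0) (x) DD(X1/X0) (x) DD(X2/X1) -> D(X2). *)
Record gerbel : Type := Gerbel {
  gob : forall L : IP, lt L -> gpd k;
  gob_gerbe : forall (L : IP) (X : lt L), is_gerbe (gob X);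
  gphi : forall (L0 L1 : IP) (X0 : lt L0) (X1 : lt L1) (u : hom L0 L1)
      (W : T1) (p : hom L1 (const W)),
    quo X0 X1 u p -> gfun (gtens (gob X0) (DD W)) (gob X1);
  gphi_equiv : forall (L0 L1 : IP) (X0 : lt L0) (X1 : lt L1) (u : hom L0 L1)
      (W : T1) (p : hom L1 (const W)) (H : quo X0 X1 u p), is_equiv (gphi H);
  gnat : forall (L0 L1 L2 : IP) (X0 : lt L0) (X1 : lt L1) (X2 : lt L2)
      (u01 : hom L0 L1) (u02 : hom L0 L2) (u12 : hom L1 L2) (W01 W02 W12 : T1)
      (p01 : hom L1 (const W01)) (p02 : hom L2 (const W02)) (p12 : hom L2 (const W12))
      (i : hom W01 W02) (q : hom W02 W12)
      (H01 : quo X0 X1 u01 p01) (H02 : quo X0 X2 u02 p02) (H12 : quo X1 X2 u12 p12)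
      (s : ses i q),
    qtri u12 p01 p02 p12 i q ->
    forall (x : gob X0) (a : DD W01) (b : DD W12),
    hom (bob (gphi H12) (bob (gphi H01) x a) b) (bob (gphi H02) x (bob (dm M s) a b));
  gnat_nat : forall (L0 L1 L2 : IP) (X0 : lt L0) (X1 : lt L1) (X2 : lt L2)
      (u01 : hom L0 L1) (u02 : hom L0 L2) (u12 : hom L1 L2) (W01 W02 W12 : T1)
      (p01 : hom L1 (const W01)) (p02 : hom L2 (const W02)) (p12 : hom L2 (const W12))
      (i : hom W01 W02) (q : hom W02 W12)
      (H01 : quo X0 X1 u01 p01) (H02 : quo X0 X2 u02 p02) (H12 : quo X1 X2 u12 p12)
      (s : ses i q) (t : qtri u12 p01 p02 p12 i q)
      (x x' : gob X0) (a a' : DD W01) (b b' : DD W12)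
      (f : hom x x') (g : hom a a') (h : hom b b'),
    gnat H01 H02 H12 s t x' a' b' \oc bmap (gphi H12) (bmap (gphi H01) f g) h =
    bmap (gphi H02) f (bmap (dm M s) g h) \oc gnat H01 H02 H12 s t x a b;
  gcube : forall (L0 L1 L2 L3 : IP) (X0 : lt L0) (X1 : lt L1) (X2 : lt L2) (X3 : lt L3)
      (u01 : hom L0 L1) (u02 : hom L0 L2) (u03 : hom L0 L3)
      (u12 : hom L1 L2) (u13 : hom L1 L3) (u23 : hom L2 L3)
      (W01 W02 W03 W12 W13 W23 : T1)
      (p01 : hom L1 (const W01)) (p02 : hom L2 (const W02)) (p03 : hom L3 (const W03))
      (p12 : hom L2 (const W12)) (p13 : hom L3 (const W13)) (p23 : hom L3 (const W23))
      (i012 : hom W01 W02) (q012 : hom W02 W12) (i013 : hom W01 W03) (q013 : hom W03 W13)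
      (i023 : hom W02 W03) (q023 : hom W03 W23) (i123 : hom W12 W13) (q123 : hom W13 W23)
      (H01 : quo X0 X1 u01 p01) (H02 : quo X0 X2 u02 p02) (H03 : quo X0 X3 u03 p03)
      (H12 : quo X1 X2 u12 p12) (H13 : quo X1 X3 u13 p13) (H23 : quo X2 X3 u23 p23)
      (s012 : ses i012 q012) (s013 : ses i013 q013)
      (s023 : ses i023 q023) (s123 : ses i123 q123)
      (t012 : qtri u12 p01 p02 p12 i012 q012) (t013 : qtri u13 p01 p03 p13 i013 q013)
      (t023 : qtri u23 p02 p03 p23 i023 q023) (t123 : qtri u23 p12 p13 p23 i123 q123)
      (t : tet i012 q012 i013 q013 i023 q023 i123 q123)
      (x : gob X0) (a : DD W01) (b : DD W12) (c : DD W23),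
    bmap (gphi H03) (idm x) (da M s012 s013 s023 s123 t a b c)
      \oc (gnat H02 H03 H23 s023 t023 x (bob (dm M s012) a b) c
      \oc bmap (gphi H23) (gnat H01 H02 H12 s012 t012 x a b) (idm c)) =
    gnat H01 H03 H13 s013 t013 x a (bob (dm M s123) b c)
      \oc gnat H12 H13 H23 s123 t123 (bob (gphi H01) x a) b c }.

End Gerbel.

Arguments gnat {_ _ _} _ {_ _ _ _ _ _ _ _ _ _ _ _ _ _ _ _ _} _ _ _ _ _ _ _ _.

Definition eqhom (C : category) (a b : C) (e : a = b) : hom a b :=
  match e in _ = b' return hom a b' with erefl => idm a end.

Lemma eqhom_id (C : category) (a : C) (e : a = a) : eqhom e = idm a.
Proof. by rewrite (Prop_irrelevance e erefl). Qed.

Lemma gfun_ext (k : fieldType) (G H : gpd k) (F F' : gfun G H)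
    (e : forall a, F a = F' a) :
  (forall a b (f : hom a b), eqhom (e b) \oc fmap F f = fmap F' f \oc eqhom (e a)) -> F = F'.
Proof.
case: F F' e => [F m h1 h2 h3] [F' m' h1' h2' h3'] /= e.
have e' : F = F' by apply: funext.
subst F' => em; have e' : m = m'.
  apply: functional_extensionality_dep => a; apply: functional_extensionality_dep => b.
  apply: funext => f; by move: (em a b f); rewrite !eqhom_id comp1m compm1.
by subst m'; congr GFun; apply: Prop_irrelevance.
Qed.

Section GfunLaws.
Variables (k : fieldType) (G H K L : gpd k).

Lemma gfun_comp1l (F : gfun G H) : gfun_comp (gfun_id H) F = F.
Proof.
by apply: (@gfun_ext k G H (gfun_comp (gfun_id H) F) F (fun=> erefl)) => a b f;
  rewrite /= comp1m compm1.
Qed.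

Lemma gfun_comp1r (F : gfun G H) : gfun_comp F (gfun_id G) = F.
Proof.
by apply: (@gfun_ext k G H (gfun_comp F (gfun_id G)) F (fun=> erefl)) => a b f;
  rewrite /= comp1m compm1.
Qed.

Lemma gfun_compA (F1 : gfun K L) (F2 : gfun H K) (F3 : gfun G H) :
  gfun_comp F1 (gfun_comp F2 F3) = gfun_comp (gfun_comp F1 F2) F3.
Proof.
by apply: (@gfun_ext k G L (gfun_comp F1 (gfun_comp F2 F3))
  (gfun_comp (gfun_comp F1 F2) F3) (fun=> erefl)) => a b f; rewrite /= comp1m compm1.
Qed.

End GfunLaws.

Section Gerbel2.
Variables (k : fieldType) (M : detmult k) (V : tate k 2).
Notation T1 := (tate k 1).
Notation DD := (@det_gerbe k).
Notation IP := (ind (pro T1)).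
Notation lt := (@lat T1 (sval V)).
Notation gerbel := (gerbel M V).
Implicit Types D E F : gerbel.

(* The 1-arrows of the 2-groupoid of gerbel theories: functors between the gerbes,
   automatically equivalences, compatible with [gphi] up to natural isomorphisms [ac]
   that are themselves compatible with [gnat]. *)
Record garr D E : Type := GArr {
  af : forall (L : IP) (X : lt L), gfun (gob D X) (gob E X);
  ac : forall (L0 L1 : IP) (X0 : lt L0) (X1 : lt L1) (u : hom L0 L1)
      (W : T1) (p : hom L1 (const W)) (H : quo X0 X1 u p) (x : gob D X0) (a : DD W),
    hom (af X1 (bob (gphi D H) x a)) (bob (gphi E H) (af X0 x) a);
  ac_nat : forall (L0 L1 : IP) (X0 : lt L0) (X1 : lt L1) (u : hom L0 L1)
      (W : T1) (p : hom L1 (const W)) (H : quo X0 X1 u p) (x x' : gob D X0) (a a' : DD W)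
      (f : hom x x') (g : hom a a'),
    ac H x' a' \oc fmap (af X1) (bmap (gphi D H) f g) =
    bmap (gphi E H) (fmap (af X0) f) g \oc ac H x a;
  ac_tri : forall (L0 L1 L2 : IP) (X0 : lt L0) (X1 : lt L1) (X2 : lt L2)
      (u01 : hom L0 L1) (u02 : hom L0 L2) (u12 : hom L1 L2) (W01 W02 W12 : T1)
      (p01 : hom L1 (const W01)) (p02 : hom L2 (const W02)) (p12 : hom L2 (const W12))
      (i : hom W01 W02) (q : hom W02 W12)
      (H01 : quo X0 X1 u01 p01) (H02 : quo X0 X2 u02 p02) (H12 : quo X1 X2 u12 p12)
      (s : ses i q) (t : qtri u12 p01 p02 p12 i q)
      (x : gob D X0) (a : DD W01) (b : DD W12),
    gnat E H01 H02 H12 s t (af X0 x) a b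
      \oc (bmap (gphi E H12) (ac H01 x a) (idm b) \oc ac H12 (bob (gphi D H01) x a) b) =
    ac H02 x (bob (dm M s) a b) \oc fmap (af X2) (gnat D H01 H02 H12 s t x a b) }.

Lemma garr_ext D E (f g : garr D E) (e : forall L (X : lt L), af f X = af g X) :
  (forall (L0 L1 : IP) (X0 : lt L0) (X1 : lt L1) (u : hom L0 L1)
      (W : T1) (p : hom L1 (const W)) (H : quo X0 X1 u p) (x : gob D X0) (a : DD W)
      (e1 : af f X1 (bob (gphi D H) x a) = af g X1 (bob (gphi D H) x a))
      (e2 : bob (gphi E H) (af f X0 x) a = bob (gphi E H) (af g X0 x) a),
    eqhom e2 \oc ac f H x a = ac g H x a \oc eqhom e1) -> f = g.
Proof.
case: f g e => [f c h1 h2] [g c' h1' h2'] /= e.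
have e' : f = g.
  by apply: functional_extensionality_dep => L; apply: functional_extensionality_dep => X.
subst g => ec; have e' : c = c'.
  apply: functional_extensionality_dep => L0; apply: functional_extensionality_dep => L1.
  apply: functional_extensionality_dep => X0; apply: functional_extensionality_dep => X1.
  apply: functional_extensionality_dep => u; apply: functional_extensionality_dep => W.
  apply: functional_extensionality_dep => p; apply: functional_extensionality_dep => H.
  apply: functional_extensionality_dep => x; apply: functional_extensionality_dep => a.
  by move: (ec _ _ _ _ _ _ _ H x a erefl erefl); rewrite /= comp1m compm1.
by subst c'; congr GArr; apply: Prop_irrelevance.
Qed.

Definition garr_id D : garr D D.
refine (@GArr D D (fun L X => gfun_id (gob D X)) (fun _ _ _ _ _ _ _ H x a => idm _) _ _).
- by move=> *; rewrite comp1m compm1.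
- move=> *; rewrite /bmap.
  by rewrite -[tens _ _]/(idm (_ : gtens _ _)) fmap_id !compm1 comp1m.
Defined.

Lemma bmap_comp (A B G : gpd k) (Fi : gfun (gtens A B) G) (a a' a'' : A) (b b' b'' : B)
    (f : hom a' a'') (f' : hom a a') (g : hom b' b'') (g' : hom b b') :
  bmap Fi f g \oc bmap Fi f' g' = bmap Fi (f \oc f') (g \oc g').
Proof. by rewrite /bmap -fmap_comp /= thom_compE. Qed.

Lemma bmap_compl (A B G : gpd k) (Fi : gfun (gtens A B) G) (a a' a'' : A) (b : B)
    (f : hom a' a'') (f' : hom a a') :
  bmap Fi (f \oc f') (idm b) = bmap Fi f (idm b) \oc bmap Fi f' (idm b).
Proof. by rewrite bmap_comp comp1m. Qed.

Definition garr_comp D E F (g : garr E F) (f : garr D E) : garr D F.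
refine (@GArr D F (fun L X => gfun_comp (af g X) (af f X))
  (fun L0 L1 X0 X1 u W p H x a => ac g H (af f X0 x) a \oc fmap (af g X1) (ac f H x a)) _ _).
- move=> L0 L1 X0 X1 u W p H x x' a a' h h' /=.
  by rewrite -compA -fmap_comp ac_nat fmap_comp !compA ac_nat.
- move=> L0 L1 L2 X0 X1 X2 u01 u02 u12 W01 W02 W12 p01 p02 p12 i q H01 H02 H12 s t x a b /=.
  rewrite bmap_compl.
  rewrite -(compA (ac g H02 _ _)) -fmap_comp -ac_tri !fmap_comp.
  rewrite !compA -ac_tri -!compA; congr comp; congr comp; rewrite !compA; congr comp.
  by rewrite ac_nat.
Defined.

Definition garr_cast D E (e : D = E) : garr D E :=
  match e in _ = E' return garr D E' with erefl => garr_id D end.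

Record garr2 D E (f g : garr D E) : Type := GArr2 {
  a2 : forall L (X : lt L) (x : gob D X), hom (af f X x) (af g X x);
  a2_nat : forall L (X : lt L) (x y : gob D X) (h : hom x y),
    a2 y \oc fmap (af f X) h = fmap (af g X) h \oc a2 x;
  a2_ac : forall (L0 L1 : IP) (X0 : lt L0) (X1 : lt L1) (u : hom L0 L1)
      (W : T1) (p : hom L1 (const W)) (H : quo X0 X1 u p) (x : gob D X0) (a : DD W),
    bmap (gphi E H) (a2 x) (idm a) \oc ac f H x a = ac g H x a \oc a2 (bob (gphi D H) x a) }.

Lemma garr2_ext D E (f g : garr D E) (s t : garr2 f g) :
  (forall L (X : lt L) x, a2 s (X := X) x = a2 t x) -> s = t.
Proof.
case: s t => [s s1 s2] [t t1 t2] /= e.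
have e' : s = t.
  apply: functional_extensionality_dep => L; apply: functional_extensionality_dep => X.
  exact: functional_extensionality_dep.
by subst t; congr GArr2; apply: Prop_irrelevance.
Qed.

Definition garr2_id D E (f : garr D E) : garr2 f f.
refine (@GArr2 D E f f (fun L X x => idm _) _ _).
- by move=> *; rewrite comp1m compm1.
- move=> *; rewrite /bmap -[tens _ _]/(idm (_ : gtens _ _)) fmap_id comp1m compm1 //.
Defined.

Definition garr2_comp D E (f g h : garr D E) (t : garr2 g h) (s : garr2 f g) : garr2 f h.
refine (@GArr2 D E f h (fun L X x => a2 t x \oc a2 s x) _ _).
- by move=> L X x y m; rewrite -compA a2_nat !compA a2_nat.
- move=> L0 L1 X0 X1 u W p H x a.
  by rewrite bmap_compl -compA a2_ac !compA a2_ac.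
Defined.

Definition garr2_hcomp D E F (g g' : garr E F) (f f' : garr D E)
    (t : garr2 g g') (s : garr2 f f') : garr2 (garr_comp g f) (garr_comp g' f').
refine (@GArr2 D F (garr_comp g f) (garr_comp g' f')
  (fun L X x => a2 t (af f' X x) \oc fmap (af g X) (a2 s x)) _ _).
- move=> L X x y m /=.
  rewrite -compA -fmap_comp (a2_nat s) fmap_comp !compA. by rewrite (a2_nat t).
- move=> L0 L1 X0 X1 u W p H x a /=.
  rewrite bmap_compl.
  rewrite -(compA (ac g' H _ _)) (compA (fmap _ _)) .
  rewrite -(a2_nat t) -!compA -fmap_comp -a2_ac fmap_comp.
  rewrite !compA -(a2_ac t) -!compA; congr comp; rewrite !compA; congr comp.
  by rewrite ac_nat.
Defined.

End Gerbel2.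

Section GroupLemmas.
Variable G : group.
Implicit Types x y : G.

Lemma gmulVr x : gmul x (ginv x) = gone.
Proof.
rewrite -[LHS]gmul1 -{1}(gmulV (ginv x)) -gmulA (gmulA (ginv x)) gmulV gmul1.
exact: gmulV.
Qed.

Lemma gmulr1 x : gmul x gone = x.
Proof. by rewrite -(gmulV x) gmulA gmulVr gmul1. Qed.

Lemma ginvM x y : ginv (gmul x y) = gmul (ginv y) (ginv x).
Proof.
have e : gmul (gmul x y) (gmul (ginv y) (ginv x)) = gone.
  by rewrite -gmulA (gmulA y) gmulVr gmul1 gmulVr.
by rewrite -[LHS]gmulr1 -e gmulA gmulV gmul1.
Qed.

Lemma ginv1 : ginv gone = gone :> G.
Proof. by rewrite -[LHS]gmulr1 gmulV. Qed.

End GroupLemmas.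

Section Action.
Variables (k : fieldType) (M : detmult k) (V : tate k 2).
Notation T1 := (tate k 1).
Notation DD := (@det_gerbe k).
Notation IP := (ind (pro T1)).
Notation lt := (@lat T1 (sval V)).
Notation gerbel := (gerbel M V).
Implicit Types D E F : gerbel.

Definition GL : group := @Aut (tate k 2) V.

Lemma lact_proof (g : GL) (L : IP) (X : lt L) :
  is_lattice (@comp IP _ _ _ (sval g) (sval X)).
Proof.
have [h [e1 e2]] := svalP g.
have [cL [Q [q [dQ [I [J [F1 [F2 [F3 [s [t [st [a [b [c [[ia ib ic] [r1 r2]]]]]]]]]]]]]]]]] := svalP X.
split=> //; exists Q, (@comp IP _ _ _ q h); split => //.
exists I, J, F1, F2, F3, s, t; split => //; exists a, (@comp IP _ _ _ b h), c.
split; first by split=> //; apply: (@iso_comp IP) => //; exists (sval g).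
split; last by rewrite (@compA IP) r2 -(@compA IP).
rewrite -r1 -(@compA IP) (@compA IP _ _ _ _ h).
by rewrite (e1 : @comp IP _ _ _ h (sval g) = _) (@comp1m IP).
Qed.

(* Transformations of the lattices of V preserving the underlying objects and
   the inclusions. *)
Record ltrans : Type := LTrans {
  ltr :> forall L : IP, lt L -> lt L;
  ltrP : forall (L0 L1 : IP) (X0 : lt L0) (X1 : lt L1) (u : hom L0 L1),
    sval X1 \oc u = sval X0 -> sval (ltr X1) \oc u = sval (ltr X0) }.

Lemma ltrans_ext (s t : ltrans) : (forall L (X : lt L), s L X = t L X) -> s = t.
Proof.
case: s t => [s hs] [t ht] /= e; have e' : s = t.
  by apply: functional_extensionality_dep => L; apply: functional_extensionality_dep => X.
by subst t; congr LTrans; apply: Prop_irrelevance.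
Qed.

Definition ltr_id : ltrans := @LTrans (fun L X => X) (fun _ _ _ _ _ e => e).
Definition ltr_comp (s t : ltrans) : ltrans :=
  @LTrans (fun L X => s L (t L X)) (fun _ _ _ _ _ e => ltrP s (ltrP t e)).

Definition quo_ltr (s : ltrans) (L0 L1 : IP) (X0 : lt L0) (X1 : lt L1) (u : hom L0 L1)
    (W : T1) (p : hom L1 (const W)) (H : quo X0 X1 u p) : quo (s L0 X0) (s L1 X1) u p :=
  conj (ltrP s (let: conj e _ := H in e)) (let: conj _ l := H in l).

Definition lact (g : GL) : ltrans.
refine (@LTrans (fun L X => exist _ (@comp IP _ _ _ (sval g) (sval X)) (lact_proof g X)) _).
move=> L0 L1 X0 X1 u e /=; rewrite -e; exact/esym/(@compA IP).
Defined.

Lemma lat_ext L (X Y : lt L) : sval X = sval Y -> X = Y.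
Proof. by case: X Y => [X hX] [Y hY] /= e; apply: eq_exist. Qed.

Lemma lact1 : lact gone = ltr_id.
Proof. by apply: ltrans_ext => L X; apply: lat_ext; exact: (@comp1m IP). Qed.

Lemma lactM g h : lact (gmul g h) = ltr_comp (lact g) (lact h).
Proof. by apply: ltrans_ext => L X; apply: lat_ext; exact/esym/(@compA IP). Qed.

(* [Q] is a parameter, rather than [@quo_ltr s], so that proof irrelevance can replace
   it by the identity when s is [ltr_id]. *)
Section Pull.
Variables (s : ltrans)
  (Q : forall (L0 L1 : IP) (X0 : lt L0) (X1 : lt L1) (u : hom L0 L1)
    (W : T1) (p : hom L1 (const W)), quo X0 X1 u p -> quo (s L0 X0) (s L1 X1) u p).

Definition pullQ D : gerbel :=
  @Gerbel k M V (fun L X => gob D (s L X)) (fun L X => gob_gerbe D (s L X))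
    (fun _ _ _ _ _ _ _ H => gphi D (Q H))
    (fun _ _ _ _ _ _ _ H => gphi_equiv D (Q H))
    (fun _ _ _ _ _ _ _ _ _ _ _ _ _ _ _ _ _ H01 H02 H12 S t x a b =>
       gnat D (Q H01) (Q H02) (Q H12) S t x a b)
    (fun _ _ _ _ _ _ _ _ _ _ _ _ _ _ _ _ _ H01 H02 H12 S t x x' a a' b b' f g h =>
       gnat_nat (Q H01) (Q H02) (Q H12) S t f g h)
    (fun _ _ _ _ _ _ _ _ _ _ _ _ _ _ _ _ _ _ _ _ _ _ _ _ _ _ _ _ _ _ _ _ _ _
         H01 H02 H03 H12 H13 H23 s1 s2 s3 s4 t1 t2 t3 t4 t x a b c =>
       gcube (Q H01) (Q H02) (Q H03) (Q H12) (Q H13) (Q H23)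
         s1 s2 s3 s4 t1 t2 t3 t4 t x a b c).

Definition pullQ1 D E (f : garr D E) : garr (pullQ D) (pullQ E) :=
  @GArr k M V (pullQ D) (pullQ E) (fun L X => af f (s L X))
    (fun _ _ _ _ _ _ _ H x a => ac f (Q H) x a)
    (fun _ _ _ _ _ _ _ H x x' a a' h h' => ac_nat f (Q H) h h')
    (fun _ _ _ _ _ _ _ _ _ _ _ _ _ _ _ _ _ H01 H02 H12 S t x a b =>
       ac_tri f (Q H01) (Q H02) (Q H12) S t x a b).

Definition pullQ2 D E (f g : garr D E) (t : garr2 f g) : garr2 (pullQ1 f) (pullQ1 g) :=
  @GArr2 k M V (pullQ D) (pullQ E) (pullQ1 f) (pullQ1 g)
    (fun L X x => a2 t (X := s L X) x) (fun L X x y h => a2_nat t (X := s L X) h)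
    (fun _ _ _ _ _ _ _ H x a => a2_ac t (Q H) x a).

End Pull.

Definition pull (s : ltrans) D : gerbel := pullQ (@quo_ltr s) D.
Definition pull1 (s : ltrans) D E (f : garr D E) : garr (pull s D) (pull s E) :=
  pullQ1 (@quo_ltr s) f.
Definition pull2 (s : ltrans) D E (f g : garr D E) (t : garr2 f g) :
  garr2 (pull1 s f) (pull1 s g) := pullQ2 (@quo_ltr s) t.

Lemma pull_id D : pull ltr_id D = D.
Proof.
transitivity (@pullQ ltr_id (fun _ _ _ _ _ _ _ H => H) D); last by case: D.
exact: (f_equal (fun Q => @pullQ ltr_id Q D) (Prop_irrelevance _ _)).
Qed.

Lemma pull_comp s t D : pull t (pull s D) = pull (ltr_comp s t) D.
Proof. reflexivity. Qed.

(* The action of GL(V) by translation: (g . D)(X) = D(g^-1 X).  It is strict, see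
   [gact1], [gactM], [gactM_nat] and [gact1_nat] below. *)
Definition gact (g : GL) (D : gerbel) : gerbel := pull (lact (ginv g)) D.

Lemma gact1 D : gact gone D = D.
Proof. by rewrite /gact ginv1 lact1 pull_id. Qed.

Lemma gactM g h D : gact (gmul g h) D = gact g (gact h D).
Proof. by rewrite /gact pull_comp ginvM lactM. Qed.

Definition gact_arr (g : GL) D E (f : garr D E) : garr (gact g D) (gact g E) :=
  pull1 (lact (ginv g)) f.
Definition gact_arr2 (g : GL) D E (f f' : garr D E) (t : garr2 f f') :
    garr2 (gact_arr g f) (gact_arr g f') := pull2 (lact (ginv g)) t.


Lemma garr_castid D (e : D = D) : garr_cast e = garr_id D.
Proof. by rewrite (Prop_irrelevance e erefl). Qed.

Lemma garr_comp1l D E (f : garr D E) : garr_comp (garr_id E) f = f.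
Proof.
apply: garr_ext => [L X|L0 L1 X0 X1 u W p H x a e1 e2].
  exact: gfun_comp1l.
by rewrite (eqhom_id e1) (eqhom_id e2) /= comp1m compm1 comp1m.
Qed.

Lemma garr_comp1r D E (f : garr D E) : garr_comp f (garr_id D) = f.
Proof.
apply: garr_ext => [L X|L0 L1 X0 X1 u W p H x a e1 e2].
  exact: gfun_comp1r.
by rewrite (eqhom_id e1) (eqhom_id e2) /= fmap_id comp1m !compm1.
Qed.

Lemma garr_compA D E F G (h : garr F G) (g : garr E F) (f : garr D E) :
  garr_comp h (garr_comp g f) = garr_comp (garr_comp h g) f.
Proof.
apply: garr_ext => [L X|L0 L1 X0 X1 u W p H x a e1 e2].
  exact: gfun_compA.
by rewrite (eqhom_id e1) (eqhom_id e2) /= comp1m compm1 fmap_comp compA.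
Qed.

Lemma pullQ1_id s Q D : @pullQ1 s Q _ _ (garr_id D) = garr_id _.
Proof.
apply: garr_ext => [L X|L0 L1 X0 X1 u W p H x a e1 e2] //.
by rewrite (eqhom_id e1) (eqhom_id e2) /= comp1m.
Qed.

Lemma garr_pi D E o c h1 h2 h1' h2' :
  @GArr k M V D E o c h1 h2 = @GArr k M V D E o c h1' h2'.
Proof. by congr GArr; apply: Prop_irrelevance. Qed.

Lemma pullQ1_comp s Q D E F (g : garr E F) (f : garr D E) :
  @pullQ1 s Q _ _ (garr_comp g f) = garr_comp (pullQ1 Q g) (pullQ1 Q f).
Proof. exact: garr_pi. Qed.

Lemma gact_arr_comp g D E F (f : garr E F) (f' : garr D E) :
  gact_arr g (garr_comp f f') = garr_comp (gact_arr g f) (gact_arr g f').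
Proof. exact: pullQ1_comp. Qed.

Lemma gact_cast g D E (e : D = E) :
  gact_arr g (garr_cast e) = garr_cast (f_equal (gact g) e).
Proof. case: E / e; exact: pullQ1_id. Qed.

Lemma garr_cast_comp D E F (e : D = E) (e' : E = F) :
  garr_comp (garr_cast e') (garr_cast e) = garr_cast (etrans e e').
Proof. by case: F / e' => /=; rewrite garr_comp1l. Qed.

Lemma pull1_nat s t D E (f : garr D E) (es : s = t)
    (eD : pull t D = pull s D) (eE : pull t E = pull s E) :
  garr_comp (pull1 s f) (garr_cast eD) = garr_comp (garr_cast eE) (pull1 t f).
Proof.
case: t / es eD eE => eD eE.
by rewrite !garr_castid garr_comp1l garr_comp1r.
Qed.

Lemma pull1_id_nat D E (f : garr D E) (eD : pull ltr_id D = D) (eE : pull ltr_id E = E) :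
  garr_comp (garr_cast eE) (pull1 ltr_id f) = garr_comp f (garr_cast eD).
Proof.
rewrite /pull1 /pull in eD eE *; move: (@quo_ltr ltr_id) eD eE => Q.
rewrite (Prop_irrelevance Q (fun _ _ _ _ _ _ _ H => H)) {Q}.
case: D E f => ? ? ? ? ? ? ? [? ? ? ? ? ? ?] [? ? ? ?] eD eE.
have -> : garr_cast eD = garr_id _ := garr_castid eD.
have -> : garr_cast eE = garr_id _ := garr_castid eE.
by rewrite [LHS]garr_comp1l [RHS]garr_comp1r.
Qed.

Lemma gactM_nat g h D E (f : garr D E) :
  garr_comp (gact_arr g (gact_arr h f)) (garr_cast (gactM g h D)) =
  garr_comp (garr_cast (gactM g h E)) (gact_arr (gmul g h) f).
Proof.
apply: (@pull1_nat (ltr_comp (lact (ginv h)) (lact (ginv g)))).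
by rewrite ginvM lactM.
Qed.

Lemma gact1_nat D E (f : garr D E) :
  garr_comp (garr_cast (gact1 E)) (gact_arr gone f) = garr_comp f (garr_cast (gact1 D)).
Proof.
rewrite /gact_arr; move: (gact1 D) (gact1 E); rewrite /gact ginv1 lact1 => eD eE.
exact: pull1_id_nat.
Qed.

End Action.

(* The data of a monoidal category; the axioms are in [is_2group]. *)
Record mondata : Type := MonData {
  mcat :> category;
  mone : mcat;
  mtens : mcat -> mcat -> mcat;
  mtensm : forall a a' b b' : mcat, hom a a' -> hom b b' -> hom (mtens a b) (mtens a' b');
  massoc : forall a b c : mcat, hom (mtens (mtens a b) c) (mtens a (mtens b c));
  mlun : forall a : mcat, hom (mtens mone a) a;
  mrun : forall a : mcat, hom (mtens a mone) a }.
Arguments mone {_}.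
Arguments mtens {_} _ _.
Arguments mtensm {_ _ _ _ _} _ _.
Arguments massoc {_} _ _ _.
Arguments mlun {_} _.
Arguments mrun {_} _.

Record is_2group (E : mondata) : Prop := Is2Group {
  tg_iso : forall (a b : E) (f : hom a b), is_iso f;
  tg_id : forall a b : E, mtensm (idm a) (idm b) = idm (mtens a b);
  tg_comp : forall (a a' a'' b b' b'' : E) (f : hom a' a'') (f' : hom a a')
      (g : hom b' b'') (g' : hom b b'),
    mtensm (f \oc f') (g \oc g') = mtensm f g \oc mtensm f' g';
  tg_assoc : forall (a a' b b' c c' : E) (f : hom a a') (g : hom b b') (h : hom c c'),
    massoc a' b' c' \oc mtensm (mtensm f g) h = mtensm f (mtensm g h) \oc massoc a b c;
  tg_lun : forall (a a' : E) (f : hom a a'), mlun a' \oc mtensm (idm mone) f = f \oc mlun a;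
  tg_run : forall (a a' : E) (f : hom a a'), mrun a' \oc mtensm f (idm mone) = f \oc mrun a;
  tg_pentagon : forall a b c d : E,
    mtensm (idm a) (massoc b c d) \oc
      (massoc a (mtens b c) d \oc mtensm (massoc a b c) (idm d)) =
    massoc a b (mtens c d) \oc massoc (mtens a b) c d;
  tg_triangle : forall a b : E,
    mtensm (idm a) (mlun b) \oc massoc a mone b = mtensm (mrun a) (idm b);
  tg_inv : forall a : E, exists b : E,
    inhabited (hom (mtens a b) mone) /\ inhabited (hom (mtens b a) mone) }.

(* Central extensions by A of the discrete 2-group of G.  As that 2-group has only
   identity morphisms, a monoidal functor to it is a multiplicative map [pi] on objects
   that is constant on connected components; [ce_surj] and [ce_inj] say that it
   induces a bijection from the connected components of E to G. *)
Record is_central_extension (A G : group) (E : mondata) (pi : E -> G) : Prop :=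
  IsCentralExtension {
    ce_2group : is_2group E;
    ce_mul : forall a b : E, pi (mtens a b) = gmul (pi a) (pi b);
    ce_surj : forall g : G, exists a : E, pi a = g;
    ce_inj : forall a b : E, inhabited (hom a b) <-> pi a = pi b;
    ce_aut : exists s : A -> hom (@mone E) mone,
      bijective s /\ forall x y, s (gmul x y) = s x \oc s y }.

(* The 2-group associated to the action of GL(V) on the 2-groupoid of gerbel theories
   and to an object D of it: its objects are pairs of g in GL(V) and a 1-arrow
   g . D -> D, its morphisms are 2-arrows, and (g, f) (x) (h, f') is the composite
     (gh) . D = g . (h . D) --> g . D --> D
   of g . f' and f.  The action being strict, the tensor product is strictly
   associative and unital. *)
Section Stab.
Variables (k : fieldType) (M : detmult k) (V : tate k 2).
Variable D : gerbel M V.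
Notation G := (GL V).

Record sob : Type := SOb { sg : G; sf : garr (gact sg D) D }.

Definition strans (g h : G) (e : g = h) (f : garr (gact g D) D) : garr (gact h D) D :=
  match e in _ = h' return garr (gact h' D) D with erefl => f end.

Record shom (a b : sob) : Type := SHom {
  se : sg a = sg b;
  s2 : garr2 (strans se (sf a)) (sf b) }.

Definition shom_id (a : sob) : shom a a := @SHom a a erefl (garr2_id (sf a)).

Definition strans2 (g h : G) (e : g = h) (f f' : garr (gact g D) D) (t : garr2 f f') :
    garr2 (strans e f) (strans e f') :=
  match e in _ = h' return garr2 (strans (e : g = h') f) (strans (e : g = h') f') with
  | erefl => t end.

Lemma stransE g h l (e : g = h) (e' : h = l) f :
  strans (etrans e e') f = strans e' (strans e f).
Proof. by case: l / e'. Qed.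

Definition shom_comp (a b c : sob) (t : shom b c) (s : shom a b) : shom a c.
case: a b c t s => [g f] [g' f'] [g'' f''] [/= e t] [/= e' s].
move: f'' t; case: g'' / e => f'' t; move: f' f'' s t; case: g' / e' => f' f'' s t.
exact: (@SHom (SOb f) (SOb f'') erefl (garr2_comp t s)).
Defined.

Lemma shom_eq (g : G) (f f' : garr (gact g D) D) (t t' : garr2 f f') :
  t = t' -> @SHom (SOb f) (SOb f') erefl t = @SHom (SOb f) (SOb f') erefl t'.
Proof. by move=> ->. Qed.

Lemma shom_comp1 (a b : sob) (s : shom a b) : shom_comp (shom_id b) s = s.
Proof.
case: a b s => [g f] [g' f'] [/= e t]; move: f' t; case: g' / e => f' t.
by apply: shom_eq; apply: garr2_ext => L X x; exact: comp1m.
Qed.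

Lemma shom_1comp (a b : sob) (s : shom a b) : shom_comp s (shom_id a) = s.
Proof.
case: a b s => [g f] [g' f'] [/= e t]; move: f' t; case: g' / e => f' t.
by apply: shom_eq; apply: garr2_ext => L X x; exact: compm1.
Qed.

Lemma shom_compA (a b c d : sob) (r : shom c d) (s : shom b c) (t : shom a b) :
  shom_comp r (shom_comp s t) = shom_comp (shom_comp r s) t.
Proof.
case: a b c d r s t => [g1 f1] [g2 f2] [g3 f3] [g4 f4] [/= e t] [/= e' t'] [/= e'' t''].
move: f4 t; case: g4 / e => f4 t; move: f3 f4 t t'; case: g3 / e' => f3 f4 t t'.
move: f2 f3 f4 t t' t''; case: g2 / e'' => f2 f3 f4 t t' t''.
by apply: shom_eq; apply: garr2_ext => L X x; exact: compA.
Qed.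

Definition stab_cat : category :=
  @Category sob shom shom_id shom_comp shom_comp1 shom_1comp shom_compA.

Definition sone : sob := SOb (garr_cast (gact1 D)).

Definition stens (a b : sob) : sob :=
  @SOb (gmul (sg a) (sg b))
    (garr_comp (sf a)
      (garr_comp (gact_arr (sg a) (sf b)) (garr_cast (gactM (sg a) (sg b) D)))).

Definition stensm (a a' b b' : sob) (s : shom a a') (t : shom b b') :
  shom (stens a b) (stens a' b').
case: a a' b b' s t => [g f] [g' f'] [h m] [h' m'] [/= e s] [/= e' t].
move: f' s; case: g' / e => f' s; move: m' t; case: h' / e' => m' t.
exact: (@SHom (stens (SOb f) (SOb m)) (stens (SOb f') (SOb m')) erefl
  (garr2_hcomp s (garr2_hcomp (gact_arr2 g t) (garr2_id _)))).
Defined.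

Lemma sob_ext (a b : sob) (e : sg a = sg b) :
  (forall c : gact (sg a) D = gact (sg b) D, sf a = garr_comp (sf b) (garr_cast c)) -> a = b.
Proof.
case: a b e => [g f] [g' f'] /= e; move: f'; case: g' / e => f' /(_ erefl) /= ->.
by rewrite garr_comp1r.
Qed.

Lemma garr_cast_irr (E F : gerbel M V) (e e' : E = F) : garr_cast e = garr_cast e'.
Proof. by rewrite (Prop_irrelevance e e'). Qed.

Lemma stensA (a b c : sob) : stens (stens a b) c = stens a (stens b c).
Proof.
apply: sob_ext => /= [|e]; first exact: (esym (gmulA (sg a) (sg b) (sg c))).
rewrite !gact_arr_comp gact_cast -!garr_compA garr_cast_comp garr_cast_comp.
rewrite (garr_compA (garr_cast (gactM (sg a) (sg b) D))) -gactM_nat -!garr_compA.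
rewrite garr_cast_comp; do 3 apply: f_equal; exact: garr_cast_irr.
Qed.

Lemma stens1l (a : sob) : stens sone a = a.
Proof.
apply: sob_ext => /= [|e]; first exact: (gmul1 (sg a)).
rewrite garr_compA gact1_nat -garr_compA garr_cast_comp; apply: f_equal.
exact: garr_cast_irr.
Qed.

Lemma stens1r (a : sob) : stens a sone = a.
Proof.
apply: sob_ext => /= [|e]; first exact: (gmulr1 (sg a)).
rewrite gact_cast garr_cast_comp; apply: f_equal.
exact: garr_cast_irr.
Qed.

Definition stab : mondata :=
  @MonData stab_cat sone stens stensm
    (fun a b c => @eqhom stab_cat _ _ (stensA a b c))
    (fun a => @eqhom stab_cat _ _ (stens1l a))
    (fun a => @eqhom stab_cat _ _ (stens1r a)).

End Stab.

(* The trivial gerbe: one object with automorphism group G_m. *)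
Definition bgm_cat (k : fieldType) : category :=
  @Category unit (fun _ _ => Gm k) (fun _ => gone) (fun _ _ _ x y => gmul x y)
    (fun _ _ x => gmul1 x) (fun _ _ x => gmulr1 x) (fun _ _ _ _ x y z => gmulA x y z).

Definition bgm (k : fieldType) : gpd k.
refine (@Gpd k (bgm_cat k) _ (fun t _ => t) _ _ _) => //=.
- by move=> a b f; exists (ginv (f : Gm k)); split; [exact: (@gmulV (Gm k)) | exact: (@gmulVr (Gm k))].
- by move=> t a b f; exact: gmC.
Defined.

(* D is a gerbel theory attached to the lattice X: its value at X is identified with
   the trivial gerbe. *)
Definition trivialized (k : fieldType) (M : detmult k) (V : tate k 2)
    (L : ind (pro (tate k 1))) (X : @lat _ (sval V) L) (D : gerbel M V) : Prop :=
  exists b : gfun (bgm k) (gob D X), is_equiv b.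

(* Main.v *)
(* Proof.  All the exact sequences involved split: in Ind and Pro objects indexed by
   sequences, a levelwise split sequence with split transition maps splits, the splittings
   being adjusted one index at a time.  Hence any two nested lattices have a quotient,
   which is unique, and every lattice lies in all the late terms of one increasing
   sequence of lattices.  Consequently the complex of G_m-valued cochains on chains of
   nested lattices is acyclic: it is contracted onto a term of the sequence, the
   contractions being corrected so as to be compatible.

   In degree at most 2, acyclicity shows that determinant theories on a 1-Tate space form a
   G_m-gerbe, as bases of exterior powers compare through a 2-cocycle.  Trivialising every
   gerbe by a "charge", a morphism becomes a scalar.  The associativity of the
   multiplication of determinant gerbes is then a 3-cocycle of the lattices of a 2-Tate
   space, and a gerbel theory is a 2-cochain bounding it, a 1-arrow a 1-cochain bounding
   the difference of two such, a 2-arrow a 0-cochain.  So acyclicity in degrees 3, 2, 1, 0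
   gives the existence of a gerbel theory, of 1-arrows between two of them, of 2-arrows
   between parallel 1-arrows, and identifies the automorphisms of a 1-arrow with G_m.
   As GL(V) acts strictly, the monoidal laws hold up to equalities of objects. *)
From HB Require Import structures.
From mathcomp Require Import all_boot all_order all_algebra.
From mathcomp Require Import boolp.
Require Import Defs.

Set Implicit Arguments.
Unset Strict Implicit.
Unset Printing Implicit Defensive.

Import GRing.Theory.
Local Open Scope ring_scope.

(** * Split sequences in additive categories *)

(** Lattices have no common upper bound in general, so the cone onto N n contracts only the lattices
    of rank at most n, and the primitives of a cocycle found for different n need not agree. They
    are normalised: with h the contraction one degree lower, c - d(h c) depends only on dc, so
    normalised primitives of the same cocycle coincide wherever both are defined. Quotients are
    determined only up to isomorphism and the theories carry data for every choice of them, so an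
    edge of the complex is an inclusion together with a chosen quotient; parallel edges abound,
    edges are not composed, and the cones use arbitrarily chosen edges to N n. Quotients of nested
    lattices are images of idempotents, so idempotents must split already among 1-Tate spaces: a
    lattice is enlarged until it is stable under the idempotent, which becomes block triangular.
    This uses that linear maps factor through their images by split maps. Finally, functors respect
    the chosen trivialisations only up to a coboundary, the defect; corrected by defects, the charge
    of a natural transformation is a constant, and the defects cancel in each coherence diagram. *)

(* The additive structure consists of bare operations: a [zmodType] structure on all
   sets of morphisms would bound their universe, which [ind] has to raise. *)
Record addcat : Type := AddCat {
  acat :> category;
  hadd : forall a b : acat, hom a b -> hom a b -> hom a b;
  hopp : forall a b : acat, hom a b -> hom a b;
  hzero : forall a b : acat, hom a b;
  haddA : forall a b : acat, associative (@hadd a b);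
  haddC : forall a b : acat, commutative (@hadd a b);
  hadd0 : forall a b : acat, left_id (hzero a b) (@hadd a b);
  haddN : forall a b : acat, left_inverse (hzero a b) (@hopp a b) (@hadd a b);
  hcompDl : forall (a b c : acat) (f g : hom b c) (h : hom a b),
    hadd f g \oc h = hadd (f \oc h) (g \oc h);
  hcompDr : forall (a b c : acat) (h : hom b c) (f g : hom a b),
    h \oc hadd f g = hadd (h \oc f) (h \oc g) }.

Declare Scope hom_scope.
Delimit Scope hom_scope with H.
Notation "f + g" := (hadd f g) : hom_scope.
Notation "- f" := (hopp f) : hom_scope.
Notation "f - g" := (hadd f (hopp g)) : hom_scope.
Notation "0" := (hzero _ _) : hom_scope.
Local Open Scope hom_scope.

Section Additive.
Variable A : addcat.
Implicit Types a b c : A.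

Lemma haddr0 a b (f : hom a b) : f + 0 = f.
Proof. by rewrite haddC hadd0. Qed.
Lemma haddNr a b (f : hom a b) : f - f = 0.
Proof. by rewrite haddC haddN. Qed.
Lemma haddI a b (f g h : hom a b) : f + g = f + h -> g = h.
Proof. by move=> e; rewrite -[g]hadd0 -[h]hadd0 -(haddN f) -!haddA e. Qed.
Lemma hopp0 a b : - (0 : hom a b) = 0.
Proof. by rewrite -[LHS]hadd0 haddNr. Qed.
Lemma hoppK a b (f : hom a b) : - - f = f.
Proof. by apply: (@haddI _ _ (- f)); rewrite haddNr haddN. Qed.
Lemma hsubK a b (f g : hom a b) : f - g + g = f.
Proof. by rewrite -haddA haddN haddr0. Qed.
Lemma compDl a b c (f g : hom b c) (h : hom a b) : (f + g) \oc h = f \oc h + g \oc h.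
Proof. exact: hcompDl. Qed.
Lemma compDr a b c (h : hom b c) (f g : hom a b) : h \oc (f + g) = h \oc f + h \oc g.
Proof. exact: hcompDr. Qed.
Lemma comp0l a b c (h : hom a b) : hzero b c \oc h = 0.
Proof. by apply: (@haddI _ _ (hzero b c \oc h)); rewrite -compDl !haddr0. Qed.
Lemma comp0r a b c (h : hom b c) : h \oc hzero a b = 0.
Proof. by apply: (@haddI _ _ (h \oc hzero a b)); rewrite -compDr !haddr0. Qed.
Lemma compNl a b c (f : hom b c) (h : hom a b) : (- f) \oc h = - (f \oc h).
Proof. by apply: (@haddI _ _ (f \oc h)); rewrite -compDl !haddNr comp0l. Qed.
Lemma compNr a b c (h : hom b c) (f : hom a b) : h \oc (- f) = - (h \oc f).
Proof. by apply: (@haddI _ _ (h \oc f)); rewrite -compDr !haddNr comp0r. Qed.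
Lemma compBl a b c (f g : hom b c) (h : hom a b) : (f - g) \oc h = f \oc h - g \oc h.
Proof. by rewrite compDl compNl. Qed.
Lemma compBr a b c (h : hom b c) (f g : hom a b) : h \oc (f - g) = h \oc f - h \oc g.
Proof. by rewrite compDr compNr. Qed.

Definition split_mono a b (f : hom a b) : Prop := exists r : hom b a, r \oc f = idm a.
Definition split_epi a b (f : hom a b) : Prop := exists s : hom b a, f \oc s = idm b.

Definition splits a b c (f : hom a b) (g : hom b c) : Prop :=
  exists (r : hom b a) (s : hom c b),
    [/\ r \oc f = idm a, g \oc s = idm c, g \oc f = 0 & f \oc r + s \oc g = idm b].

Lemma split_mono_inj a b c (f : hom b c) (g h : hom a b) :
  split_mono f -> f \oc g = f \oc h -> g = h.
Proof. by move=> [r e] e'; rewrite -[g]comp1m -[h]comp1m -e -!compA e'. Qed.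
Lemma split_epi_inj a b c (f : hom a b) (g h : hom b c) :
  split_epi f -> g \oc f = h \oc f -> g = h.
Proof. by move=> [s e] e'; rewrite -[g]compm1 -[h]compm1 -e !compA e'. Qed.

Lemma splits_mono a b c (f : hom a b) (g : hom b c) : splits f g -> split_mono f.
Proof. by move=> [r [s []]]; exists r. Qed.
Lemma splits_epi a b c (f : hom a b) (g : hom b c) : splits f g -> split_epi g.
Proof. by move=> [r [s []]]; exists s. Qed.
Lemma splits0 a b c (f : hom a b) (g : hom b c) : splits f g -> g \oc f = 0.
Proof. by move=> [r [s []]]. Qed.

Lemma split_mono_comp a b c (f : hom b c) (g : hom a b) :
  split_mono f -> split_mono g -> split_mono (f \oc g).
Proof.
move=> [r e] [r' e']; exists (r' \oc r).
by rewrite compA -(compA r') e compm1.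
Qed.
Lemma split_epi_comp a b c (f : hom b c) (g : hom a b) :
  split_epi f -> split_epi g -> split_epi (f \oc g).
Proof.
move=> [r e] [r' e']; exists (r' \oc r).
by rewrite compA -(compA f) e' compm1.
Qed.
Lemma iso_split_mono a b (f : hom a b) : is_iso f -> split_mono f.
Proof. by move=> [g [e _]]; exists g. Qed.
(** The second map of a split sequence is a cokernel of the first; a section s gives h' = h s. *)
Lemma splits_sum a b c d (f : hom a b) (g : hom b c) (h : hom b d) : splits f g ->
  h \oc f = 0 -> exists h' : hom c d, h = h' \oc g.
Proof.
move=> [r [s [e1 e2 e3 e4]]] e; exists (h \oc s).
by rewrite -{1}[h]compm1 -e4 compDr !compA e comp0l hadd0.
Qed.

Lemma splits_ker a b c d (f : hom a b) (g : hom b c) (h : hom d b) : splits f g ->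
  g \oc h = 0 -> exists h' : hom d a, h = f \oc h'.
Proof.
move=> [r [s [e1 e2 e3 e4]]] e; exists (r \oc h).
by rewrite -{1}[h]comp1m -e4 compDl -!compA e comp0r haddr0.
Qed.

(** The map 1 - s g is killed by g, hence factors through its kernel f; the factor is the
    retraction. *)
Lemma kernel_splits a b c (f : hom a b) (g : hom b c) : split_epi g -> g \oc f = 0 ->
  (forall d (x y : hom d a), f \oc x = f \oc y -> x = y) ->
  (forall d (h : hom d b), g \oc h = 0 -> exists h' : hom d a, h = f \oc h') -> splits f g.
Proof.
move=> [s es] e0 inj ker.
have [r er] : exists r, idm b - s \oc g = f \oc r.
  by apply: ker; rewrite compBr compm1 compA es comp1m haddNr.
exists r, s; split=> //; last by rewrite -er hsubK.
by apply: inj; rewrite compA -er compBl comp1m -compA e0 comp0r hopp0 haddr0 compm1.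
Qed.

Lemma splits_iso a b c a' b' c' (f : hom a b) (g : hom b c) (f' : hom a' b') (g' : hom b' c')
    (u : hom a a') (v : hom b b') (w : hom c c') : is_iso u -> is_iso v -> is_iso w ->
  v \oc f = f' \oc u -> w \oc g = g' \oc v -> splits f' g' -> splits f g.
Proof.
move=> [u' [u1 u2]] [v' [v1 v2]] [w' [w1 w2]] e1 e2 [r [s [h1 h2 h3 h4]]].
have ef : f = v' \oc f' \oc u by rewrite -compA -e1 compA v1 comp1m.
have eg : g = w' \oc g' \oc v by rewrite -compA -e2 compA w1 comp1m.
exists (u' \oc r \oc v), (v' \oc s \oc w); split.
- rewrite ef -!compA (compA v v') v2 comp1m (compA r) h1 comp1m; exact: u1.
- rewrite eg -!compA (compA v v') v2 comp1m (compA g') h2 comp1m; exact: w1.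
- by rewrite ef eg -!compA (compA v v') v2 comp1m (compA g') h3 comp0l !comp0r.
- rewrite ef eg -!compA (compA u u') u2 comp1m (compA w w') w2 comp1m.
  by rewrite !(compA f') !(compA s) -compDr -compDl h4 comp1m v1.
Qed.

Lemma splits_iso_ex a b c a' b' c' (f : hom a b) (g : hom b c)
    (f' : hom a' b') (g' : hom b' c') (u : hom a a') (w : hom c c') :
  splits f g -> splits f' g' -> is_iso u -> is_iso w ->
  exists v : hom b b', [/\ is_iso v, v \oc f = f' \oc u & w \oc g = g' \oc v].
Proof.
(* The fifth biproduct identity r s = 0 follows from the other four, so the two decompositions can
   be matched block by block. *)
have rs (x y z : A) (p : hom x y) (q : hom y z) (r : hom y x) (s : hom z y) :
    r \oc p = idm x -> q \oc s = idm z -> q \oc p = 0 -> p \oc r + s \oc q = idm y ->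
    r \oc s = 0.
  move=> e1 e2 e3 e4; have : r \oc (p \oc r + s \oc q) \oc s = r \oc s by rewrite e4 compm1.
  rewrite compDr compDl !compA e1 comp1m -!compA e2 compm1 => e.
  by apply: (@haddI _ _ (r \oc s)); rewrite e haddr0.
move=> [r [s [h1 h2 h3 h4]]] [r' [s' [k1 k2 k3 k4]]] [u' [u1 u2]] [w' [w1 w2]].
have h5 := rs _ _ _ _ _ _ _ h1 h2 h3 h4; have k5 := rs _ _ _ _ _ _ _ k1 k2 k3 k4.
exists (f' \oc u \oc r + s' \oc w \oc g); split; last 1 first.
- by rewrite compDr !compA k3 !comp0l hadd0 k2 comp1m.
- exists (f \oc u' \oc r' + s \oc w' \oc g'); split.
    rewrite compDl !compDr -!compA !(compA r') k1 !(compA g') k2 k3 k5 !comp0l !comp0r.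
    by rewrite !comp1m (compA u') u1 (compA w') w1 !comp1m haddr0 hadd0.
  rewrite compDl !compDr -!compA !(compA r) h1 !(compA g) h2 h3 h5 !comp0l !comp0r.
  by rewrite !comp1m (compA u) u2 (compA w) w2 !comp1m haddr0 hadd0.
- by rewrite compDl -!compA h1 compm1 h3 !comp0r haddr0.
Qed.

End Additive.

Section OppositeAdditive.
Variable A : addcat.

Definition op_add : addcat.
refine (@AddCat (opcat A) (fun a b f g => @hadd A b a f g) (fun a b f => @hopp A b a f)
  (fun a b => hzero b a) _ _ _ _ _ _).
- by move=> a b; exact: haddA.
- by move=> a b; exact: haddC.
- by move=> a b; exact: hadd0.
- by move=> a b; exact: haddN.
- by move=> a b c f g h; exact: hcompDr.
- by move=> a b c f g h; exact: hcompDl.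
Defined.

Lemma splits_op (a b c : A) (f : hom a b) (g : hom b c) :
  @splits A a b c f g -> @splits op_add c b a g f.
Proof. by move=> [r [s [h1 h2 h3 h4]]]; exists s, r; split=> //; rewrite haddC. Qed.

End OppositeAdditive.

(** * Ind-objects of an additive category *)

Section IndAdditive.
Variable A : addcat.
Implicit Types X Y Z : indobj A.

Lemma indhom_ex (C : category) (X Y : indobj C) (R : indhom X Y) i : exists j f, sval R i j f.
Proof. by case: (svalP R). Qed.

Lemma indhom_germ (C : category) (X Y : indobj C) (R : indhom X Y) i j f j' f' :
  sval R i j f -> sval R i j' f' -> germ_eq f f'.
Proof. by case: (svalP R) => _ h _ r; move/(h _ _ _ _ _ r). Qed.

Lemma indhom_closed (C : category) (X Y : indobj C) (R : indhom X Y) i j f j' f' :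
  sval R i j f -> germ_eq f f' -> sval R i j' f'.
Proof. by case: (svalP R) => _ h _ r; move/(h _ _ _ _ _ r). Qed.

Lemma indhom_pre (C : category) (X Y : indobj C) (R : indhom X Y) i i' (h : dle i i') j f :
  sval R i' j f -> sval R i j (f \oc dmap _ h).
Proof. by case: (svalP R) => _ _; apply. Qed.

Lemma indhom_post (C : category) (X Y : indobj C) (R : indhom X Y) i j j' (h : dle j j') f :
  sval R i j f -> sval R i j' (dmap _ h \oc f).
Proof. by move=> r; apply: (indhom_closed r); exact: germ_imap. Qed.

(** At each index a morphism is a whole equivalence class of germs, so one shared representative
    suffices. Equalities in Ind are proved below by exhibiting such representatives. *)
Lemma indhom_eq (C : category) (X Y : indobj C) (R S : indhom X Y) :
  (forall i, exists j f, sval R i j f /\ sval S i j f) -> R = S.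
Proof.
move=> h; apply: indhom_ext => i j f r; have [j' [f' [r' s']]] := h i.
exact: indhom_closed s' (indhom_germ r' r).
Qed.

Lemma indhom_common (C : category) (X Y : indobj C) (R S : indhom X Y) i :
  exists j f g, sval R i j f /\ sval S i j g.
Proof.
have [j [f r]] := indhom_ex R i; have [j' [f' r']] := indhom_ex S i.
have [l [h h']] := ddir j j'.
by exists l, (dmap _ h \oc f), (dmap _ h' \oc f'); split; exact: indhom_post.
Qed.

Lemma indcomp_mem (C : category) (X Y Z : indobj C) (S : indhom Y Z) (R : indhom X Y) i j l f g :
  sval R i j f -> sval S j l g -> sval (indcomp S R) i l (g \oc f).
Proof. by move=> r s; exists j, f, l, g; split=> //; exact: germ_refl. Qed.

Lemma indid_mem (C : category) (X : indobj C) i : sval (indid X) i i (idm _).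
Proof. exact: germ_refl. Qed.

Lemma level_mem (C : category) (D : dirset) (F G : diagram D C) (t : dnat F G) i :
  sval (level t) i i (t i).
Proof. exact: germ_refl. Qed.

Lemma germ_add X (a : A) (Y : indobj A) j (f g : hom a (Y j)) j' (f' g' : hom a (Y j')) :
  germ_eq f f' -> germ_eq g g' -> germ_eq (f + g) (f' + g').
Proof.
move=> [l [h [h' e]]] [m [k [k' e']]]; have [n [ln mn]] := ddir l m.
have E (p : dle j n) (p' : dle j' n) (x : hom a (Y j)) (x' : hom a (Y j')) m'
    (y : dle j m') (y' : dle j' m') (z : dle m' n) :
    dmap _ y \oc x = dmap _ y' \oc x' -> dmap _ p \oc x = dmap _ p' \oc x'.
  by move=> e0; rewrite -(dmap_comp _ y z) -(dmap_comp _ y' z) -!compA e0.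
exists n, (dle_trans h ln), (dle_trans h' ln); rewrite !compDr; congr hadd.
  exact: E e.
exact: E e'.
Qed.

Lemma germ_opp (a : A) (Y : indobj A) j (f : hom a (Y j)) j' (f' : hom a (Y j')) :
  germ_eq f f' -> germ_eq (- f) (- f').
Proof. by move=> [l [h [h' e]]]; exists l, h, h'; rewrite !compNr e. Qed.

Lemma indadd_proof X Y (R S : indhom X Y) : is_indhom (fun i j (f : hom (X i) (Y j)) =>
  exists l r s, [/\ sval R i l r, sval S i l s & germ_eq (r + s) f]).
Proof.
split.
- move=> i; have [j [f [g [r s]]]] := indhom_common R S i.
  by exists j, (f + g), j, f, g; split=> //; exact: germ_refl.
- move=> i j f j' f' [l [r [s [Rr Ss e]]]]; split.
    move=> [l' [r' [s' [Rr' Ss' e']]]]; apply: germ_trans (germ_sym e) _.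
    by apply: germ_trans e'; apply: (germ_add X); [exact: indhom_germ Rr Rr'|exact: indhom_germ Ss Ss'].
  by move=> e'; exists l, r, s; split=> //; exact: germ_trans e'.
- move=> i i' h j f [l [r [s [Rr Ss e]]]].
  exists l, (r \oc dmap _ h), (s \oc dmap _ h); split; try exact: indhom_pre.
  by rewrite -compDl; exact: germ_pre.
Qed.

Definition indadd X Y (R S : indhom X Y) : indhom X Y := exist _ _ (indadd_proof R S).

Lemma indopp_proof X Y (R : indhom X Y) :
  is_indhom (fun i j (f : hom (X i) (Y j)) => sval R i j (- f)).
Proof.
split.
- by move=> i; have [j [f r]] := indhom_ex R i; exists j, (- f); rewrite hoppK.
- move=> i j f j' f' r; split=> [r'|e].
    by have := germ_opp (indhom_germ r r'); rewrite !hoppK.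
  exact/(indhom_closed r)/germ_opp.
- by move=> i i' h j f r; rewrite -compNl; exact: indhom_pre.
Qed.

Definition indopp X Y (R : indhom X Y) : indhom X Y := exist _ _ (indopp_proof R).

Lemma indzero_proof X Y :
  is_indhom (fun i j (f : hom (X i) (Y j)) => germ_eq (hzero (X i) (Y j)) f).
Proof.
have Z i j j' : germ_eq (hzero (X i) (Y j)) (hzero (X i) (Y j')).
  by have [l [h h']] := ddir j j'; exists l, h, h'; rewrite !comp0r.
split.
- move=> i; have [j] := dinh (iidx Y); exists j, 0; exact: germ_refl.
- move=> i j f j' f' r; split=> [r'|e].
    by apply: germ_trans (germ_sym r) _; exact: germ_trans (Z _ _ _) r'.
  by apply: germ_trans (Z _ _ _) _; exact: germ_trans r e.
- by move=> i i' h j f r; rewrite -[X in germ_eq X](comp0l _ (dmap X h)); exact: germ_pre.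
Qed.

Definition indzero X Y : indhom X Y := exist _ _ (indzero_proof X Y).

Lemma indadd_mem X Y (R S : indhom X Y) i j f g :
  sval R i j f -> sval S i j g -> sval (indadd R S) i j (f + g).
Proof. by move=> r s; exists j, f, g; split=> //; exact: germ_refl. Qed.

Lemma indopp_mem X Y (R : indhom X Y) i j f : sval R i j f -> sval (indopp R) i j (- f).
Proof. by rewrite /= hoppK. Qed.

Lemma indzero_mem X Y i j : sval (indzero X Y) i j 0.
Proof. exact: germ_refl. Qed.

Definition ind_add : addcat.
refine (@AddCat (ind A) indadd indopp indzero _ _ _ _ _ _).
- move=> X Y R S T; apply: indhom_eq => i.
  have [j [f [g [r s]]]] := indhom_common R S i; have [j' [h t]] := indhom_ex T i.
  have [l [p p']] := ddir j j'.
  have {}r := indhom_post p r; have {}s := indhom_post p s; have {}t := indhom_post p' t.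
  exists l, (dmap _ p \oc f + (dmap _ p \oc g + dmap _ p' \oc h)); split.
    by do 2 apply: indadd_mem => //.
  by rewrite haddA; do 2 apply: indadd_mem => //.
- move=> X Y R S; apply: indhom_eq => i.
  have [j [f [g [r s]]]] := indhom_common R S i.
  by exists j, (f + g); split; [|rewrite haddC]; exact: indadd_mem.
- move=> X Y R; apply: indhom_eq => i; have [j [f r]] := indhom_ex R i.
  exists j, f; split=> //; rewrite -[f]hadd0; apply: indadd_mem => //; exact: indzero_mem.
- move=> X Y R; apply: indhom_eq => i; have [j [f r]] := indhom_ex R i.
  exists j, 0; split; last exact: indzero_mem.
  rewrite -(haddN f); apply: indadd_mem => //; exact: indopp_mem.
- move=> X Y Z R S T; apply: indhom_eq => i; have [j [f t]] := indhom_ex T i.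
  have [l [g [h [r s]]]] := indhom_common R S j; exists l, ((g + h) \oc f); split.
    by apply: indcomp_mem => //; exact: indadd_mem.
  by rewrite compDl; apply: indadd_mem; exact: indcomp_mem.
- move=> X Y Z R S T; apply: indhom_eq => i; have [j [g [h [s t]]]] := indhom_common S T i.
  have [l [f r]] := indhom_ex R j; exists l, (f \oc (g + h)); split.
    by apply: (@indcomp_mem _ _ _ _ R _ i j) => //; exact: indadd_mem.
  by rewrite compDr; apply: indadd_mem; exact: indcomp_mem.
Defined.

End IndAdditive.

(** * Colimits of sequences *)

Lemma dchoice (I : Type) (T : I -> Type) (P : forall i, T i -> Prop) :
  (forall i, exists x, P i x) -> exists f : forall i, T i, forall i, P i (f i).
Proof. by move=> h; exists (fun i => sval (cid (h i))) => i; exact: svalP (cid (h i)). Qed.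

(** Dependent choice for a family of types: splittings of sequences are built by induction, each
    constrained by the previous one. *)
Lemma dep_choice (T : nat -> Type) (P : forall n, T n -> Prop)
    (R : forall n, T n -> T n.+1 -> Prop) :
  (exists x : T 0%N, P 0%N x) ->
  (forall n x, P n x -> exists y, P n.+1 y /\ R n x y) ->
  exists f : forall n, T n, (forall n, P n (f n)) /\ forall n, R n (f n) (f n.+1).
Proof.
move=> /cid [x0 p0] step.
pose S n := {x : T n | P n x}.
pose nxt n (x : S n) : S n.+1 :=
  exist _ (sval (cid (step n _ (svalP x)))) (proj1 (svalP (cid (step n _ (svalP x))))).
pose g := nat_rect S (exist _ x0 p0) nxt.
exists (fun n => sval (g n)); split=> n; first exact: svalP.
exact: (proj2 (svalP (cid (step n _ (svalP (g n)))))).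
Qed.

Definition natc : corder.
refine (@COrder nat (fun m n => is_true (m <= n)%N) _ _ _ _ _ _).
- exact: leqnn.
- by move=> m n p h; apply: leq_trans.
- by move=> m n h h'; apply/anti_leq; rewrite h h'.
- by move=> m n; case/orP: (leq_total m n); [left|right].
- exact: (inhabits 0%N).
- by exists id.
Defined.

Notation ndir := (dir_of natc).
Definition nstep n : @dle ndir n n.+1 := leqnSn n.

Lemma icomp_mem (C : category) (X Y Z : ind C) (S : hom Y Z) (R : hom X Y) i j l
    (f : hom (X i) (Y j)) (g : hom (Y j) (Z l)) :
  sval R i j f -> sval S j l g -> sval (S \oc R) i l (g \oc f).
Proof. exact: indcomp_mem. Qed.

Section NatDiagrams.
Variable C : category.
Implicit Types F G : diagram ndir C.

Lemma dmap_irr (D : dirset) (F : diagram D C) i j (h h' : dle i j) : dmap F h = dmap F h'.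
Proof. by rewrite (Prop_irrelevance h h'). Qed.

Lemma nat_natural F G (t : forall n : nat, hom (F n) (G n)) :
  (forall n, dmap G (nstep n) \oc t n = t n.+1 \oc dmap F (nstep n)) ->
  forall (m n : nat) (h : @dle ndir m n), dmap G h \oc t m = t n \oc dmap F h.
Proof.
move=> st m n h; have [k e] : exists k, n = (k + m)%N.
  by exists (n - m)%N; rewrite subnK.
subst n; elim: k h => [|k IH] h; first by rewrite !dmap_id comp1m compm1.
have h' : @dle ndir m (k + m)%N by exact: leq_addl.
rewrite -(dmap_comp G h' (nstep (k + m)%N)) -(dmap_comp F h' (nstep (k + m)%N)).
by rewrite -compA IH !compA st.
Qed.

Definition nat_dnat F G (t : forall n : nat, hom (F n) (G n))
  (h : forall n, dmap G (nstep n) \oc t n = t n.+1 \oc dmap F (nstep n)) : dnat F G :=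
  @DNat ndir C F G t (nat_natural h).

End NatDiagrams.

(** * Reindexing of ind-objects along cofinal maps *)

Section Reindex.
Variables (D D' : dirset) (C : category) (phi : D' -> D).
Hypothesis phim : forall i j, dle i j -> dle (phi i) (phi j).

Section UpToIso.
Variables (F : diagram D C) (F' : diagram D' C) (al : forall i, hom (F' i) (F (phi i))).
Hypothesis alP : forall i j (h : dle i j), dmap F (phim h) \oc al i = al j \oc dmap F' h.

Lemma reindex_proof : @is_indhom C (IndObj F') (IndObj F) (fun i j f =>
  @germ_eq C (F' i) (IndObj F) (phi i) (al i) j f).
Proof.
apply: (@level_subproof C (IndObj F') (IndObj F) phi al) => i i' h.
by rewrite -alP; exact/germ_sym/(@germ_imap C _ (IndObj F)).
Qed.

Definition reindex : @hom (ind C) (IndObj F') (IndObj F) := exist _ _ reindex_proof.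

Hypothesis cof : forall i, exists d, dle i (phi d).
Hypothesis al_iso : forall i, is_iso (al i).

(** The two diagrams are related by isomorphisms [al] rather than by equality because reindexing the
    rows of a two-variable diagram alters the terms of its column diagram up to isomorphism. *)
Lemma reindex_iso : is_iso reindex.
Proof.
have gE (a : C) d d' (f : hom a (F' d)) (f' : hom a (F' d')) :
    @germ_eq C a (IndObj F) (phi d) (al d \oc f) (phi d') (al d' \oc f') <->
    @germ_eq C a (IndObj F') d f d' f'.
  split=> [[l [h [h' e]]]|[l [h [h' e]]]]; last first.
    by exists (phi l), (phim h), (phim h'); rewrite !compA !alP -!compA e.
  have [m [dm dm']] := ddir d d'; have [p lp] := cof l; have [q [mq pq]] := ddir m p.
  exists q, (dle_trans dm mq), (dle_trans dm' mq).
  have k : dle l (phi q) := dle_trans lp (phim pq).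
  have [be [ba _]] := al_iso q.
  suff e' : al q \oc (dmap F' (dle_trans dm mq) \oc f) = al q \oc (dmap F' (dle_trans dm' mq) \oc f').
    by have := f_equal (comp be) e'; rewrite !compA ba !comp1m.
  rewrite !compA -!alP -!compA -(dmap_comp F h k) -(dmap_comp F h' k) -!compA.
  by rewrite e.
(* The inverse consists of the germs that become the germ of the identity of F i after composition
   with [al]; cofinality provides one for each i. *)
pose R i d (f : hom (F i) (F' d)) := @germ_eq C (F i) (IndObj F) i (idm _) (phi d) (al d \oc f).
have ex i : exists d f, R i d f.
  have [d h] := cof i; have [be [_ ab]] := al_iso d; exists d, (be \oc dmap F h).
  rewrite /R compA ab comp1m -[dmap _ h]compm1; exact: (@germ_imap C _ (IndObj F)).
have P : @is_indhom C (IndObj F) (IndObj F') R.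
  split=> //.
  - move=> i d f d' f' r; split=> [r'|/gE e]; last exact: germ_trans r e.
    apply/gE; exact: germ_trans (germ_sym r) r'.
  - move=> i i' h d f r; rewrite /R compA; apply: germ_trans (germ_pre (dmap F h) r).
    rewrite comp1m -[dmap _ h]compm1; exact: (@germ_imap C _ (IndObj F)).
pose Q : @hom (ind C) (IndObj F) (IndObj F') := exist _ R P.
exists Q; split; apply: indhom_eq => i.
  have [d [f r]] := ex (phi i); exists d, (f \oc al i); split.
    by apply: (@icomp_mem C _ _ _ Q reindex i (phi i) d) => //; exact: germ_refl.
  apply/gE; rewrite compm1 compA; apply: germ_trans (germ_pre (al i) r).
  by rewrite comp1m; exact: germ_refl.
have [d [f r]] := ex i; exists (phi d), (al d \oc f); split=> //.
by apply: (@icomp_mem C _ _ _ reindex Q i d (phi d)) => //; exact: germ_refl.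
Qed.

End UpToIso.

Lemma reindex_nat (F G : diagram D C) (F' G' : diagram D' C)
    (al : forall i, hom (F' i) (F (phi i))) (be : forall i, hom (G' i) (G (phi i)))
    (alP : forall i j (h : dle i j), dmap F (phim h) \oc al i = al j \oc dmap F' h)
    (beP : forall i j (h : dle i j), dmap G (phim h) \oc be i = be j \oc dmap G' h)
    (t : dnat F G) (t' : dnat F' G') : (forall i, t (phi i) \oc al i = be i \oc t' i) ->
  level t \oc reindex alP = reindex beP \oc level t'.
Proof.
move=> e; apply: indhom_eq => i; exists (phi i), (t (phi i) \oc al i); split.
  apply: (@icomp_mem C _ _ _ (level t) (reindex alP) i (phi i)); first exact: germ_refl.
  exact: level_mem.
rewrite e; apply: (@icomp_mem C _ _ _ (reindex beP) _ i i); last exact: germ_refl.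
exact: (@level_mem C _ _ _ t').
Qed.

Definition rediag (F : diagram D C) : diagram D' C.
refine (@Diagram D' C (fun i => F (phi i)) (fun i j h => dmap F (phim h)) _ _).
- by move=> i h; exact: dmap_id.
- by move=> i j l h h' h''; exact: dmap_comp.
Defined.

Lemma rediag_nat (F : diagram D C) i j (h : dle i j) :
  dmap F (phim h) \oc idm (F (phi i)) = idm (F (phi j)) \oc dmap (rediag F) h.
Proof. by rewrite comp1m compm1. Qed.

Definition reind (F : diagram D C) : @hom (ind C) (IndObj (rediag F)) (IndObj F) :=
  @reindex F (rediag F) (fun i => idm _) (@rediag_nat F).

Lemma reind_iso F : (forall i, exists d, dle i (phi d)) -> is_iso (reind F).
Proof. by move=> cof; apply: reindex_iso => // i; exact: iso_id. Qed.

End Reindex.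

(** The running maximum of an enumeration. It may be eventually constant, so finite orders are
    covered. *)
Lemma corder_cofinal (J : corder) : exists psi : nat -> J,
  (forall m n, (m <= n)%N -> cle (psi m) (psi n)) /\ (forall j, exists n, cle j (psi n)).
Proof.
have [j0] := cinh J; have [f fi] := ccount J.
(* A left inverse of the injection f, with default value j0 outside its image. *)
pose g n := if pselect (exists j, f j = n) is left h then sval (cid h) else j0.
have gf j : g (f j) = j.
  rewrite /g; case: pselect => [h|[]]; last by exists j.
  exact/fi/(svalP (cid h)).
pose mx i j : J := if pselect (cle i j) is left _ then j else i.
have mx1 i j : cle i (mx i j) by rewrite /mx; case: pselect => // _; exact: cle_refl.
have mx2 i j : cle j (mx i j).
  rewrite /mx; case: pselect => [_|h]; first exact: cle_refl.
  by have [] := cle_total i j.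
pose psi := nat_rect (fun=> J) (g 0%N) (fun n x => mx x (g n.+1)).
have st n : cle (psi n) (psi n.+1) := mx1 _ _.
exists psi; split.
  move=> m n; elim: n => [|n IH]; first by rewrite leqn0 => /eqP ->; exact: cle_refl.
  rewrite leq_eqVlt => /orP [/eqP ->|]; first exact: cle_refl.
  by rewrite ltnS => /IH h; exact: cle_trans (st n).
move=> j; exists (f j); rewrite -{1}(gf j).
by case: (f j) => [|n]; [exact: cle_refl|exact: mx2].
Qed.

Section Sequences.
Variable A : addcat.
Implicit Types F G : diagram ndir A.

Definition mono_steps F : Prop := forall n, split_mono (dmap F (nstep n)).

Lemma mono_steps_all F : mono_steps F -> forall (m n : nat) (h : @dle ndir m n), split_mono (dmap F h).
Proof.
move=> st m n h; have [k e] : exists k, n = (k + m)%N by exists (n - m)%N; rewrite subnK.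
subst n; elim: k h => [|k IH] h; first by rewrite dmap_id; exists (idm _); rewrite comp1m.
have h' : @dle ndir m (k + m)%N by exact: leq_addl.
rewrite -(dmap_comp F h' (nstep (k + m)%N)); exact: split_mono_comp.
Qed.

Lemma level_add (D : dirset) (F G : diagram D A) (t u v : dnat F G) :
  (forall i, v i = t i + u i) -> level v = hadd (level t : @hom (ind_add A) _ _) (level u).
Proof.
move=> e; apply: indhom_eq => i; exists i, (v i); split; first exact: level_mem.
by rewrite e; apply: indadd_mem; exact: level_mem.
Qed.

Lemma level_0 (D : dirset) (F G : diagram D A) (t : dnat F G) :
  (forall i, t i = 0) -> level t = hzero (IndObj F : ind_add A) (IndObj G).
Proof.
move=> e; apply: indhom_eq => i; exists i, (t i); split; first exact: level_mem.
rewrite e; exact: indzero_mem.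
Qed.

(* The colimit of a sequence of split exact sequences splits: retractions are chosen
   inductively, the defect of compatibility being a map defined on the third term,
   which extends along its transition map. *)
Lemma level_splits (F1 F2 F3 : diagram ndir A) (s : dnat F1 F2) (t : dnat F2 F3) :
  (forall n, splits (s n) (t n)) -> mono_steps F3 ->
  @splits (ind_add A) _ _ _ (level s) (level t).
Proof.
move=> ex st.
have [r [r1 rs]] : exists r : forall n, hom (F2 n) (F1 n),
    (forall n, r n \oc s n = idm _) /\
    forall n, dmap F1 (nstep n) \oc r n = r n.+1 \oc dmap F2 (nstep n).
  apply: (@dep_choice (fun n => hom (F2 n) (F1 n)) (fun n x => x \oc s n = idm _)
    (fun n x y => dmap F1 (nstep n) \oc x = y \oc dmap F2 (nstep n))).
    by have [r [? []]] := ex 0%N; exists r.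
  move=> n r r1; have [r' [s' [e1 e2 e3 e4]]] := ex n.+1.
  have [d dE] : exists d, dmap F1 (nstep n) \oc r - r' \oc dmap F2 (nstep n) = d \oc t n.
    apply: splits_sum (ex n) _.
    by rewrite compBl -!compA r1 compm1 dcompP compA e1 comp1m haddNr.
  have [q qE] := st n; pose d' := d \oc q.
  exists (r' + d' \oc t n.+1); split.
    by rewrite compDl e1 -compA e3 comp0r haddr0.
  rewrite compDl -compA -dcompP compA -(compA d) qE compm1 -dE.
  by rewrite haddC hsubK.
(* The section is corrected to be the one complementary to r n. This determines it, so that
   compatibility of the sections follows from that of the retractions. *)
have ex' n : exists s' : hom (F3 n) (F2 n),
    t n \oc s' = idm _ /\ s n \oc r n + s' \oc t n = idm _.
  have [r' [s' [e1 e2 e3 e4]]] := ex n; exists (s' - s n \oc (r n \oc s')); split.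
    by rewrite compBr e2 !compA e3 !comp0l hopp0 haddr0.
  have -> : s' - s n \oc (r n \oc s') = (idm _ - s n \oc r n) \oc s'.
    by rewrite compBl comp1m !compA.
  have -> : (idm _ - s n \oc r n) \oc s' \oc t n = (idm _ - s n \oc r n) \oc (s n \oc r' + s' \oc t n).
    have z : (idm _ - s n \oc r n) \oc (s n \oc r') = 0.
      by rewrite compA compBl comp1m -(compA (s n)) r1 compm1 haddNr comp0l.
    by rewrite compDr z hadd0 compA.
  by rewrite e4 compm1 haddC hsubK.
pose s' n := sval (cid (ex' n)).
have s1 n : t n \oc s' n = idm _ by have [] := svalP (cid (ex' n)).
have s2 n : s n \oc r n + s' n \oc t n = idm _ by have [] := svalP (cid (ex' n)).
have s's n : dmap F2 (nstep n) \oc s' n = s' n.+1 \oc dmap F3 (nstep n).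
  apply: (split_epi_inj (splits_epi (ex n))).
  have e m : s' m \oc t m = idm _ - s m \oc r m by rewrite -(s2 m) haddC haddA haddN hadd0.
  rewrite -compA e -compA dcompP compA e compBr compBl compm1 comp1m.
  by rewrite !compA dcompP -!compA rs.
pose R := nat_dnat rs; pose S := nat_dnat s's.
have mem F G (x : dnat F G) n := @level_mem A ndir F G x n.
exists (level R), (level S); split; apply: indhom_eq => n.
- exists n, (r n \oc s n); split; last by rewrite r1; exact: indid_mem.
  exact: (icomp_mem (mem _ _ s n) (mem _ _ R n)).
- exists n, (t n \oc s' n); split; last by rewrite s1; exact: indid_mem.
  exact: (icomp_mem (mem _ _ S n) (mem _ _ t n)).
- exists n, (t n \oc s n); split; last by rewrite (splits0 (ex n)); exact: indzero_mem.
  exact: (icomp_mem (mem _ _ s n) (mem _ _ t n)).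
- exists n, (s n \oc r n + s' n \oc t n); split; last by rewrite s2; exact: indid_mem.
  apply: indadd_mem.
    exact: (icomp_mem (mem _ _ R n) (mem _ _ s n)).
  exact: (icomp_mem (mem _ _ t n) (mem _ _ S n)).
Qed.

End Sequences.

(** * Constant ind-objects and maps out of them *)

Section Constant.
Variable B : category.
Implicit Types (P : B) (X Y : ind B).

Definition cind P : ind B := IndObj (cdiag P).
Definition cind_map P P' (f : hom P P') : hom (cind P) (cind P') := level (cnat f).

Lemma germ_hom_proof P X (j : iidx X) (f : hom P (X j)) :
  @is_indhom B (cind P) X (fun _ j' f' => germ_eq f f').
Proof.
apply: (@level_subproof B (cind P) X (fun=> j) (fun=> f)) => i i' h.
by rewrite /= compm1; exact: germ_refl.
Qed.

Definition germ_hom P X (j : iidx X) (f : hom P (X j)) : hom (cind P) X :=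
  exist _ _ (germ_hom_proof f).
Definition cin X (j : iidx X) : hom (cind (X j)) X := germ_hom (idm (X j)).

Lemma germ_hom_mem P X (j : iidx X) (f : hom P (X j)) : sval (germ_hom f) tt j f.
Proof. exact: germ_refl. Qed.

Lemma germ_homP P X (h : hom (cind P) X) : exists j (f : hom P (X j)), h = germ_hom f.
Proof.
have [j [f m]] := indhom_ex h tt; exists j, f; apply: indhom_eq => -[].
by exists j, f; split=> //; exact: germ_refl.
Qed.

Lemma germ_hom_eq P X (j j' : iidx X) (f : hom P (X j)) (f' : hom P (X j')) :
  germ_eq f f' -> germ_hom f = germ_hom f'.
Proof.
move=> e; apply: indhom_eq => -[]; exists j', f'; split=> //; exact: germ_refl.
Qed.

Lemma cind_map_mem P P' (f : hom P P') : sval (cind_map f) tt tt f.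
Proof. exact: germ_refl. Qed.

Lemma cind_full P P' (h : hom (cind P) (cind P')) : exists f, h = cind_map f.
Proof.
have [[] [f m]] := indhom_ex h tt; exists f; apply: indhom_eq => -[].
by exists tt, f; split=> //; exact: germ_refl.
Qed.

Lemma cind_faithful P P' (f g : hom P P') : cind_map f = cind_map g -> f = g.
Proof.
move=> e; have := cind_map_mem f; rewrite e => m.
have [[] [h [h' /= e']]] := indhom_germ m (cind_map_mem g).
by rewrite !comp1m in e'.
Qed.

Lemma cind_map_id P : cind_map (idm P) = idm (cind P).
Proof. exact: level_id. Qed.

Lemma cind_map_comp P P' P'' (f : hom P' P'') (g : hom P P') :
  cind_map (f \oc g) = cind_map f \oc cind_map g.
Proof. by apply/esym/level_comp. Qed.

Lemma cind_iso P P' (f : hom P P') : is_iso f -> is_iso (cind_map f).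
Proof.
by move=> [g [e1 e2]]; exists (cind_map g); rewrite -!cind_map_comp e1 e2 !cind_map_id.
Qed.

Lemma germ_homE P X (j : iidx X) (f : hom P (X j)) : germ_hom f = cin j \oc cind_map f.
Proof.
apply: indhom_eq => -[]; exists j, f; split; first exact: germ_refl.
rewrite -[X in sval _ _ _ X]comp1m; exact: icomp_mem (cind_map_mem f) (germ_hom_mem _).
Qed.

Lemma cin_dmap X (j j' : iidx X) (h : dle j j') : cin j' \oc cind_map (dmap X h) = cin j.
Proof.
by rewrite -germ_homE -[dmap _ h]compm1; apply/germ_hom_eq/germ_sym/germ_imap.
Qed.

Lemma hom_cin X Y (R : hom X Y) i j (f : hom (X i) (Y j)) :
  sval R i j f -> R \oc cin i = germ_hom f.
Proof.
move=> r; apply: indhom_eq => -[]; exists j, f; split; last exact: germ_refl.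
by rewrite -[f]compm1; exact: icomp_mem (germ_hom_mem _) r.
Qed.

End Constant.

Section ConstantAdditive.
Variable A : addcat.
Implicit Types a b c : A.

Lemma cind_map_add a b (f g : hom a b) :
  cind_map (f + g) = hadd (cind_map f : @hom (ind_add A) _ _) (cind_map g).
Proof. exact: level_add. Qed.

Lemma cind_map_0 a b : cind_map (hzero a b) = hzero (cind a : ind_add A) (cind b).
Proof. exact: level_0. Qed.

Lemma cind_addM a b c (f : hom b c) (g : hom a b) :
  @comp (ind_add A) _ _ _ (cind_map f) (cind_map g) = cind_map (f \oc g).
Proof. exact/esym/cind_map_comp. Qed.

Lemma cind_splits a b c (f : hom a b) (g : hom b c) :
  @splits (ind_add A) _ _ _ (cind_map f) (cind_map g) <-> splits f g.
Proof.
split=> [[r [s [e1 e2 e3 e4]]]|[r [s [e1 e2 e3 e4]]]]; last first.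
  exists (cind_map r), (cind_map s); split; rewrite !cind_addM.
  - by rewrite e1; exact: cind_map_id.
  - by rewrite e2; exact: cind_map_id.
  - by rewrite e3; exact: cind_map_0.
  - by rewrite -[LHS]cind_map_add e4; exact: cind_map_id.
have [r' rE] := cind_full r; have [s' sE] := cind_full s; subst r s.
rewrite !cind_addM in e1 e2 e3 e4.
exists r', s'; split; apply: cind_faithful.
- by rewrite e1 cind_map_id.
- by rewrite e2 cind_map_id.
- by rewrite e3 cind_map_0.
- by rewrite cind_map_add e4 cind_map_id.
Qed.

Lemma cind_split_mono a b (f : hom a b) :
  @split_mono (ind_add A) _ _ (cind_map f) <-> split_mono f.
Proof.
split=> [[r e]|[r e]]; last first.
  by exists (cind_map r); rewrite cind_addM e; exact: cind_map_id.
have [r' rE] := cind_full r; subst r; exists r'; apply: cind_faithful.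
by rewrite -cind_addM e cind_map_id.
Qed.

Lemma cind_split_epi a b (f : hom a b) :
  @split_epi (ind_add A) _ _ (cind_map f) <-> split_epi f.
Proof.
split=> [[r e]|[r e]]; last first.
  by exists (cind_map r); rewrite cind_addM e; exact: cind_map_id.
have [r' rE] := cind_full r; subst r; exists r'; apply: cind_faithful.
by rewrite -cind_addM e cind_map_id.
Qed.

End ConstantAdditive.

Section SequenceColimits.
Variable A : addcat.
Implicit Types F G : diagram ndir A.

(** The retraction onto F l is the transition map on the terms up to l, and is extended beyond l one
    index at a time through retractions of the steps. *)
Lemma cin_split_mono F l : mono_steps F -> @split_mono (ind_add A) _ _ (@cin A (IndObj F) l).
Proof.
move=> st.
have [t [tl ts]] : exists t : forall n, hom (F n) (F l),
    (forall n (h : @dle ndir n l), t n = dmap F h) /\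
    forall n, t n = t n.+1 \oc dmap F (nstep n).
  apply: (@dep_choice (fun n => hom (F n) (F l))
    (fun n x => forall h : @dle ndir n l, x = dmap F h)
    (fun n x y => x = y \oc dmap F (nstep n))).
    have h : @dle ndir 0%N l by []; exists (dmap F h) => h'; exact: dmap_irr.
  move=> n x xP; have [h|h] := leqP n.+1 l.
    exists (dmap F (h : @dle ndir n.+1 l)); split=> [h'|]; first exact: dmap_irr.
    have h' : @dle ndir n l := ltnW h; by rewrite (dmap_comp F (nstep n) _ h').
  have [r e] := st n; exists (x \oc r); split; last by rewrite -compA e compm1.
  by move=> h'; have := leq_ltn_trans (h' : is_true (n.+1 <= l)%N) h; rewrite ltnn.
have tn m n (h : @dle ndir m n) : t m = t n \oc dmap F h.
  pose G := @rediag pt_dir ndir A (fun=> tt) (fun _ _ _ => I) (cdiag (F l)).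
  have := @nat_natural A F G t _ m n h; rewrite /= comp1m; apply=> k.
  by rewrite /= comp1m.
have P : @is_indhom A (IndObj F) (cind (F l))
    (fun n j f => @germ_eq A (F n) (cind (F l)) tt (t n) j f).
  apply: (@level_subproof A (IndObj F) (cind (F l)) (fun=> tt) t) => m n h.
  by rewrite -tn; exact: germ_refl.
pose T : @hom (ind A) (IndObj F) (cind (F l)) := exist _ _ P.
exists T; rewrite [LHS](hom_cin (_ : sval T l tt (idm _))).
  by apply: indhom_eq => -[]; exists tt, (idm _); split; exact: germ_refl.
have e : t l = idm (F l) by rewrite (tl l (leqnn l)) dmap_id.
by rewrite /= e; exact: germ_refl.
Qed.

Lemma germ_mono F n a (f g : hom a (F n)) : mono_steps F ->
  @germ_eq A a (IndObj F) n f n g -> f = g.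
Proof.
move=> st [l [h [h' e]]]; apply: (split_mono_inj (mono_steps_all st h)).
by rewrite e; congr comp; exact: dmap_irr.
Qed.

(** The quotient is the colimit of the quotients R n of the terms, whose transition maps are induced
    by those of F. The predicate K records that the quotients stay in a class of small objects. *)
Lemma sequence_quotient F (K : A -> Prop) (S : A) (m : forall n : nat, hom S (F n))
    (R : nat -> A) (t : forall n : nat, hom (F n) (R n)) :
  mono_steps F -> (forall n, dmap F (nstep n) \oc m n = m n.+1) ->
  (forall n, splits (m n) (t n)) -> (forall n, K (R n)) ->
  exists (D : diagram ndir A) (g : @hom (ind A) (IndObj F) (IndObj D)),
    [/\ mono_steps D, forall n, K (D n) &
        @splits (ind_add A) _ _ _ (@germ_hom A S (IndObj F) 0%N (m 0%N)) g].
Proof.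
move=> st mn ex KR.
pose F1 := @rediag pt_dir ndir A (fun=> tt) (fun _ _ _ => I) (cdiag S).
have mn1 n : dmap F (nstep n) \oc m n = m n.+1 \oc dmap F1 (nstep n).
  by rewrite /= compm1.
pose M : dnat F1 F := @nat_dnat A F1 F m mn1.
have mh k l (h : @dle ndir k l) : dmap F h \oc m k = m l.
  by have := dcompP M h; rewrite /= compm1.
have sx n : exists s, t n \oc s = idm _ by have [r [s []]] := ex n; exists s.
pose s n := sval (cid (sx n)); have sP n : t n \oc s n = idm _ := svalP (cid (sx n)).
(* The left side kills S, hence factors through t k, so inserting s k after t k does not change
   it. *)
have key k l (h : @dle ndir k l) : t l \oc dmap F h = t l \oc dmap F h \oc s k \oc t k.
  have [x xE] : exists x, t l \oc dmap F h = x \oc t k.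
    by apply: splits_sum (ex k) _; rewrite -compA mh (splits0 (ex l)).
  by rewrite xE -(compA x (t k)) sP compm1.
have Did i (h : @dle ndir i i) : t i \oc dmap F h \oc s i = idm _.
  by rewrite dmap_id compm1.
have Dco i j l (h : @dle ndir i j) (h' : @dle ndir j l) (h'' : @dle ndir i l) :
    (t l \oc dmap F h' \oc s j) \oc (t j \oc dmap F h \oc s i) = t l \oc dmap F h'' \oc s i.
  by rewrite !compA -key -(compA (t l)) (dmap_comp F h h' h'').
pose D : diagram ndir A := @Diagram ndir A R (fun k l h => t l \oc dmap F h \oc s k) Did Dco.
have tD n : dmap D (nstep n) \oc t n = t n.+1 \oc dmap F (nstep n).
  by rewrite /= -key.
pose T : dnat F D := @nat_dnat A F D t tD.
have stD : mono_steps D.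
  move=> n; have [r e] := st n; exists (t n \oc r \oc s n.+1) => /=.
  have [x xE] : exists x, t n \oc r = x \oc t n.+1.
    apply: splits_sum (ex n.+1) _.
    by rewrite -(mn n) !compA -(compA (t n)) e compm1 (splits0 (ex n)).
  by rewrite xE !compA -(compA x) sP compm1 -xE -(compA (t n)) e compm1 sP.
exists D, (level T); split=> //.
have cof (i : pt_dir) : exists d : ndir, @dle pt_dir i tt by exists 0%N.
have iso := @reind_iso pt_dir ndir A (fun=> tt) (fun _ _ _ => I) (cdiag S) cof.
have [v [v1 v2]] := iso.
apply: (@splits_iso (ind_add A) _ _ _ _ _ _ _ _ _ _ v (idm _) (idm _) _ _ _ _ _
  (@level_splits A F1 F D M T ex stD)).
- by exists (@reind pt_dir ndir A (fun=> tt) (fun _ _ _ => I) (cdiag S)).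
- exact: iso_id.
- exact: iso_id.
- rewrite [LHS]comp1m -[LHS]compm1 -[in LHS]v2 [LHS]compA; congr comp.
  apply: (@indhom_eq A (IndObj F1) (IndObj F)) => n.
  exists n, (m n); split; last exact: (@level_mem A ndir F1 F M).
  rewrite -[m n]compm1; apply: (@icomp_mem A (IndObj F1) (cind S) (IndObj F) _ _ n tt n).
    exact: germ_refl.
  have h : @dle ndir 0%N n by [].
  by rewrite -(mh _ _ h); exact: (@germ_imap A S (IndObj F)).
- by rewrite [LHS]comp1m [RHS]compm1.
Qed.

End SequenceColimits.

Section IdempotentsOfColimits.
Variable A : addcat.
Implicit Types F : diagram ndir A.
Variable K : A -> Prop.

Definition split_factor (a b : A) (f : hom a b) : Prop :=
  exists (c : A) (p : hom a c) (m : hom c b),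
    [/\ K c, split_epi p, split_mono m & f = m \oc p].

Hypothesis factK : forall (a b : A) (f : hom a b), K a -> K b -> split_factor f.

(* If e is represented by maps e_n : F_n -> F_{n+1}, its image is the colimit of the
   images of the e_n. *)
Lemma idempotent_colimit_steps F (e : @hom (ind A) (IndObj F) (IndObj F))
    (en : forall n : nat, hom (F n) (F n.+1)) :
  mono_steps F -> (forall n, K (F n)) -> e \oc e = e ->
  (forall n : nat, sval e n n.+1 (en n)) ->
  exists (E : diagram ndir A) (p : @hom (ind A) (IndObj F) (IndObj E)) (i : hom (IndObj E : ind A) (IndObj F)),
    [/\ mono_steps E, forall n, K (E n), p \oc i = idm _ & i \oc p = e].
Proof.
move=> st KF ee enP.
pose S' m n (h : (m <= n)%N) : @dle ndir m n := h.
have com m n (h : (m <= n)%N) (h' : (m.+1 <= n.+1)%N) :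
    dmap F (S' _ _ h') \oc en m = en n \oc dmap F (S' _ _ h).
  apply: (germ_mono st).
  exact: indhom_germ (indhom_post _ (enP m)) (indhom_pre _ (enP n)).
have idem n : en n.+1 \oc en n = dmap F (nstep n.+1) \oc en n.
  apply: (germ_mono st); apply: (indhom_germ (R := e)); last exact: indhom_post (enP n).
  by rewrite -ee; exact: icomp_mem (enP n) (enP n.+1).
have fx n : exists c : {c : A & (hom (F n) c * hom c (F n.+1) * hom c (F n) * hom (F n.+1) c)%type},
    [/\ K (tag c), (tagged c).1.1.1 \oc (tagged c).1.2 = idm _,
      (tagged c).2 \oc (tagged c).1.1.2 = idm _ &
      en n = (tagged c).1.1.2 \oc (tagged c).1.1.1].
  have [c [p [m [Kc [s sP] [r rP] E]]]] := factK (en n) (KF n) (KF n.+1).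
  by exists (existT _ c (p, m, s, r)).
have [c cP] := dchoice fx.
pose E0 n := tag (c n).
pose p n : hom (F n) (E0 n) := (tagged (c n)).1.1.1.
pose m n : hom (E0 n) (F n.+1) := (tagged (c n)).1.1.2.
pose s n : hom (E0 n) (F n) := (tagged (c n)).1.2.
pose r n : hom (F n.+1) (E0 n) := (tagged (c n)).2.
have KE n : K (E0 n) by have [] := cP n.
have ps n : p n \oc s n = idm _ by have [] := cP n.
have rm n : r n \oc m n = idm _ by have [] := cP n.
have mp n : en n = m n \oc p n by have [] := cP n.
(* By naturality of the e_n the transition maps of F carry the image of e_k into that of e_l, on
   which m l after r l is the identity. *)
have key k l (h : @dle ndir k l) :
    m l \oc (r l \oc (dmap F (S' k.+1 l.+1 h) \oc m k)) = dmap F (S' k.+1 l.+1 h) \oc m k.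
  have -> : m k = en k \oc s k by rewrite mp -compA ps compm1.
  have -> : dmap F (S' k.+1 l.+1 h) \oc (en k \oc s k) = m l \oc (p l \oc (dmap F h \oc s k)).
    by rewrite !compA -mp -(com _ _ (h : is_true (k <= l)%N)).
  by rewrite !compA -(compA (m l)) rm compm1.
have mI k a (f g : hom a (E0 k)) : m k \oc f = m k \oc g -> f = g.
  by apply: split_mono_inj; exists (r k).
have Eid k (h : @dle ndir k k) : r k \oc (dmap F (S' k.+1 k.+1 h) \oc m k) = idm _.
  by apply: mI; rewrite key dmap_id comp1m compm1.
have Eco i j l (h : @dle ndir i j) (h' : @dle ndir j l) (h'' : @dle ndir i l) :
    (r l \oc (dmap F (S' j.+1 l.+1 h') \oc m j)) \oc (r j \oc (dmap F (S' i.+1 j.+1 h) \oc m i)) =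
    r l \oc (dmap F (S' i.+1 l.+1 h'') \oc m i).
  apply: mI; rewrite [LHS]compA !key -(compA _ (m j)) (key i j h) compA.
  by rewrite (dmap_comp F _ _ (S' i.+1 l.+1 h'')).
pose E : diagram ndir A :=
  @Diagram ndir A E0 (fun k l h => r l \oc (dmap F (S' k.+1 l.+1 h) \oc m k)) Eid Eco.
pose p' n : hom (F n) (E n) := p n; pose m' n : hom (E n) (F n.+1) := m n.
have mI' k a (f g : hom a (E k)) : m' k \oc f = m' k \oc g -> f = g := @mI k a f g.
have mp' n : m' n \oc p' n = en n := esym (mp n).
have keyE k l (h : @dle ndir k l) (h' : @dle ndir k.+1 l.+1) :
  m' l \oc dmap E h = dmap F h' \oc m' k by rewrite (dmap_irr F h' (S' k.+1 l.+1 h)); exact: key.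
have KE' n : K (E n) := KE n.
pose s' n : hom (E n) (F n) := s n; pose r' n : hom (F n.+1) (E n) := r n.
have ps' n : p' n \oc s' n = idm _ := ps n.
have rm' n : r' n \oc m' n = idm _ := rm n.
clearbody r' s' p' m' E.
have pE n : dmap E (nstep n) \oc p' n = p' n.+1 \oc dmap F (nstep n).
  apply: mI'; rewrite !compA (keyE _ _ _ (nstep n.+1)) mp' -compA mp'; exact: com.
have stE : mono_steps E.
  move=> n; have [q qP] := st n.+1; exists (r' n \oc q \oc m' n.+1).
  rewrite -!compA (keyE n n.+1 _ (nstep n.+1)) (compA q) qP comp1m.
  exact: rm'.
pose P : dnat F E := @nat_dnat A F E p' pE.
have mn : @is_indhom A (IndObj E) (IndObj F) (fun k j f => @germ_eq A (E k) (IndObj F) k.+1 (m' k) j f).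
  apply: (@level_subproof A (IndObj E) (IndObj F) succn m') => k l h.
  by rewrite (keyE k l h h); exact/germ_sym/(@germ_imap A _ (IndObj F)).
pose M : @hom (ind A) (IndObj E) (IndObj F) := exist _ _ mn.
exists E, (level P), M; split=> //; apply: indhom_eq => n.
  exists n.+1, (p' n.+1 \oc m' n); split.
    exact: (@icomp_mem A (IndObj E) (IndObj F) (IndObj E) (level P) M n n.+1 n.+1 (m' n) (p' n.+1)
      (germ_refl _) (@level_mem A _ _ _ P n.+1)).
  have -> : p' n.+1 \oc m' n = dmap E (nstep n) \oc idm _.
    rewrite compm1; apply: mI'; rewrite compA mp' (keyE _ _ _ (nstep n.+1)).
    apply: (split_epi_inj (f := p' n)); first by exists (s' n).
    by rewrite -!compA mp' idem.
  exact: (@germ_imap A _ (IndObj E)).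
exists n.+1, (en n); split=> //; rewrite -mp'.
exact: (@icomp_mem A (IndObj F) (IndObj E) (IndObj F) M (level P) n n n.+1 (p' n) (m' n)
  (@level_mem A _ _ _ P n) (germ_refl _)).
Qed.

(** A cofinal subsequence phi is chosen along which e maps F (phi n) into F (phi n.+1); this reduces
    to one-step representatives. *)
Lemma idempotent_colimit F (e : @hom (ind A) (IndObj F) (IndObj F)) :
  mono_steps F -> (forall n, K (F n)) -> e \oc e = e ->
  exists (E : diagram ndir A) (p : @hom (ind A) (IndObj F) (IndObj E)) (i : hom (IndObj E : ind A) (IndObj F)),
    [/\ mono_steps E, forall n, K (E n), p \oc i = idm _ & i \oc p = e].
Proof.
move=> st KF ee.
have [||phi [_ phiP]] := @dep_choice (fun _ : nat => nat) (fun _ _ => True)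
    (fun n k l => (k < l)%N /\ exists f, sval e k l f).
- by exists 0%N.
- move=> n k _; have [j [f m]] := indhom_ex e k.
  have h : @dle ndir j (maxn j k.+1) := leq_maxl j k.+1.
  exists (maxn j k.+1); split=> //; split; first exact: leq_maxr.
  by exists (dmap F h \oc f); exact: (@indhom_post A (IndObj F) (IndObj F)).
have phim : forall m n : ndir, @dle ndir m n -> @dle ndir (phi m) (phi n).
  move=> m n; elim: n => [|n IH]; first by rewrite /= leqn0 => /eqP ->.
  rewrite /= leq_eqVlt => /orP [/eqP -> //|]; rewrite ltnS => /IH h.
  exact: leq_trans h (ltnW (phiP n).1).
have cof (n : ndir) : exists d : ndir, @dle ndir n (phi d).
  exists n; elim: n => [|n IH] //; exact: leq_ltn_trans IH (phiP n).1.
have [v [v1 v2]] := @reind_iso ndir ndir A phi phim F cof.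
pose F' := rediag phim F; pose rho : @hom (ind A) (IndObj F') (IndObj F) := reind phim F.
have ex n : exists f, sval e (phi n) (phi n.+1) f := (phiP n).2.
pose en n := sval (cid (ex n)); have enP n : sval e (phi n) (phi n.+1) (en n) := svalP (cid (ex n)).
pose e' : hom (IndObj F' : ind A) (IndObj F') := v \oc (e \oc rho).
have e'e : e' \oc e' = e'.
  by rewrite /e' -compA -(compA e) (compA rho) v2 comp1m (compA e) ee.
have en'P n : sval e' n n.+1 (en n).
  have [j [f m]] := indhom_ex e' n.
  apply: (indhom_closed m).
  have [l [h [h' E]]] : @germ_eq A _ (IndObj F) (phi j) f (phi n.+1) (en n).
    have m1 : sval (rho \oc e') n (phi j) (idm _ \oc f).
      by apply: (@icomp_mem A (IndObj F') (IndObj F') (IndObj F) rho e' n j _ f) m _; exact: germ_refl.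
    rewrite /e' !compA v2 comp1m comp1m in m1.
    apply: indhom_germ m1 _; rewrite -[en n]compm1.
    apply: (@icomp_mem A (IndObj F') (IndObj F) (IndObj F) e rho n (phi n)) (enP n).
    exact: germ_refl.
  have [d ld] := cof l.
  have [q [jq nq dq]] : exists q : ndir, [/\ @dle ndir j q, @dle ndir n.+1 q & @dle ndir d q].
    by exists (maxn j (maxn n.+1 d)); split; rewrite /= !leq_max leqnn ?orbT.
  exists q, jq, nq => /=.
  have k : @dle ndir l (phi q) := leq_trans ld (phim _ _ dq).
  by rewrite -(dmap_comp F h k) -(dmap_comp F h' k) -!compA E.
have st' : mono_steps F' by move=> n; exact: (mono_steps_all st).
have [E [p [i [stE KE pi ip]]]] :=
  idempotent_colimit_steps st' (fun n => KF (phi n)) e'e en'P.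
exists E, (p \oc v), (rho \oc i); split=> //.
  by rewrite -compA (compA v) v1 comp1m.
by rewrite -compA (compA i) ip /e' !compA v2 comp1m -compA v2 compm1.
Qed.

End IdempotentsOfColimits.

(** * Locally compact objects over split exact categories *)

(* Additive categories with split idempotents in which the exact sequences are the split
   ones.  Passing to locally compact objects preserves these properties for finite
   dimensional vector spaces, so that they hold for 0-Tate and 1-Tate spaces. *)
Record gex : Type := Gex {
  gadd :> addcat;
  gses : forall a b c : gadd, hom a b -> hom b c -> Prop;
  gsesP : forall (a b c : gadd) (f : hom a b) (g : hom b c), gses f g <-> splits f g;
  gzero : exists z : gadd, idm z = 0;
  gbip : forall a b : gadd, exists (c : gadd) (f : hom a c) (g : hom c b), splits f g;
  gidem : forall (a : gadd) (e : hom a a), e \oc e = e ->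
    exists (b : gadd) (p : hom a b) (i : hom b a), p \oc i = idm b /\ i \oc p = e }.

Definition gexcat (G : gex) : excat := @ExCat (acat G) (@gses G).

Definition pro_add (A : addcat) : addcat := op_add (ind_add (op_add A)).
Definition indpro_add (A : addcat) : addcat := ind_add (pro_add A).

Section SplitExact.
Variable G : gex.
Implicit Types a b c : G.

(** The cokernel is the image of the idempotent 1 - f r. *)
Lemma split_mono_splits a b (f : hom a b) : split_mono f ->
  exists (c : G) (g : hom b c), splits f g.
Proof.
move=> [r rf]; pose e := idm b - f \oc r.
have ee : e \oc e = e.
  rewrite {1}/e compBl comp1m /e compBr compm1 -(compA f) (compA r) rf comp1m.
  by rewrite haddNr hopp0 haddr0.
have [c [p [i [pi ip]]]] := gidem ee.
exists c, p, r, i; split=> //.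
  apply: (split_mono_inj (f := i)); first by exists p.
  by rewrite comp0r compA ip /e compBl comp1m -compA rf compm1 haddNr.
by rewrite ip haddC hsubK.
Qed.

Lemma split_epi_splits b c (g : hom b c) : split_epi g ->
  exists (a : G) (f : hom a b), splits f g.
Proof.
move=> [s gs]; have [] := @split_mono_splits c b s; first by exists g.
move=> a [q [r [i [e1 e2 e3 e4]]]].
pose e := idm b - s \oc g.
have ee : e \oc e = e.
  rewrite {1}/e compBl comp1m /e compBr compm1 -(compA s) (compA g) gs comp1m.
  by rewrite haddNr hopp0 haddr0.
have [k [p [j [pj jp]]]] := gidem ee.
exists k, j, p, s; split=> //.
  apply: (split_epi_inj (f := p)); first by exists j.
  by rewrite comp0l -compA jp /e compBr compm1 compA gs comp1m haddNr.
by rewrite jp hsubK.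
Qed.

Lemma inflationP a b (f : hom a b) : inflation (C := gexcat G) f <-> split_mono f.
Proof.
split=> [[c [g /gsesP /splits_mono]] //|/split_mono_splits [c [g s]]].
by exists c, g; apply/gsesP.
Qed.

Lemma deflationP b c (g : hom b c) : deflation (C := gexcat G) g <-> split_epi g.
Proof.
split=> [[a [f /gsesP /splits_epi]] //|/split_epi_splits [a [f s]]].
by exists a, f; apply/gsesP.
Qed.

(** In a cartesian square with h a split epimorphism, f is the kernel of r h, so parallel sides
    share the cokernel x. *)
Lemma cartesian_splits a b c d x (f : hom a b) (g : hom a c) (h : hom b d) (k : hom c d)
    (r : hom d x) : cartesian f g h k -> split_mono f -> split_epi h -> splits k r ->
  splits f (r \oc h).
Proof.
move=> [e car] mf eh kr; apply: kernel_splits.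
- by apply: split_epi_comp eh; exact: splits_epi kr.
- by rewrite -compA e compA (splits0 kr) comp0l.
- by move=> y u v; exact: split_mono_inj.
- move=> y u; rewrite -compA => /(splits_ker kr) [v e'].
  by have [z [[<- _] _]] := car _ _ _ e'; exists z.
Qed.

End SplitExact.

(** * Direct sums of diagrams *)

Section SumsOfDiagrams.
Variable A : addcat.

(** All five identities are kept so that the notion is self-dual: cocartesian squares of sums are
    obtained from [cartesian_sum] in the opposite category. *)
Record bip (a b c : A) : Type := Bip {
  bi1 : hom a c; bi2 : hom b c; bp1 : hom c a; bp2 : hom c b;
  bp1i1 : bp1 \oc bi1 = idm a; bp2i2 : bp2 \oc bi2 = idm b;
  bp2i1 : bp2 \oc bi1 = 0; bp1i2 : bp1 \oc bi2 = 0;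
  bip_sum : bi1 \oc bp1 + bi2 \oc bp2 = idm c }.

Lemma bip_joint (a b c d : A) (B : bip a b c) (f g : hom d c) :
  bp1 B \oc f = bp1 B \oc g -> bp2 B \oc f = bp2 B \oc g -> f = g.
Proof.
move=> e e'; rewrite -[f]comp1m -[g]comp1m -(bip_sum B) !compDl -!compA.
by rewrite e e'.
Qed.

Definition bmap2 (a b c a' b' c' : A) (B : bip a b c) (B' : bip a' b' c')
  (f : hom a a') (g : hom b b') : hom c c' := bi1 B' \oc f \oc bp1 B + bi2 B' \oc g \oc bp2 B.

Section Maps.
Variables (a b c a' b' c' : A) (B : bip a b c) (B' : bip a' b' c').
Variables (f : hom a a') (g : hom b b').

Lemma bp1_map : bp1 B' \oc bmap2 B B' f g = f \oc bp1 B.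
Proof. by rewrite compDr !compA bp1i1 bp1i2 comp1m !comp0l haddr0. Qed.
Lemma bp2_map : bp2 B' \oc bmap2 B B' f g = g \oc bp2 B.
Proof. by rewrite compDr !compA bp2i1 bp2i2 comp1m !comp0l hadd0. Qed.
Lemma bmap_i1 : bmap2 B B' f g \oc bi1 B = bi1 B' \oc f.
Proof. by rewrite compDl -!compA bp1i1 bp2i1 compm1 !comp0r haddr0. Qed.
Lemma bmap_i2 : bmap2 B B' f g \oc bi2 B = bi2 B' \oc g.
Proof. by rewrite compDl -!compA bp1i2 bp2i2 compm1 !comp0r hadd0. Qed.
End Maps.

Lemma bmap2_id (a b c : A) (B : bip a b c) : bmap2 B B (idm a) (idm b) = idm c.
Proof. by rewrite /bmap2 !compm1 bip_sum. Qed.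

Lemma bmap2_comp (a b c a' b' c' a2 b2 c2 : A) (B : bip a b c) (B' : bip a' b' c')
    (B2 : bip a2 b2 c2) (f : hom a a') (g : hom b b') (f' : hom a' a2) (g' : hom b' b2) :
  bmap2 B' B2 f' g' \oc bmap2 B B' f g = bmap2 B B2 (f' \oc f) (g' \oc g).
Proof.
apply: (bip_joint (B := B2)).
  by rewrite compA bp1_map -compA !bp1_map compA.
by rewrite compA bp2_map -compA !bp2_map compA.
Qed.

Lemma cartesian_sum (a1 b1 c1 a2 b2 c2 a3 b3 c3 a4 b4 c4 : A)
    (B1 : bip a1 b1 c1) (B2 : bip a2 b2 c2) (B3 : bip a3 b3 c3) (B4 : bip a4 b4 c4)
    (f : hom a1 a2) (g : hom a1 a3) (h : hom a2 a4) (k : hom a3 a4)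
    (f' : hom b1 b2) (g' : hom b1 b3) (h' : hom b2 b4) (k' : hom b3 b4)
    (F : hom c1 c2) (U : hom c1 c3) (H : hom c2 c4) (K : hom c3 c4) :
  bp1 B2 \oc F = f \oc bp1 B1 -> bp2 B2 \oc F = f' \oc bp2 B1 ->
  bp1 B3 \oc U = g \oc bp1 B1 -> bp2 B3 \oc U = g' \oc bp2 B1 ->
  bp1 B4 \oc H = h \oc bp1 B2 -> bp2 B4 \oc H = h' \oc bp2 B2 ->
  bp1 B4 \oc K = k \oc bp1 B3 -> bp2 B4 \oc K = k' \oc bp2 B3 ->
  cartesian f g h k -> cartesian f' g' h' k' -> cartesian F U H K.
Proof.
move=> eF eF' eU eU' eH eH' eK eK' [e car] [e' car']; split.
  apply: (bip_joint (B := B4)).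
    by rewrite !compA eH eK -!compA eF eU !compA e.
  by rewrite !compA eH' eK' -!compA eF' eU' !compA e'.
move=> t x y xy.
have [|z [[z1 z2] zu]] := car t (bp1 B2 \oc x) (bp1 B3 \oc y).
  by rewrite !compA -eH -eK -!compA xy.
have [|w [[w1 w2] wu]] := car' t (bp2 B2 \oc x) (bp2 B3 \oc y).
  by rewrite !compA -eH' -eK' -!compA xy.
have q1 : bp1 B1 \oc (bi1 B1 \oc z + bi2 B1 \oc w) = z.
  by rewrite compDr !compA bp1i1 bp1i2 comp1m comp0l haddr0.
have q2 : bp2 B1 \oc (bi1 B1 \oc z + bi2 B1 \oc w) = w.
  by rewrite compDr !compA bp2i1 bp2i2 comp1m comp0l hadd0.
exists (bi1 B1 \oc z + bi2 B1 \oc w); split.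
  split; [apply: (bip_joint (B := B2))|apply: (bip_joint (B := B3))].
  - by rewrite compA eF -compA q1.
  - by rewrite compA eF' -compA q2.
  - by rewrite compA eU -compA q1.
  - by rewrite compA eU' -compA q2.
move=> v [v1 v2]; apply: (bip_joint (B := B1)); rewrite ?q1 ?q2.
  by apply: zu; rewrite -v1 -v2 !compA eF eU.
by apply: wu; rewrite -v1 -v2 !compA eF' eU'.
Qed.

End SumsOfDiagrams.

Definition bip_op (A : addcat) (a b c : A) (B : bip a b c) : @bip (op_add A) a b c :=
  @Bip (op_add A) a b c (bp1 B) (bp2 B) (bi1 B) (bi2 B)
    (bp1i1 B) (bp2i2 B) (bp1i2 B) (bp2i1 B) (bip_sum B).

Lemma bip_ex (G : gex) (a b : G) : exists c : {c : G & bip a b c}, True.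
Proof.
have [c [f [g [r [s [e1 e2 e3 e4]]]]]] := gbip a b.
have e5 : r \oc s = 0.
  have := f_equal (fun h => r \oc h \oc s) e4 => /=.
  rewrite compDr compDl !compA e1 comp1m -!compA e2 !compm1 => e.
  by apply: (@haddI _ _ _ (r \oc s)); rewrite e haddr0 comp1m.
by exists (existT _ c (Bip e1 e2 e3 e5 e4)).
Qed.

Section DiagramSum.
Variables (G : gex) (I J : corder).
Notation C := (gexcat G).
Implicit Types F : lcdiag C I J.

(** The splittings are themselves maps of diagrams. The lemma is used to realise an arbitrary split
    sequence with locally compact ends as a levelwise one. *)
Lemma lcsum F1 F3 : exists (F2 : lcdiag C I J) (s : lcmap F1 F2) (t : lcmap F2 F3)
    (r : lcmap F2 F1) (q : lcmap F3 F2), forall i j,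
  [/\ r i j \oc s i j = idm (F1 i j : G), t i j \oc q i j = idm (F3 i j : G),
     t i j \oc s i j = hzero (F1 i j : G) (F3 i j) &
     hadd (s i j \oc r i j : @hom G (F2 i j) (F2 i j)) (q i j \oc t i j) = idm _].
Proof.
have ex (x : I * J) := bip_ex (F1 x.1 x.2 : G) (F3 x.1 x.2).
have [c _] := dchoice ex.
pose B i j : bip (F1 i j : G) (F3 i j) (tag (c (i, j))) := tagged (c (i, j)).
pose ob2 i j : C := tag (c (i, j)).
pose ver i i' j (h : cle i i') : hom (ob2 i' j) (ob2 i j) :=
  bmap2 (B i' j) (B i j) (lver F1 j h) (lver F3 j h).
pose hor i j j' (h : cle j j') : hom (ob2 i j) (ob2 i j') :=
  bmap2 (B i j) (B i j') (lhor F1 i h) (lhor F3 i h).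
have v1 i j (h : cle i i) : ver i i j h = idm (ob2 i j).
  by rewrite /ver !lver_id bmap2_id.
have h1 i j (h : cle j j) : hor i j j h = idm (ob2 i j).
  by rewrite /hor !lhor_id bmap2_id.
have v2 i i' i'' j (h : cle i i') (h' : cle i' i'') (h'' : cle i i'') :
    ver i i' j h \oc ver i' i'' j h' = ver i i'' j h''.
  by rewrite /ver [LHS]bmap2_comp (lver_comp F1 j h h' h'') (lver_comp F3 j h h' h'').
have h2 i j j' j'' (h : cle j j') (h' : cle j' j'') (h'' : cle j j'') :
    hor i j' j'' h' \oc hor i j j' h = hor i j j'' h''.
  by rewrite /hor [LHS]bmap2_comp (lhor_comp F1 i h h' h'') (lhor_comp F3 i h h' h'').
have ca i i' j j' (h : cle i i') (k : cle j j') :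
    cartesian (hor i' j j' k) (ver i i' j h) (ver i i' j' h) (hor i j j' k).
  apply: (@cartesian_sum G _ _ _ _ _ _ _ _ _ _ _ _ (B i' j) (B i' j') (B i j) (B i j')
    _ _ _ _ _ _ _ _ _ _ _ _ _ _ _ _ _ _ _ _ (lcart F1 h k) (lcart F3 h k));
    (exact: bp1_map || exact: bp2_map).
have O1 (a b c a' b' c' : G) (X : bip a b c) (Y : bip a' b' c') f g :
  @comp (op_add G) _ _ _ (bp1 (bip_op X)) (bmap2 X Y f g) =
  @comp (op_add G) _ _ _ f (bp1 (bip_op Y)) := bmap_i1 X Y f g.
have O2 (a b c a' b' c' : G) (X : bip a b c) (Y : bip a' b' c') f g :
  @comp (op_add G) _ _ _ (bp2 (bip_op X)) (bmap2 X Y f g) =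
  @comp (op_add G) _ _ _ g (bp2 (bip_op Y)) := bmap_i2 X Y f g.
have co i i' j j' (h : cle i i') (k : cle j j') :
    cocartesian (hor i' j j' k) (ver i i' j h) (ver i i' j' h) (hor i j j' k).
  apply: (@cartesian_sum (op_add G) _ _ _ _ _ _ _ _ _ _ _ _
    (bip_op (B i j')) (bip_op (B i' j')) (bip_op (B i j)) (bip_op (B i' j))
    _ _ _ _ _ _ _ _ _ _ _ _ _ _ _ _ _ _ _ _ (lcocart F1 h k) (lcocart F3 h k));
    (exact: O1 || exact: O2).
have de i i' j (h : cle i i') : deflation (ver i i' j h).
  apply/deflationP.
  have [s e] := (deflationP _).1 (lver_defl F1 j h).
  have [s' e'] := (deflationP _).1 (lver_defl F3 j h).
  by exists (bmap2 (B i j) (B i' j) s s'); rewrite [LHS]bmap2_comp e e' bmap2_id.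
have inf i j j' (h : cle j j') : inflation (hor i j j' h).
  apply/inflationP.
  have [s e] := (inflationP _).1 (lhor_infl F1 i h).
  have [s' e'] := (inflationP _).1 (lhor_infl F3 i h).
  by exists (bmap2 (B i j') (B i j) s s'); rewrite [LHS]bmap2_comp e e' bmap2_id.
pose F2 : lcdiag C I J := @LcDiag C I J ob2 ver hor v1 h1 v2 h2 ca co de inf.
exists F2.
exists (@LcMap C I J F1 F2 (fun i j => bi1 (B i j)) (fun _ _ _ _ => bmap_i1 _ _ _ _)
  (fun _ _ _ _ => bmap_i1 _ _ _ _)).
exists (@LcMap C I J F2 F3 (fun i j => bp2 (B i j)) (fun _ _ _ _ => esym (bp2_map _ _ _ _))
  (fun _ _ _ _ => esym (bp2_map _ _ _ _))).
exists (@LcMap C I J F2 F1 (fun i j => bp1 (B i j)) (fun _ _ _ _ => esym (bp1_map _ _ _ _))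
  (fun _ _ _ _ => esym (bp1_map _ _ _ _))).
exists (@LcMap C I J F3 F2 (fun i j => bi2 (B i j)) (fun _ _ _ _ => bmap_i2 _ _ _ _)
  (fun _ _ _ _ => bmap_i2 _ _ _ _)).
move=> i j; split; [exact: bp1i1|exact: bp2i2|exact: bp2i1|exact: bip_sum].
Qed.

End DiagramSum.

Lemma iso_square (C : category) (a b a' b' : C) (u : hom a b) (u' : hom a' b')
    (m : hom a a') (n : hom b b') (v : hom b a) (v' : hom b' a') :
  u \oc v = idm b -> v' \oc u' = idm a' -> n \oc u = u' \oc m -> m \oc v = v' \oc n.
Proof.
move=> e e' e2; rewrite -[n]compm1 -e !compA.
by rewrite -(compA v') e2 compA e' comp1m.
Qed.

(** * Reindexing of two-variable diagrams *)

Section ReindexDiagram.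
Variables (G : gex) (I J I' J' : corder).
Notation C := (gexcat G).
Variables (phi : I' -> I) (psi : J' -> J).
Hypotheses (phim : forall i j, cle i j -> cle (phi i) (phi j))
  (psim : forall i j, cle i j -> cle (psi i) (psi j)).

Definition lcre (F : lcdiag C I J) : lcdiag C I' J'.
refine (@LcDiag C I' J' (fun i j => F (phi i) (psi j))
  (fun i i' j h => lver F (psi j) (phim h)) (fun i j j' h => lhor F (phi i) (psim h))
  _ _ _ _ (fun i i' j j' h k => lcart F (phim h) (psim k))
  (fun i i' j j' h k => lcocart F (phim h) (psim k))
  (fun i i' j h => lver_defl F (psi j) (phim h)) (fun i j j' h => lhor_infl F (phi i) (psim h))).
- by move=> i j h; exact: lver_id.
- by move=> i j h; exact: lhor_id.
- by move=> i i' i'' j h h' h''; exact: lver_comp.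
- by move=> i j j' j'' h h' h''; exact: lhor_comp.
Defined.

Definition lcremap (F F' : lcdiag C I J) (t : lcmap F F') : lcmap (lcre F) (lcre F') :=
  @LcMap C I' J' (lcre F) (lcre F') (fun i j => t (phi i) (psi j))
    (fun i i' j h => lcomp_ver t (psi j) (phim h)) (fun i j j' h => lcomp_hor t (phi i) (psim h)).

Hypotheses (phic : forall i, exists d, cle i (phi d)) (psic : forall j, exists d, cle j (psi d)).

Lemma lcre_row_nat (F : lcdiag C I J) j (i i' : dir_of I') (h : dle i i') :
  dmap (lrow F (psi j)) (phim h) \oc @idm (opcat C) (F (phi i) (psi j)) =
  @idm (opcat C) (F (phi i') (psi j)) \oc dmap (lrow (lcre F) j) h.
Proof. by rewrite [LHS]compm1 [RHS]comp1m. Qed.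

Definition lcre_row (F : lcdiag C I J) j : @hom (pro C) (lrow_obj F (psi j)) (lrow_obj (lcre F) j) :=
  @reindex (dir_of I) (dir_of I') (opcat C) phi phim (lrow F (psi j)) (lrow (lcre F) j)
    _ (@lcre_row_nat F j).

Lemma lcre_row_iso F j : is_iso (lcre_row F j).
Proof.
have [v [v1 v2]] := @reindex_iso (dir_of I) (dir_of I') (opcat C) phi phim (lrow F (psi j))
  (lrow (lcre F) j) _ (@lcre_row_nat F j) phic (fun i => @iso_id (opcat C) _).
by exists v.
Qed.

(** A morphism of Pro is a reversed morphism of Ind of the opposite category, so [lcre_row] runs
    from the old row to the new one; the comparison of the columns takes the opposite direction. *)
Definition lcre_inv F j := sval (cid (lcre_row_iso F j)).
Lemma lcre_inv1 F j : lcre_inv F j \oc lcre_row F j = idm _.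
Proof. by rewrite /lcre_inv; case: cid => x []. Qed.
Lemma lcre_inv2 F j : lcre_row F j \oc lcre_inv F j = idm _.
Proof. by rewrite /lcre_inv; case: cid => x []. Qed.

Lemma lcre_col_nat F (j j' : dir_of J') (h : dle j j') :
  dmap (indpro_dia F) (psim h) \oc lcre_inv F j = lcre_inv F j' \oc dmap (indpro_dia (lcre F)) h.
Proof.
apply: iso_square (lcre_inv2 F j) (lcre_inv1 F j') _.
apply: esym.
exact: (@reindex_nat (dir_of I) (dir_of I') (opcat C) phi phim (lrow F (psi j')) (lrow F (psi j))
  (lrow (lcre F) j') (lrow (lcre F) j) _ _ (@lcre_row_nat F j') (@lcre_row_nat F j)
  (lrow_nat F (psim h)) (lrow_nat (lcre F) h)
  (fun i => etrans (@compm1 (opcat C) _ _ _) (esym (@comp1m (opcat C) _ _ _)))).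
Qed.

Definition lcre_iso F : @hom (ind (pro C)) (indpro (lcre F)) (indpro F) :=
  @reindex (dir_of J) (dir_of J') (pro C) psi psim (indpro_dia F) (indpro_dia (lcre F))
    _ (@lcre_col_nat F).

Lemma lcre_isoP F : is_iso (lcre_iso F).
Proof.
apply: reindex_iso => // j; exists (lcre_row F j).
by split; [exact: lcre_inv2|exact: lcre_inv1].
Qed.

Lemma lcre_iso_nat F F' (t : lcmap F F') :
  indpro_map t \oc lcre_iso F = lcre_iso F' \oc indpro_map (lcremap t).
Proof.
apply: reindex_nat => j.
apply: iso_square (lcre_inv2 F j) (lcre_inv1 F' j) _.
apply: esym.
exact: (@reindex_nat (dir_of I) (dir_of I') (opcat C) phi phim (lrow F' (psi j)) (lrow F (psi j))
  (lrow (lcre F') j) (lrow (lcre F) j) _ _ (@lcre_row_nat F' j) (@lcre_row_nat F j)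
  (@DNat _ (opcat C) (lrow F' (psi j)) (lrow F (psi j)) (fun i => t i (psi j))
    (fun i i' h => esym (lcomp_ver t (psi j) h)))
  (@DNat _ (opcat C) (lrow (lcre F') j) (lrow (lcre F) j) (fun i => lcremap t i j)
    (fun i i' h => esym (lcomp_ver (lcremap t) j h)))
  (fun i => etrans (@compm1 (opcat C) _ _ _) (esym (@comp1m (opcat C) _ _ _)))).
Qed.

End ReindexDiagram.

Section NatRows.
Variables (G : gex) (J : corder).
Notation C := (gexcat G).
Implicit Types F : lcdiag C natc J.

Lemma row_mono_steps F j : @mono_steps (op_add G) (lrow F j).
Proof.
move=> n; have [s e] := (deflationP _).1 (lver_defl F j (nstep n)).
by exists s.
Qed.

Lemma row_splits F1 F2 F3 (s : lcmap F1 F2) (t : lcmap F2 F3) j :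
  (forall i j, gses (s i j) (t i j)) ->
  @splits (pro_add G) _ _ _ (lcmap_row s j) (lcmap_row t j).
Proof.
move=> ex; apply: (@splits_op (ind_add (op_add G))).
apply: (@level_splits (op_add G) (lrow F3 j) (lrow F2 j) (lrow F1 j)).
  by move=> n; apply: splits_op; apply/gsesP; exact: ex.
exact: row_mono_steps.
Qed.

(** Since the squares are cartesian, the cokernel of the inclusion of the two rows is the same at
    every level i, so it is a constant pro-object. *)
Lemma row_quotient F (j j' : J) (h : cle j j') :
  exists (R : G) (t : hom (lrow_obj F j') (cpro R)),
    @splits (pro_add G) (lrow_obj F j) _ _ (lrow_map F h) t.
Proof.
(* R is the cokernel at level 0, and the level n term of the projection goes through the vertical
   arrow down to level 0. *)
have [R [r kr]] := split_mono_splits ((inflationP _).1 (lhor_infl F 0%N h)).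
pose cR : diagram ndir (opcat G) := @rediag pt_dir ndir _ (fun=> tt) (fun _ _ _ => I) (cdiag (R : opcat G)).
have z n : @cle natc 0%N n by [].
pose T0 n : @hom (opcat G) (cR n) (lrow F j' n) := r \oc lver F j' (z n).
have T0P n : dmap (lrow F j') (nstep n) \oc T0 n = T0 n.+1 \oc dmap cR (nstep n).
  rewrite [RHS]compm1 /T0 /= -[LHS]/(@comp G _ _ _ (@comp G _ _ _ r _) _) -compA.
  by congr comp; exact: (lver_comp F).
pose T : dnat cR (lrow F j') := @nat_dnat (opcat G) _ _ T0 T0P.
have ex n : @splits (op_add G) _ _ _ (T n) (lrow_nat F h n).
  apply: splits_op; apply: cartesian_splits kr; first exact: (lcart F (z n) h).
    exact/inflationP/lhor_infl.
  exact/deflationP/lver_defl.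
have := @level_splits (op_add G) cR (lrow F j') (lrow F j) T (lrow_nat F h) ex (@row_mono_steps F j).
move=> /(@splits_op (ind_add (op_add G))) sp.
have [v [v1 v2]] := @reind_iso pt_dir ndir (opcat G) (fun=> tt) (fun _ _ _ => I) (cdiag (R : opcat G))
  (fun _ => ex_intro _ 0%N Logic.I).
pose rho : @hom (pro C) (cpro (R : C)) (IndObj cR) :=
  @reind pt_dir ndir (opcat G) (fun=> tt) (fun _ _ _ => Logic.I) (cdiag (R : opcat G)).
pose v' : @hom (pro C) (IndObj cR) (cpro (R : C)) := v.
exists R, (v' \oc (level T : @hom (pro C) (lrow_obj F j') (IndObj cR))).
apply: (@splits_iso (pro_add G) _ _ _ _ _ _ _ _ _ _ (idm _) (idm _) rho _ _ _ _ _ sp).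
- exact: (@iso_id (pro C)).
- exact: (@iso_id (pro C)).
- by exists v; split; [exact: v2|exact: v1].
- by rewrite [LHS]comp1m [RHS]compm1.
- have rv : rho \oc v' = idm _ := v1.
  by rewrite [RHS]compm1 [LHS]compA; exact: etrans (f_equal (comp^~ _) rv) (comp1m _).
Qed.

End NatRows.

Lemma isomorphic_sym (C : category) (a b : C) : isomorphic a b -> isomorphic b a.
Proof. by move=> [f [g [e1 e2]]]; exists g, f. Qed.
Lemma isomorphic_trans (C : category) (a b c : C) :
  isomorphic a b -> isomorphic b c -> isomorphic a c.
Proof. by move=> [f i] [g j]; exists (g \oc f); exact: iso_comp. Qed.

Lemma splits_isoV (A : addcat) (a b c a' b' c' : A) (f : hom a b) (g : hom b c)
    (f' : hom a' b') (g' : hom b' c') (u : hom a' a) (v : hom b' b) (w : hom c' c) :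
  is_iso u -> is_iso v -> is_iso w -> f \oc u = v \oc f' -> g \oc v = w \oc g' ->
  splits f' g' -> splits f g.
Proof.
move=> [u' [u1 u2]] [v' [v1 v2]] [w' [w1 w2]] e1 e2.
apply: (@splits_iso _ _ _ _ _ _ _ _ _ _ _ u' v' w'); try by eexists; split; eassumption.
  apply/esym; exact: iso_square u2 v1 e1.
apply/esym; exact: iso_square v2 w1 e2.
Qed.

Section LocallyCompactSplit.
Variable G : gex.
Notation C := (gexcat G).
Notation IP := (ind (pro C)).
Notation A := (indpro_add G).

Lemma col_mono_steps (F : lcdiag C natc natc) : @mono_steps (pro_add G) (indpro_dia F).
Proof.
move=> n; have [R [t sp]] := row_quotient F (nstep n); exact: splits_mono sp.
Qed.

Lemma indpro_splits (F1 F2 F3 : lcdiag C natc natc) (s : lcmap F1 F2) (t : lcmap F2 F3) :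
  (forall i j, gses (s i j) (t i j)) -> @splits A _ _ _ (indpro_map s) (indpro_map t).
Proof.
move=> ex; apply: (@level_splits (pro_add G) (indpro_dia F1) (indpro_dia F2) (indpro_dia F3)).
  by move=> n; exact: row_splits.
exact: col_mono_steps.
Qed.

(** Cofinal sequences replace both orders by [natc]. Then [level_splits] is applied twice: to each
    row in the opposite category, and to the sequence of rows in Ind. *)
Lemma lc_ses_splits (X Y Z : IP) (f : hom X Y) (g : hom Y Z) :
  lc_ses f g -> @splits A X Y Z f g.
Proof.
move=> [I [J [F1 [F2 [F3 [s [t [ex [a [b [c [[ia ib ic] [e1 e2]]]]]]]]]]]]].
apply: (@splits_iso A X Y Z _ _ _ f g (indpro_map s) (indpro_map t) a b c) => //.
have [phi [phim phic]] := corder_cofinal I; have [psi [psim psic]] := corder_cofinal J.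
pose pm : forall i j : natc, cle i j -> cle (phi i) (phi j) := phim.
pose sm : forall i j : natc, cle i j -> cle (psi i) (psi j) := psim.
have iso F := @lcre_isoP G I J natc natc phi psi pm sm phic psic F.
have nat F F' (m : lcmap F F') := @lcre_iso_nat G I J natc natc phi psi pm sm phic F F' m.
have sp : @splits A _ _ _ (indpro_map (lcremap pm sm s)) (indpro_map (lcremap pm sm t)).
  by apply: indpro_splits => i j; exact: ex.
exact: (@splits_isoV A (indpro F1) (indpro F2) (indpro F3) _ _ _ (indpro_map s) (indpro_map t)
  _ _ _ _ _ (iso F1) (iso F2) (iso F3) (nat _ _ s) (nat _ _ t) sp).
Qed.

Lemma is_lc_nat (X : IP) : is_lc X -> exists F : lcdiag C natc natc, isomorphic X (indpro F).
Proof.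
move=> [I [J [F iX]]].
have [phi [phim phic]] := corder_cofinal I; have [psi [psim psic]] := corder_cofinal J.
pose pm : forall i j : natc, cle i j -> cle (phi i) (phi j) := phim.
pose sm : forall i j : natc, cle i j -> cle (psi i) (psi j) := psim.
exists (lcre pm sm F); apply: isomorphic_trans iX _; apply: isomorphic_sym.
exists (@lcre_iso G I J natc natc phi psi pm sm phic F); exact: lcre_isoP.
Qed.

(** The ends are presented over the same index [natc] in both directions, and the middle term, being
    determined by the ends up to isomorphism, is the levelwise sum of their diagrams. *)
Lemma splits_lc_ses (X Y Z : IP) (f : hom X Y) (g : hom Y Z) :
  @splits A X Y Z f g -> is_lc X -> is_lc Z -> is_lc Y /\ lc_ses f g.
Proof.
move=> sp /is_lc_nat [F1 [a ia]] /is_lc_nat [F3 [c ic]].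
have [F2 [s [t [r [q e]]]]] := lcsum F1 F3.
have ex i j : gses (s i j : @hom G _ _) (t i j).
  by apply/gsesP; exists (r i j), (q i j); have [] := e i j.
have [b [ib e1 e2]] := @splits_iso_ex A _ _ _ _ _ _ _ _ _ _ a c sp (indpro_splits ex) ia ic.
split; first by exists natc, natc, F2, b.
by exists natc, natc, F1, F2, F3, s, t; split=> //; exists a, b, c.
Qed.

Definition finite_pro (P : pro C) : Prop := exists a : G, isomorphic P (cpro (a : C)).

(** In the opposite category [mono_steps] says that the transition maps of the pro-object are split
    epimorphisms. *)
Lemma compact_diagram (L : IP) : is_compact L ->
  exists E : diagram ndir (opcat G), @mono_steps (op_add G) E /\
    isomorphic L (@cind (pro C) (IndObj E)).
Proof.
move=> [I [J [F [J1 iL]]]].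
have [phi [phim phic]] := corder_cofinal I; have [j0] := cinh J.
pose pm : forall i j : natc, cle i j -> cle (phi i) (phi j) := phim.
pose sm : forall i j : natc, cle i j -> cle j0 j0 := fun _ _ _ => cle_refl j0.
have psic j : exists d : natc, cle j j0 by exists 0%N; rewrite (J1 j j0); exact: cle_refl.
pose F' := lcre pm sm F; exists (lrow F' 0%N); split; first exact: row_mono_steps.
apply: isomorphic_trans iL _; apply: (@isomorphic_trans _ _ (indpro F')).
  apply: isomorphic_sym; exists (@lcre_iso G I J natc natc phi (fun=> j0) pm sm phic F).
  exact: lcre_isoP.
have nat (i j : natc) (h : cle i j) :
    dmap (cdiag (lrow_obj F' 0%N)) (Logic.I : @dle pt_dir tt tt) \oc idm (lrow_obj F' 0%N) =
    idm (lrow_obj F' 0%N) \oc dmap (indpro_dia F') h.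
  congr comp; apply: esym; apply: level_id => n; exact: (lhor_id F).
exists (@reindex pt_dir ndir (pro C) (fun=> tt) (fun _ _ _ => Logic.I)
  (cdiag (lrow_obj F' 0%N)) (indpro_dia F') (fun=> idm _) nat).
by apply: reindex_iso; [move=> i; exists 0%N|move=> i; exact: iso_id].
Qed.

Lemma discrete_diagram (Q : IP) : is_discrete Q ->
  exists D : diagram ndir (pro C), [/\ @mono_steps (pro_add G) D,
    forall n, finite_pro (D n) & isomorphic Q (IndObj D)].
Proof.
move=> [I [J [F [I1 iQ]]]].
have [psi [psim psic]] := corder_cofinal J; have [i0] := cinh I.
pose sm : forall i j : natc, cle i j -> cle (psi i) (psi j) := psim.
pose pm : forall i j : natc, cle i j -> cle i0 i0 := fun _ _ _ => cle_refl i0.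
have phic i : exists d : natc, cle i i0 by exists 0%N; rewrite (I1 i i0); exact: cle_refl.
pose F' := lcre pm sm F; exists (indpro_dia F'); split; first exact: col_mono_steps.
  move=> n; exists (F' 0%N n).
  have nat (i j : natc) (h : cle i j) :
      dmap (cdiag (F' 0%N n : opcat C)) (Logic.I : @dle pt_dir tt tt) \oc @idm (opcat C) (F' 0%N n) =
      @idm (opcat C) (F' 0%N n) \oc dmap (lrow F' n) h.
    by congr comp; apply: esym; exact: (lver_id F).
  have [] := @reindex_iso pt_dir ndir (opcat C) (fun=> tt) (fun _ _ _ => Logic.I)
    (cdiag (F' 0%N n : opcat C)) (lrow F' n) (fun=> @idm (opcat C) _) nat.
  - by exists 0%N.
  - by move=> i; exact: iso_id.
  move=> v [v1 v2]; exists v; eexists; split; [exact: v1|exact: v2].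
apply: isomorphic_trans iQ _; apply: isomorphic_sym.
by exists (@lcre_iso G I J natc natc (fun=> i0) psi pm sm phic F); exact: lcre_isoP.
Qed.

End LocallyCompactSplit.

(** * Compact and discrete objects, lattices *)

Definition split_data (A : addcat) (a b c : A) (f : hom a b) (g : hom b c)
    (r : hom b a) (s : hom c b) : Prop :=
  [/\ r \oc f = idm a, g \oc s = idm c, g \oc f = 0 & f \oc r + s \oc g = idm b].

Section SplitData.
Variable A : addcat.

(** Here the splittings already commute with the transition maps, so no induction along the index is
    involved and any directed index is allowed, in contrast to [level_splits]. *)
Lemma level_split_data (D : dirset) (F1 F2 F3 : diagram D A) (s : dnat F1 F2) (t : dnat F2 F3)
    (r : dnat F2 F1) (q : dnat F3 F2) :
  (forall i, split_data (s i) (t i) (r i) (q i)) ->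
  @split_data (ind_add A) _ _ _ (level s) (level t) (level r) (level q).
Proof.
move=> ex; have mem F F' (x : dnat F F') n := @level_mem A D F F' x n.
split; apply: indhom_eq => n; have [e1 e2 e3 e4] := ex n.
- exists n, (r n \oc s n); split; last by rewrite e1; exact: indid_mem.
  exact: (icomp_mem (mem _ _ s n) (mem _ _ r n)).
- exists n, (t n \oc q n); split; last by rewrite e2; exact: indid_mem.
  exact: (icomp_mem (mem _ _ q n) (mem _ _ t n)).
- exists n, (t n \oc s n); split; last by rewrite e3; exact: indzero_mem.
  exact: (icomp_mem (mem _ _ s n) (mem _ _ t n)).
- exists n, (s n \oc r n + q n \oc t n); split; last by rewrite e4; exact: indid_mem.
  apply: indadd_mem.
    exact: (icomp_mem (mem _ _ r n) (mem _ _ s n)).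
  exact: (icomp_mem (mem _ _ t n) (mem _ _ q n)).
Qed.

End SplitData.

Lemma split_data_op (A : addcat) (a b c : A) (f : hom a b) (g : hom b c) (r : hom b a) (s : hom c b) :
  @split_data A a b c f g r s -> @split_data (op_add A) c b a g f s r.
Proof. by move=> [h1 h2 h3 h4]; split=> //; rewrite [LHS]haddC. Qed.

Lemma cartesian_idh (C : category) (a c : C) (g : hom a c) : cartesian (idm a) g g (idm c).
Proof.
split=> [|t x y e]; first by rewrite compm1 comp1m.
exists x; split=> [|z [<- _]]; last by rewrite comp1m.
by rewrite comp1m e comp1m.
Qed.

Lemma cartesian_idv (C : category) (a b : C) (f : hom a b) : cartesian f (idm a) (idm b) f.
Proof.
split=> [|t x y e]; first by rewrite compm1 comp1m.
exists y; split=> [|z [_ <-]]; last by rewrite comp1m.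
by rewrite comp1m -e comp1m.
Qed.

Definition unitc : corder.
refine (@COrder unit (fun _ _ => True) (fun _ => Logic.I) (fun _ _ _ _ _ => Logic.I) _
  (fun _ _ => or_introl Logic.I) (inhabits tt) _).
- by case; case.
- by exists (fun=> 0%N); case; case.
Defined.

Section CompactDiscrete.
Variable G : gex.
Notation C := (gexcat G).
Notation IP := (ind (pro C)).
Notation A := (indpro_add G).

Definition compact_lcdiag (E : diagram ndir (opcat G)) :
  @mono_steps (op_add G) E -> lcdiag C natc unitc.
Proof.
move=> st; refine (@LcDiag C natc unitc (fun i _ => E i) (fun i i' _ h => @dmap _ _ E i i' h)
    (fun i _ _ _ => @idm C (E i)) _ _ _ _ _ _ _ _).
- by move=> i _ h; exact: (dmap_id E).
- by [].
- by move=> i i' i'' _ h h' h''; exact: (dmap_comp E).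
- by move=> *; exact: comp1m.
- by move=> i i' _ _ h _; exact: cartesian_idh.
- by move=> i i' _ _ h _; exact: (@cartesian_idv (opcat C)).
- move=> i i' _ h; apply/deflationP.
  by have [s e] := mono_steps_all st h; exists s.
- by move=> i _ _ _; apply/inflationP; exists (idm (E i : G)); rewrite comp1m.
Defined.

Lemma compact_of_diagram (E : diagram ndir (opcat G)) :
  @mono_steps (op_add G) E -> is_compact (@cind (pro C) (IndObj E)).
Proof.
move=> st; pose F := compact_lcdiag st.
exists natc, unitc, F; split; first by case; case.
have nat (i j : natc) (h : @dle ndir i j) :
    dmap E h \oc @idm (opcat C) (E i) = @idm (opcat C) (E j) \oc dmap (lrow F tt) h.
  by rewrite comp1m compm1.
have [v [v1 v2]] := @reindex_iso ndir ndir (opcat C) id (fun _ _ h => h) E (lrow F tt) _ nat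
  (fun i => ex_intro _ i (leqnn i)) (fun i => @iso_id (opcat C) _).
pose al : @hom (pro C) (IndObj E) (lrow_obj F tt) :=
  @reindex ndir ndir (opcat C) id (fun _ _ h => h) E (lrow F tt) _ nat.
have ali : is_iso al by exists v.
have nat' (i j : pt_dir) (h : @dle pt_dir i j) :
    dmap (indpro_dia F) (Logic.I : @dle (dir_of unitc) tt tt) \oc al =
    al \oc dmap (cdiag (IndObj E : pro C)) h.
  by rewrite [RHS]compm1 [X in X \oc _](lrow_map_id F) comp1m.
exists (@reindex (dir_of unitc) pt_dir (pro C) (fun=> tt) (fun _ _ _ => Logic.I)
  (indpro_dia F) (cdiag (IndObj E : pro C)) (fun=> al) nat').
by apply: reindex_iso => // -[]; exists tt.
Qed.

Lemma compact_iso (X Y : IP) : isomorphic X Y -> is_compact Y -> is_compact X.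
Proof.
by move=> i [I [J [F [h i']]]]; exists I, J, F; split=> //; exact: isomorphic_trans i i'.
Qed.
Lemma compact_lc (X : IP) : is_compact X -> is_lc X.
Proof. by move=> [I [J [F [_ i]]]]; exists I, J, F. Qed.
Lemma discrete_lc (X : IP) : is_discrete X -> is_lc X.
Proof. by move=> [I [J [F [_ i]]]]; exists I, J, F. Qed.

Lemma const_compact (a : G) : is_compact (const (a : C)).
Proof.
pose E := @rediag pt_dir ndir (opcat G) (fun=> tt) (fun _ _ _ => Logic.I) (cdiag (a : opcat G)).
have st : @mono_steps (op_add G) E.
  by move=> n; exists (@idm (opcat G) a); exact: (@comp1m (opcat G)).
apply: compact_iso (compact_of_diagram st).
have [v [v1 v2]] := @reind_iso pt_dir ndir (opcat G) (fun=> tt) (fun _ _ _ => Logic.I)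
  (cdiag (a : opcat G)) (fun _ => ex_intro _ 0%N Logic.I).
pose w : @hom (pro C) (cpro (a : C)) (IndObj E) :=
  @reind pt_dir ndir (opcat G) (fun=> tt) (fun _ _ _ => Logic.I) (cdiag (a : opcat G)).
exists (cind_map w); apply: cind_iso; exists v; split; [exact: v2|exact: v1].
Qed.

Lemma const_lc (a : G) : is_lc (const (a : C)).
Proof. exact/compact_lc/const_compact. Qed.

Lemma cpro_full (a b : G) (f : hom (cpro (a : C)) (cpro (b : C))) :
  exists g : hom a b, f = @cpro_map C a b g.
Proof. exact: (@cind_full (opcat C)). Qed.
Lemma cpro_faithful (a b : G) (f g : hom a b) :
  @cpro_map C a b f = @cpro_map C a b g -> f = g.
Proof. exact: (@cind_faithful (opcat C)). Qed.
Lemma cpro_map_comp (a b c : G) (f : hom b c) (g : hom a b) :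
  @cpro_map C a c (f \oc g) = @cpro_map C b c f \oc @cpro_map C a b g.
Proof. exact: (@cind_map_comp (opcat C)). Qed.
Lemma cpro_map_id (a : G) : @cpro_map C a a (idm a) = idm _.
Proof. exact: (@cind_map_id (opcat C)). Qed.
Lemma cpro_splits (a b c : G) (f : hom a b) (g : hom b c) :
  @splits (pro_add G) _ _ _ (@cpro_map C a b f) (@cpro_map C b c g) <-> splits f g.
Proof.
split=> [/(@splits_op (pro_add G)) s|/splits_op s].
  apply: (@splits_op (op_add G)); apply/(@cind_splits (op_add G)); exact: s.
apply: (@splits_op (ind_add (op_add G))); exact/(@cind_splits (op_add G)).
Qed.
Lemma cpro_split_mono (a b : G) (f : hom a b) :
  @split_mono (pro_add G) _ _ (@cpro_map C a b f) <-> split_mono f.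
Proof.
split=> [s|s].
  have /(@cind_split_epi (op_add G)) [r e] : @split_epi (ind_add (op_add G)) _ _ (@cind_map (opcat G) b a f) by [].
  by exists r.
have /(@cind_split_epi (op_add G)) [r e] : @split_epi (op_add G) b a f by [].
by exists r.
Qed.

(** Once the Ind index of both ends is rewritten as the one-point order, the middle term is their
    levelwise sum, which again has a single column. *)
Lemma compact_splits (X Y Z : IP) (f : hom X Y) (g : hom Y Z) :
  @splits A X Y Z f g -> is_compact X -> is_compact Z -> is_compact Y.
Proof.
have nf (L : IP) : is_compact L -> exists F : lcdiag C natc unitc, isomorphic L (indpro F).
  move=> [I [J [F [J1 iL]]]].
  have [phi [phim phic]] := corder_cofinal I; have [j0] := cinh J.
  pose pm : forall i j : natc, cle i j -> cle (phi i) (phi j) := phim.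
  pose sm : forall i j : unitc, cle i j -> cle j0 j0 := fun _ _ _ => cle_refl j0.
  have psic j : exists d : unitc, cle j j0 by exists tt; rewrite (J1 j j0); exact: cle_refl.
  exists (lcre pm sm F); apply: isomorphic_trans iL _; apply: isomorphic_sym.
  by exists (@lcre_iso G I J natc unitc phi (fun=> j0) pm sm phic F); exact: lcre_isoP.
move=> sp /nf [F1 [a ia]] /nf [F3 [c ic]].
have [F2 [s [t [r [q e]]]]] := lcsum F1 F3.
have sp2 : @splits A _ _ _ (indpro_map s) (indpro_map t).
  exists (indpro_map r), (indpro_map q).
  apply: (@level_split_data (pro_add G)) => j.
  apply: (@split_data_op (ind_add (op_add G))).
  apply: (@level_split_data (op_add G)) => i.
  apply: split_data_op; exact: e.
have [b [ib e1 e2]] := @splits_iso_ex A _ _ _ _ _ _ _ _ _ _ a c sp sp2 ia ic.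
by exists natc, unitc, F2; split; [case; case|exists b].
Qed.

End CompactDiscrete.

Canonical op_add.
Canonical ind_add.

Lemma sequence_quotient_at (A : addcat) (F : diagram ndir A) (K : A -> Prop) (S : A) (l : nat)
    (m : hom S (F l)) : mono_steps F ->
  (forall (n : nat) (h : @dle ndir l n), exists (R : A) (t : hom (F n) R), K R /\ splits (dmap F h \oc m) t) ->
  exists (D : diagram ndir A) (g : @hom (ind A) (IndObj F) (IndObj D)),
    [/\ mono_steps D, forall n, K (D n) & @splits (ind_add A) _ _ _ (@germ_hom A S (IndObj F) l m) g].
Proof.
move=> st ex.
have phim (i j : ndir) : @dle ndir i j -> @dle ndir (l + i)%N (l + j)%N.
  by move=> h; exact: (leq_add (leqnn l) h).
pose F' := @rediag ndir ndir A (addn l) phim F.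
have hl n : @dle ndir l (l + n)%N by exact: leq_addr.
have ex' n : exists Rt : {R : A & hom (F' n) R}, K (tag Rt) /\ splits (dmap F (hl n) \oc m) (tagged Rt).
  by have [R [t h]] := ex _ (hl n); exists (existT _ R t).
have [Rt RtP] := dchoice ex'.
have st' : mono_steps F' by move=> n; exact: (mono_steps_all st).
have [D [g [stD KD sp]]] := @sequence_quotient A F' K S (fun n => dmap F (hl n) \oc m) (fun n => tag (Rt n))
  (fun n => tagged (Rt n)) st'
  (fun n => etrans (compA _ _ _) (f_equal (comp^~ m) (dmap_comp F _ _ _)))
  (fun n => (RtP n).2) (fun n => (RtP n).1).
have iso := @reind_iso ndir ndir A (addn l) phim F (fun i => ex_intro _ i (leq_addl l i)).
have [v [v1 v2]] := iso.
exists D, (g \oc v); split=> //.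
apply: (@splits_isoV (ind_add A) _ _ _ _ _ _ _ _ _ _ (idm _) _ (idm _) _ iso _ _ _ sp).
- exact: (@iso_id (ind A)).
- exact: (@iso_id (ind A)).
- rewrite [LHS]compm1; apply: (@indhom_eq A (cind S) (IndObj F)) => -[].
  exists (l + 0)%N, (dmap F (hl 0%N) \oc m); split; first exact: (@germ_imap A S (IndObj F)).
  rewrite -[X in sval _ _ _ X]comp1m.
  apply: (@icomp_mem A (cind S) (IndObj F') (IndObj F) _ _ tt 0%N (l + 0)%N); exact: germ_refl.
- by rewrite [RHS]comp1m [LHS](esym (compA _ _ _)) v1 [LHS]compm1.
Qed.

Section NestedAlgebra.
Variable A : addcat.

(** The complementary idempotent of L1 passes through Q. For lattices it therefore involves a map
    from a compact object to a discrete one. *)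
Lemma nested_retraction (L0 L1 V Q : A) (X0 : hom L0 V) (X1 : hom L1 V) (u : hom L0 L1)
    (r0 : hom V L0) (q : hom V Q) (s : hom Q V) (r1 : hom V L1) :
  X1 \oc u = X0 -> r0 \oc X0 = idm L0 -> X0 \oc r0 + s \oc q = idm V -> r1 \oc X1 = idm L1 ->
  (r0 \oc X1) \oc u = idm L0 /\ u \oc (r0 \oc X1) + r1 \oc (s \oc (q \oc X1)) = idm L1.
Proof.
move=> e r0X e1 r1X; split; first by rewrite -compA e.
apply: (split_mono_inj (f := X1)); first by exists r1.
have -> : s \oc (q \oc X1) = X1 - X0 \oc (r0 \oc X1).
  by rewrite -[X in X - _]comp1m -e1 compDl -!compA haddC haddA haddN hadd0.
rewrite compDr compm1 compBr r1X -e -!compA (compA r1) r1X comp1m compBr compm1.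
by rewrite haddC hsubK.
Qed.

Section Complement.
Variables (L0 L1 B : A) (u : hom L0 L1) (r : hom L1 L0) (e : hom L1 L1).
Variables (g : hom L1 B) (h : hom B L1).
Hypotheses (ru : r \oc u = idm L0) (ue : u \oc r + e = idm L1) (eE : e = h \oc g).

Let eu : e \oc u = 0.
Proof.
apply: (@haddI _ _ _ ((u \oc r) \oc u)).
by rewrite -compDl ue comp1m haddr0 -compA ru compm1.
Qed.
Let ee : e \oc e = e.
Proof.
have re : r \oc e = 0.
  apply: (@haddI _ _ _ (r \oc (u \oc r))).
  by rewrite -compDr ue compm1 haddr0 compA ru comp1m.
by rewrite -[RHS]comp1m -ue compDl -compA re comp0r hadd0.
Qed.

(** The idempotent e of L1 is h g, with g and h passing through B; the idempotent g e h of B has the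
    same image. This moves the splitting problem to B, an object over which idempotents are known to
    split. *)
Lemma complement_idempotent : (g \oc e \oc h) \oc (g \oc e \oc h) = g \oc e \oc h.
Proof.
have -> : g \oc e \oc h \oc (g \oc e \oc h) = g \oc (e \oc (h \oc g) \oc e) \oc h.
  by rewrite !compA.
by rewrite -eE ee ee.
Qed.

Lemma complement_splits W (p : hom B W) (i : hom W B) :
  p \oc i = idm W -> i \oc p = g \oc e \oc h -> splits u (p \oc g).
Proof.
move=> pi ip; have pp : p = p \oc (g \oc e \oc h) by rewrite -ip compA pi comp1m.
exists r, (h \oc i); split=> //.
- have -> : p \oc g \oc (h \oc i) = p \oc (g \oc e \oc h) \oc i.
    by rewrite {1}pp -!compA (compA h g) -eE (compA e e) ee.
  by rewrite -pp.
- by rewrite {1}pp -!compA (compA h) -eE eu !comp0r.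
- rewrite -[RHS]ue; congr hadd.
  have -> : h \oc i \oc (p \oc g) = h \oc (i \oc p) \oc g by rewrite !compA.
  by rewrite ip !compA -eE ee -compA -eE ee.
Qed.
End Complement.

End NestedAlgebra.

Section Lattices.
Variable G : gex.
Notation C := (gexcat G).
Notation IP := (ind (pro C)).
Notation A := (indpro_add G).

Definition discrete_lcdiag (h : nat -> G) (k : forall m n : nat, (m <= n)%N -> hom (h m) (h n)) :
  (forall m (e : (m <= m)%N), k m m e = idm _) ->
  (forall m n p (e : (m <= n)%N) (e' : (n <= p)%N) (e'' : (m <= p)%N),
    k n p e' \oc k m n e = k m p e'') ->
  (forall m n (e : (m <= n)%N), split_mono (k m n e)) -> lcdiag C unitc natc.
Proof.
move=> k1 k2 ks; refine (@LcDiag C unitc natc (fun _ n => h n) (fun _ _ n _ => @idm C (h n))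
  (fun _ m n e => k m n e) _ _ _ _ _ _ _ _).
- by [].
- by move=> _ m e; exact: k1.
- by move=> *; exact: comp1m.
- by move=> _ m n p e e' e''; exact: k2.
- by move=> _ _ m n _ e; exact: cartesian_idv.
- by move=> _ _ m n _ e; exact: (@cartesian_idh (opcat C)).
- by move=> _ _ n _; apply/deflationP; exists (idm (h n : G)); rewrite comp1m.
- by move=> _ m n e; apply/inflationP; exact: ks.
Defined.

(** The terms are only isomorphic to constant pro-objects. As [cpro_map] is fully faithful,
    conjugating the transition maps by these isomorphisms gives a strict diagram in C. *)
Lemma discrete_of_diagram (D : diagram ndir (pro C)) :
  @mono_steps (pro_add G) D -> (forall n, finite_pro (D n)) -> is_discrete (IndObj D : IP).
Proof.
move=> st fin.
have ex (n : nat) : exists x : {a : G & (hom (D n) (cpro (a : C)) * hom (cpro (a : C)) (D n))%type},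
    (tagged x).2 \oc (tagged x).1 = idm _ /\ (tagged x).1 \oc (tagged x).2 = idm _.
  by have [a [f [g [e1 e2]]]] := fin n; exists (existT _ a (f, g)).
have [x xP] := dchoice ex.
pose h n : G := tag (x n).
pose al n : hom (D n) (cpro (h n : C)) := (tagged (x n)).1.
pose be n : hom (cpro (h n : C)) (D n) := (tagged (x n)).2.
have ba n : be n \oc al n = idm _ := (xP n).1.
have ab n : al n \oc be n = idm _ := (xP n).2.
clearbody h al be.
have ex' (y : {mn : nat * nat | (mn.1 <= mn.2)%N}) : exists g : hom (h (sval y).1) (h (sval y).2),
    al (sval y).2 \oc (dmap D (svalP y : @dle ndir _ _) \oc be (sval y).1) = @cpro_map C _ _ g.
  exact: cpro_full.
have [k0 k0P] := dchoice ex'.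
pose k m n (e : (m <= n)%N) : hom (h m) (h n) := k0 (exist _ (m, n) e).
have kP m n (e : (m <= n)%N) : @cpro_map C _ _ (k m n e) = al n \oc (dmap D (e : @dle ndir m n) \oc be m).
  apply: etrans (esym (k0P (exist _ (m, n) e))) _ => /=.
  by rewrite (dmap_irr D _ (e : @dle ndir m n)).
clearbody k.
have k1 m (e : (m <= m)%N) : k m m e = idm _.
  by apply: cpro_faithful; rewrite kP dmap_id comp1m ab cpro_map_id.
have k2 m n p (e : (m <= n)%N) (e' : (n <= p)%N) (e'' : (m <= p)%N) :
    k n p e' \oc k m n e = k m p e''.
  apply: cpro_faithful; rewrite cpro_map_comp !kP -!compA (compA (be n)) ba comp1m.
  by congr comp; rewrite compA (dmap_comp D (e : @dle ndir m n) (e' : @dle ndir n p)).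
have ks m n (e : (m <= n)%N) : split_mono (k m n e).
  apply/cpro_split_mono; rewrite kP.
  have sm := @mono_steps_all (pro_add G) D st m n e.
  apply: (@split_mono_comp (pro_add G)); first by exists (be n); exact: ba.
  by apply: (@split_mono_comp (pro_add G)) => //; exists (al m); exact: ab.
pose F := discrete_lcdiag k1 k2 ks.
exists unitc, natc, F; split; first by case; case.
have nat n (i j : dir_of unitc) (e : dle i j) :
    dmap (cdiag (h n : opcat C)) (Logic.I : @dle pt_dir tt tt) \oc @idm (opcat C) (h n) =
    @idm (opcat C) (h n) \oc dmap (lrow F n) e by [].
pose rho n : @hom (pro C) (cpro (h n : C)) (lrow_obj F n) :=
  @reindex pt_dir (dir_of unitc) (opcat C) (fun=> tt) (fun _ _ _ => Logic.I)
    (cdiag (h n : opcat C)) (lrow F n) (fun=> @idm (opcat C) (h n)) (nat n).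
have rhoi n : is_iso (rho n).
  have [] := @reindex_iso pt_dir (dir_of unitc) (opcat C) (fun=> tt) (fun _ _ _ => Logic.I)
    (cdiag (h n : opcat C)) (lrow F n) (fun=> @idm (opcat C) (h n)) (nat n).
  - by move=> i; exists tt.
  - by move=> i; exact: iso_id.
  by move=> v [v1 v2]; exists v.
have rhoN (m n : natc) (e : cle m n) :
    lrow_map F e \oc rho m = rho n \oc @cpro_map C _ _ (k m n e).
  apply: esym; apply: (@reindex_nat pt_dir (dir_of unitc) (opcat C) (fun=> tt) (fun _ _ _ => Logic.I)
    (cdiag (h n : opcat C)) (cdiag (h m : opcat C)) (lrow F n) (lrow F m) _ _ (nat n) (nat m)
    (@cnat (opcat C) (h n) (h m) (k m n e)) (lrow_nat F e)) => i.
  by rewrite [LHS]compm1 [RHS]comp1m.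
have nat' (i j : ndir) (e : @dle ndir i j) :
    dmap (indpro_dia F) e \oc (rho i \oc al i) = (rho j \oc al j) \oc dmap D e.
  rewrite compA [X in X \oc _](rhoN i j e) kP -!compA ba compm1.
  by do 2 congr comp; exact: dmap_irr.
exists (@reindex (dir_of natc) ndir (pro C) id (fun _ _ e => e) (indpro_dia F) D _ nat').
apply: reindex_iso => [i|i]; first by exists i; exact: leqnn.
by apply: iso_comp => //; exists (be i).
Qed.

Lemma germ_factor (P : pro C) (D : diagram ndir (pro C)) (h : @hom IP (cind P) (IndObj D)) :
  exists n0 : nat, forall n, (n0 <= n)%N ->
    exists f : hom P (D n), h = @cin (pro C) (IndObj D) n \oc cind_map f.
Proof.
have [j [f e]] := germ_homP h; exists j => n jn.
exists (dmap D (jn : @dle ndir j n) \oc f).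
rewrite e -germ_homE; apply: germ_hom_eq; exact: (@germ_imap (pro C) P (IndObj D)).
Qed.

Lemma lc_chain (V : IP) : is_lc V -> exists D : diagram ndir (pro C),
  [/\ isomorphic V (IndObj D), @mono_steps (pro_add G) D,
      forall (m n : nat) (h : @dle ndir m n), exists (R : pro C) (t : hom (D n) R),
        finite_pro R /\ @splits (pro_add G) _ _ _ (dmap D h) t &
      forall n, is_compact (@cind (pro C) (D n))].
Proof.
move=> /is_lc_nat [F iF]; exists (indpro_dia F); split=> //; first exact: col_mono_steps.
  move=> m n h; have [R [t sp]] := row_quotient F h.
  by exists (cpro (R : C)), t; split=> //; exists R, (idm _); exact: (@iso_id (pro C)).
by move=> n; apply: compact_of_diagram; exact: row_mono_steps.
Qed.

Section LatticesOf.
Variable V : IP.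

Lemma lattice_splits L (X : @lat C V L) : exists (Q : IP) (q : hom V Q),
  is_discrete Q /\ @splits A _ _ _ (sval X) q.
Proof.
have [_ [Q [q [dQ s]]]] := svalP X.
by exists Q, q; split=> //; exact: lc_ses_splits.
Qed.

Lemma lattice_compact L (X : @lat C V L) : is_compact L.
Proof. by have [] := svalP X. Qed.

Lemma lattice_mono L (X : @lat C V L) : @split_mono A _ _ (sval X).
Proof. by have [Q [q [_ /splits_mono]]] := lattice_splits X. Qed.

Lemma lattice_of_splits (L Q : IP) (i : hom L V) (q : hom V Q) :
  is_compact L -> is_discrete Q -> @splits A _ _ _ i q -> is_lattice i.
Proof.
move=> cL dQ sp; split=> //; exists Q, q; split=> //.
exact: (splits_lc_ses sp (compact_lc cL) (discrete_lc dQ)).2.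
Qed.

(** A map from a constant ind-object to a colimit lands in one term, and the terms of a discrete
    object are objects of C. *)
Lemma compact_to_discrete (L Q : IP) (f : hom L Q) : is_compact L -> is_discrete Q ->
  exists (a : G) (g : hom L (const (a : C))) (h : hom (const (a : C)) Q), f = h \oc g.
Proof.
move=> /compact_diagram [E [_ [l [l' [l1 l2]]]]] /discrete_diagram [D [_ fin [d [d' [d1 d2]]]]].
have [n0 /(_ n0 (leqnn n0)) [g gE]] := germ_factor (d \oc (f \oc l')).
have [a [x [y [yx _]]]] := fin n0.
exists a, (cind_map (x \oc g) \oc l), (d' \oc (@cin (pro C) (IndObj D) n0 \oc cind_map y)).
rewrite -!compA (compA (cind_map y)) -cind_map_comp (compA y) yx comp1m (compA (cin _)) -gE.
by rewrite -!compA l1 compm1 compA d1 comp1m.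
Qed.

(* The complement of L0 in L1 is the image of an idempotent of L1 which factors
   through an object of C. *)
Lemma nested_splits (L0 L1 : IP) (X0 : @lat C V L0) (X1 : @lat C V L1) (u : hom L0 L1) :
  sval X1 \oc u = sval X0 ->
  exists (W : G) (p : hom L1 (const (W : C))), @splits A _ _ _ u p.
Proof.
move=> e10; have [Q0 [q0 [dQ [r0 [s0 [a1 a2 a3 a4]]]]]] := lattice_splits X0.
have [r1 r1P] := lattice_mono X1.
have [ru ue] := @nested_retraction A _ _ _ _ _ _ _ _ _ _ _ e10 a1 a4 r1P.
have [a [g [h gh]]] := compact_to_discrete (q0 \oc sval X1) (lattice_compact X1) dQ.
pose h' : @hom A (const (a : C)) L1 := r1 \oc (s0 \oc h).
pose e : @hom A L1 L1 := r1 \oc (s0 \oc (q0 \oc sval X1)).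
have eE : e = @comp A _ _ _ h' g.
  by rewrite /e [X in _ \oc (_ \oc X)]gh /h' !(@compA A).
(* The idempotent of the constant object comes from an idempotent of a in C, which splits there. *)
have [f fE] := @cind_full (pro C) _ _ (@comp A _ _ _ (@comp A _ _ _ g e) h').
have [f' fE'] := cpro_full f; subst f.
have ff : f' \oc f' = f'.
  apply: cpro_faithful; rewrite cpro_map_comp; apply: cind_faithful.
  by rewrite cind_map_comp -fE; exact: complement_idempotent ru ue eE.
have [W [p [i [pi ip]]]] := gidem ff.
exists W, (@comp A _ _ _ (const_map (p : @hom C a W)) g).
apply: (@complement_splits A _ _ _ _ _ _ _ _ ru ue eE _ _ (const_map (i : @hom C W a))).
  rewrite [LHS](esym (cind_map_comp _ _)) -cpro_map_comp pi.
  by rewrite cpro_map_id [LHS]cind_map_id.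
by rewrite fE -ip cpro_map_comp cind_map_comp.
Qed.

End LatticesOf.
End Lattices.

(** The third isomorphism theorem: the retraction of i is induced by p01 r12, and p02 t12 is a
    section of q. *)
Lemma noether (A : addcat) (a0 a1 a2 w01 w02 w12 : A) (u01 : hom a0 a1) (u02 : hom a0 a2)
    (u12 : hom a1 a2) (p01 : hom a1 w01) (p02 : hom a2 w02) (p12 : hom a2 w12) :
  u02 = u12 \oc u01 -> splits u01 p01 -> splits u02 p02 -> splits u12 p12 ->
  exists (i : hom w01 w02) (q : hom w02 w12),
    [/\ i \oc p01 = p02 \oc u12, q \oc p02 = p12 & splits i q].
Proof.
move=> e s01 s02 s12.
have [i iE] : exists i, p02 \oc u12 = i \oc p01.
  by apply: splits_sum s01 _; rewrite -compA -e (splits0 s02).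
have [q qE] : exists q, p12 = q \oc p02.
  by apply: splits_sum s02 _; rewrite e compA (splits0 s12) comp0l.
exists i, q; split=> //.
have [r01 [t01 [c1 c2 c3 c4]]] := s01; have [r02 [t02 [d1 d2 d3 d4]]] := s02.
have [r12 [t12 [f1 f2 f3 f4]]] := s12.
have [rho rhoE] : exists rho, p01 \oc r12 = rho \oc p02.
  by apply: splits_sum s02 _; rewrite e -compA (compA r12) f1 comp1m c3.
exists rho, (p02 \oc t12); split.
- apply: (split_epi_inj (splits_epi s01)).
  by rewrite -compA -iE compA -rhoE -compA f1 compm1 comp1m.
- by rewrite compA -qE.
- apply: (split_epi_inj (splits_epi s01)).
  by rewrite -compA -iE compA -qE f3 comp0l.
- apply: (split_epi_inj (splits_epi s02)).
  rewrite compDl -(compA i) -rhoE compA -iE -(compA (p02 \oc t12)) -qE -!compA -compDr f4.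
  by rewrite compm1 comp1m.
Qed.

Section LatticeChains.
Variable G : gex.
Notation C := (gexcat G).
Notation IP := (ind (pro C)).
Notation A := (indpro_add G).

Lemma const_full (a b : G) (f : hom (const (a : C)) (const (b : C))) :
  exists g : hom a b, f = @const_map C a b g.
Proof.
have [x ->] := cind_full f; have [g ->] := cpro_full x; by exists g.
Qed.
Lemma const_faithful (a b : G) (f g : hom a b) :
  @const_map C a b f = @const_map C a b g -> f = g.
Proof. by move=> /cind_faithful /cpro_faithful. Qed.
Lemma const_map_comp (a b c : G) (f : hom b c) (g : hom a b) :
  @const_map C a c (f \oc g) = @const_map C b c f \oc @const_map C a b g.
Proof. by rewrite /const_map cpro_map_comp; exact: cind_map_comp. Qed.
Lemma const_splits (a b c : G) (f : hom a b) (g : hom b c) :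
  @splits A _ _ _ (@const_map C a b f) (@const_map C b c g) <-> splits f g.
Proof.
split=> [s|s].
  by apply/cpro_splits; apply/(@cind_splits (pro_add G)).
by apply/(@cind_splits (pro_add G)); apply/cpro_splits.
Qed.

Variable V : IP.

Lemma quo_splits L0 L1 (X0 : @lat C V L0) (X1 : @lat C V L1) u (W : G) p :
  quo X0 X1 u (W := (W : C)) p -> @splits A _ _ _ u p.
Proof. by move=> [_ /lc_ses_splits]. Qed.

Lemma quo_epi L0 L1 (X0 : @lat C V L0) (X1 : @lat C V L1) u (W : G) p (Z : IP)
    (f g : hom (const (W : C)) Z) :
  quo X0 X1 u (W := (W : C)) p -> f \oc p = g \oc p -> f = g.
Proof. by move=> /quo_splits /splits_epi /(@split_epi_inj A) h /h. Qed.

Lemma nested_quo L0 L1 (X0 : @lat C V L0) (X1 : @lat C V L1) u :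
  sval X1 \oc u = sval X0 -> exists (W : G) p, quo X0 X1 u (W := (W : C)) p.
Proof.
move=> e; have [W [p s]] := nested_splits e; exists W, p; split=> //.
exact: (splits_lc_ses s (compact_lc (lattice_compact X0)) (const_lc W)).2.
Qed.

Lemma lat_incl_inj L0 L1 (X0 : @lat C V L0) (X1 : @lat C V L1) u u' :
  sval X1 \oc u = sval X0 -> sval X1 \oc u' = sval X0 -> u = u'.
Proof.
by move=> e e'; apply: (@split_mono_inj A _ _ _ _ _ _ (lattice_mono X1)); rewrite e.
Qed.

Section Triangle.
Variables (L0 L1 L2 : IP) (X0 : @lat C V L0) (X1 : @lat C V L1) (X2 : @lat C V L2).
Variables (u01 : hom L0 L1) (u02 : hom L0 L2) (u12 : hom L1 L2) (W01 W02 W12 : G).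
Variables (p01 : hom L1 (const (W01 : C))) (p02 : hom L2 (const (W02 : C)))
  (p12 : hom L2 (const (W12 : C))).
Hypotheses (H01 : quo X0 X1 u01 p01) (H02 : quo X0 X2 u02 p02) (H12 : quo X1 X2 u12 p12).

Lemma qtri_ex : exists (i : hom W01 W02) (q : hom W02 W12),
  @qtri C L1 L2 u12 W01 W02 W12 p01 p02 p12 i q.
Proof.
have e : u02 = u12 \oc u01.
  by apply: (lat_incl_inj (X0 := X0) (X1 := X2) H02.1); rewrite compA H12.1 H01.1.
have [i [q [e1 e2 s]]] := @noether A _ _ _ _ _ _ _ _ _ _ _ _ e (quo_splits H01)
  (quo_splits H02) (quo_splits H12).
have [i' iE] := const_full i; have [q' qE] := const_full q; subst i q.
by exists i', q'; split=> //; apply/gsesP/const_splits.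
Qed.

Lemma qtri_uniq (i i' : hom W01 W02) (q q' : hom W02 W12) :
  @qtri C L1 L2 u12 W01 W02 W12 p01 p02 p12 i q ->
  @qtri C L1 L2 u12 W01 W02 W12 p01 p02 p12 i' q' -> i = i' /\ q = q'.
Proof.
move=> [_ e1 e2] [_ e1' e2']; split; apply: const_faithful.
  by apply: (quo_epi H01); rewrite e1 e1'.
by apply: (quo_epi H02); rewrite e2 e2'.
Qed.

End Triangle.

Lemma qtri_tet (L0 L1 L2 L3 : IP) (X0 : @lat C V L0) (X1 : @lat C V L1) (X2 : @lat C V L2)
    (X3 : @lat C V L3)
    (u01 : hom L0 L1) (u02 : hom L0 L2) (u03 : hom L0 L3)
    (u12 : hom L1 L2) (u13 : hom L1 L3) (u23 : hom L2 L3)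
    (W01 W02 W03 W12 W13 W23 : G)
    (p01 : hom L1 (const (W01 : C))) (p02 : hom L2 (const (W02 : C)))
    (p03 : hom L3 (const (W03 : C))) (p12 : hom L2 (const (W12 : C)))
    (p13 : hom L3 (const (W13 : C))) (p23 : hom L3 (const (W23 : C)))
    (i012 : hom W01 W02) (q012 : hom W02 W12) (i013 : hom W01 W03) (q013 : hom W03 W13)
    (i023 : hom W02 W03) (q023 : hom W03 W23) (i123 : hom W12 W13) (q123 : hom W13 W23) :
  quo X0 X1 u01 p01 -> quo X0 X2 u02 p02 -> quo X0 X3 u03 p03 ->
  quo X1 X2 u12 p12 -> quo X1 X3 u13 p13 -> quo X2 X3 u23 p23 ->
  @qtri C L1 L2 u12 W01 W02 W12 p01 p02 p12 i012 q012 ->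
  @qtri C L1 L3 u13 W01 W03 W13 p01 p03 p13 i013 q013 ->
  @qtri C L2 L3 u23 W02 W03 W23 p02 p03 p23 i023 q023 ->
  @qtri C L2 L3 u23 W12 W13 W23 p12 p13 p23 i123 q123 ->
  [/\ i023 \oc i012 = i013, q123 \oc q013 = q023 & q013 \oc i023 = i123 \oc q012].
Proof.
move=> H01 H02 H03 H12 H13 H23 [_ a1 a2] [_ b1 b2] [_ c1 c2] [_ d1 d2].
have e13 : u13 = u23 \oc u12.
  by apply: (lat_incl_inj (X0 := X1) (X1 := X3) H13.1); rewrite compA H23.1 H12.1.
split; apply: const_faithful; rewrite ?const_map_comp.
- by apply: (quo_epi H01); rewrite -!compA a1 compA c1 -compA -e13 b1.
- by apply: (quo_epi H03); rewrite -!compA b2 d2 c2.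
- by apply: (quo_epi H02); rewrite -!compA c1 compA b2 a2 d1.
Qed.

Definition lat_le L0 L1 (X0 : @lat C V L0) (X1 : @lat C V L1) : Prop :=
  exists u, sval X1 \oc u = sval X0.

Lemma lattice_chain : is_lc V -> exists (N : nat -> IP) (X : forall n, @lat C V (N n)),
  (forall m n, (m <= n)%N -> lat_le (X m) (X n)) /\
  forall L (Y : @lat C V L), exists n0, forall n, (n0 <= n)%N -> lat_le Y (X n).
Proof.
move=> lV; have [D [[f [g [gf fg]]] st fin cD]] := lc_chain lV.
pose c n := @cin (pro C) (IndObj D) n.
have lX n : @is_lattice C V (cind (D n)) (g \oc c n).
  have [R [q [stR KR sp]]] := @sequence_quotient_at (pro_add G) D (@finite_pro G) (D n) n (idm (D n)) st
    (fun m h => ltac:(rewrite (@compm1 (pro C)); exact: fin)).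
  apply: (@lattice_of_splits G V _ (IndObj R) _ (q \oc f)) => //.
    exact: discrete_of_diagram.
  apply: (@splits_iso A _ _ _ _ _ _ _ _ _ _ (idm _) f (idm _) _ _ _ _ _ sp).
  - exact: (@iso_id IP).
  - by exists g.
  - exact: (@iso_id IP).
  - by rewrite [LHS]compA [X in X \oc _]fg [LHS]comp1m [RHS]compm1.
  - exact: (@comp1m IP).
exists (fun n => cind (D n)), (fun n => exist _ _ (lX n)); split.
  move=> m n h; exists (cind_map (dmap D (h : @dle ndir m n))).
  apply: etrans (esym (compA _ _ _)) (f_equal (comp g) _).
  exact: (@cin_dmap (pro C) (IndObj D)).
move=> L Y; have [E [_ [l [l' [l1 l2]]]]] := compact_diagram (lattice_compact Y).
have [n0 H] := germ_factor (f \oc (sval Y \oc l')).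
exists n0 => n /H [h hE]; exists (cind_map h \oc l).
apply: etrans (esym (compA _ _ _)) _.
rewrite (compA (c n)) -hE -!compA l1 compm1 compA.
by rewrite [X in X \oc _]gf comp1m.
Qed.

End LatticeChains.

(** * Idempotents of Tate spaces *)

Section IdempotentAlgebra.
Variable A : addcat.

Lemma bip_of_splits (a b c : A) (f : hom a b) (g : hom b c) : splits f g ->
  exists B : bip a c b, bi1 B = f /\ bp2 B = g.
Proof.
move=> [r [s [e1 e2 e3 e4]]].
have e5 : r \oc s = 0.
  have := f_equal (fun h => r \oc h \oc s) e4 => /=.
  rewrite compDr compDl !compA e1 comp1m -!compA e2 !compm1 => e.
  by apply: (@haddI _ _ _ (r \oc s)); rewrite e haddr0 comp1m.
by exists (Bip e1 e2 e3 e5 e4).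
Qed.

Lemma splits_of_bip (a b c : A) (B : bip a c b) : splits (bi1 B) (bp2 B).
Proof.
exists (bp1 B), (bi2 B).
by split; [exact: bp1i1|exact: bp2i2|exact: bp2i1|exact: bip_sum].
Qed.

(** Reassociation: if V = L + Q and Q = S + Q', then V = (L + S) + Q'. *)
Lemma splits_extend (L V Q S Q' N : A) (X : bip L Q V) (Y : bip S Q' Q) (Z : bip L S N) :
  splits (bi1 X \oc bp1 Z + bi2 X \oc (bi1 Y \oc bp2 Z)) (bp2 Y \oc bp2 X).
Proof.
exists (bi1 Z \oc bp1 X + bi2 Z \oc (bp1 Y \oc bp2 X)), (bi2 X \oc bi2 Y); split.
- rewrite compDr !compDl -!compA !(compA (bp1 X)) !(compA (bp2 X)) bp1i1 bp1i2 bp2i1 bp2i2.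
  rewrite !comp0l !comp0r !comp1m !(compA (bp1 Y)) bp1i1 comp1m haddr0.
  by rewrite ?comp0r hadd0 bip_sum.
- by rewrite -compA (compA (bp2 X)) bp2i2 comp1m bp2i2.
- rewrite compDr -!compA !(compA (bp2 X)) bp2i1 bp2i2 comp0l comp0r comp1m hadd0.
  by rewrite (compA (bp2 Y)) bp2i1 comp0l.
- rewrite !compDl !compDr -!compA !(compA (bp1 Z)) !(compA (bp2 Z)) bp1i1 bp1i2 bp2i1 bp2i2.
  rewrite !comp0l !comp0r !comp1m haddr0 hadd0 -haddA.
  rewrite -[X in _ + X]compDr !compA -compDl (bip_sum Y) comp1m.
  exact: bip_sum.
Qed.

(* e is block triangular for V = N + Q, and W is the sum of the images of the diagonal
   blocks. *)
Lemma triangular_split (V N Q N1 Q1 W : A) (e : hom V V) (X : bip N Q V) (Z : bip N1 Q1 W)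
    (pN : hom N N1) (iN : hom N1 N) (pQ : hom Q Q1) (iQ : hom Q1 Q) :
  e \oc e = e -> bp2 X \oc (e \oc bi1 X) = 0 ->
  pN \oc iN = idm N1 -> iN \oc pN = bp1 X \oc (e \oc bi1 X) ->
  pQ \oc iQ = idm Q1 -> iQ \oc pQ = bp2 X \oc (e \oc bi2 X) ->
  exists (p : hom V W) (i : hom W V), p \oc i = idm W /\ i \oc p = e.
Proof.
move=> ee low n1 n2 q1 q2.
have [a aE] : exists a, a = bp1 X \oc (e \oc bi1 X) by eexists.
have [d dE] : exists d, d = bp2 X \oc (e \oc bi2 X) by eexists.
rewrite -aE in n2; rewrite -dE in q2.
pose b := bp1 X \oc (e \oc bi2 X).
have eX : e \oc bi1 X = bi1 X \oc a.
  rewrite -[e \oc bi1 X]comp1m -(bip_sum X) compDl -!compA low comp0r haddr0.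
  by rewrite aE !compA.
have Xe : bp2 X \oc e = d \oc bp2 X.
  rewrite -[bp2 X \oc e]compm1 -(bip_sum X) compDr !compA -(compA _ e) low comp0l hadd0.
  by rewrite dE !compA.
have bE : b = a \oc b + b \oc d.
  rewrite /b -{1}ee -compA -[e \oc bi2 X in LHS]comp1m -(bip_sum X) compDl compDr compDr.
  congr hadd; first by rewrite aE !compA.
  by rewrite dE !compA.
have pbi : pN \oc (b \oc iQ) = 0.
  have : pN \oc (b \oc iQ) = pN \oc (b \oc iQ) + pN \oc (b \oc iQ).
    rewrite {1}bE compDl compDr -n2 -q2; congr hadd.
      by rewrite !compA n1 comp1m.
    by rewrite -!compA q1 compm1.
  by move=> h; apply: (@haddI _ _ _ (pN \oc (b \oc iQ))); rewrite haddr0 -h.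
exists (bi1 Z \oc (pN \oc (bp1 X \oc e)) + bi2 Z \oc (pQ \oc (bp2 X \oc e))),
  (e \oc (bi1 X \oc (iN \oc bp1 Z) + bi2 X \oc (iQ \oc bp2 Z))); split.
- rewrite compDl -!compA !(compA e e) ee.
  have h1 : bp1 X \oc (e \oc (bi1 X \oc (iN \oc bp1 Z) + bi2 X \oc (iQ \oc bp2 Z))) =
      iN \oc bp1 Z + b \oc (iQ \oc bp2 Z).
    rewrite !compDr; congr hadd; last by rewrite /b !compA.
    by rewrite !compA -(compA _ e) -aE -n2 -(compA iN) n1 compm1.
  have h2 : bp2 X \oc (e \oc (bi1 X \oc (iN \oc bp1 Z) + bi2 X \oc (iQ \oc bp2 Z))) =
      iQ \oc bp2 Z.
    rewrite !compDr !compA -(compA (bp2 X) e) low !comp0l hadd0.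
    by rewrite -(compA _ e) -dE -q2 -(compA iQ) q1 compm1.
  rewrite h1 h2 compDr (compA pN iN) n1 comp1m (compA b) (compA pN) pbi comp0l haddr0.
  by rewrite (compA pQ) q1 comp1m bip_sum.
- have -> : (e \oc (bi1 X \oc (iN \oc bp1 Z) + bi2 X \oc (iQ \oc bp2 Z))) \oc
      (bi1 Z \oc (pN \oc (bp1 X \oc e)) + bi2 Z \oc (pQ \oc (bp2 X \oc e))) =
      e \oc (bi1 X \oc (a \oc (bp1 X \oc e)) + bi2 X \oc (d \oc (bp2 X \oc e))).
    rewrite -compA; congr comp; rewrite compDl !compDr -!compA.
    rewrite !(compA (bp1 Z)) !(compA (bp2 Z)) bp1i1 bp1i2 bp2i1 bp2i2.
    by rewrite !comp0l !comp0r !comp1m haddr0 hadd0 !(compA iN) !(compA iQ) n2 q2.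
  rewrite (compA (bi1 X)) -eX compDr -!compA (compA e e) ee.
  have -> : d \oc (bp2 X \oc e) = bp2 X \oc e by rewrite compA -Xe -compA ee.
  rewrite -compDr !compA -compDl (bip_sum X) comp1m.
  exact: ee.
Qed.

End IdempotentAlgebra.

Section Idempotents.
Variable G : gex.
Notation C := (gexcat G).
Notation IP := (ind (pro C)).
Notation A := (indpro_add G).

Lemma lc_sum (X Z : IP) : is_lc X -> is_lc Z -> exists (Y : IP) (B : @bip A X Z Y), is_lc Y.
Proof.
move=> /is_lc_nat [F1 [a ia]] /is_lc_nat [F3 [c ic]].
have [F2 [s [t [r [q e]]]]] := lcsum F1 F3.
have ex i j : gses (s i j : @hom G _ _) (t i j).
  by apply/gsesP; exists (r i j), (q i j); have [] := e i j.
have sp := indpro_splits ex.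
have [c' [c1 c2]] := ic.
have sp' : @splits A X (indpro F2) Z (indpro_map s \oc a) (c' \oc indpro_map t).
  apply: (@splits_iso A _ _ _ _ _ _ _ _ _ _ a (idm _) c _ _ _ _ _ sp) => //.
  - exact: (@iso_id IP).
  - exact: (@comp1m IP).
  - by rewrite [RHS]compm1 [LHS]compA c2 [LHS]comp1m.
have [B _] := bip_of_splits sp'.
by exists (indpro F2), B; exists natc, natc, F2, (idm _); exact: (@iso_id IP).
Qed.

(** The map k lands in a term D n0. It stays a split monomorphism into each later term, because it
    is one into Q, so the quotients can be taken term by term in C. *)
Lemma discrete_quotient (S : G) (Q : IP) (k : hom (const (S : C)) Q) : is_discrete Q ->
  @split_mono A _ _ k -> exists (Q' : IP) (g : hom Q Q'), is_discrete Q' /\ @splits A _ _ _ k g.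
Proof.
move=> /discrete_diagram [D [st fin [d id]]] sk.
have [d' [d1 d2]] := id.
have [n0 H] := germ_factor (d \oc k).
have [x xE] := H n0 (leqnn n0).
have skd : @split_mono A _ _ (d \oc k).
  by apply: (@split_mono_comp A) sk; exact: (@iso_split_mono A).
have quot (n : nat) (h : @dle ndir n0 n) : exists (R : pro C) (t : hom (D n) R),
    finite_pro R /\ @splits (pro_add G) _ _ _ (dmap D h \oc x) t.
  have sx : @split_mono (pro_add G) _ _ (dmap D h \oc x).
    have [rd rdP] := skd.
    apply/(@cind_split_mono (pro_add G)).
    exists (rd \oc @cin (pro C) (IndObj D) n).
    have e1 : @cin (pro C) (IndObj D) n \oc cind_map (dmap D h \oc x) = d \oc k.
      rewrite xE cind_map_comp compA; congr comp.
      exact: (@cin_dmap (pro C) (IndObj D)).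
    by rewrite [LHS](esym (compA _ _ _)) e1; exact: rdP.
  have [a [al ial]] := fin n; have [be [b1 b2]] := ial.
  have [y yE] := cpro_full (al \oc (dmap D h \oc x)).
  have sy : split_mono y.
    apply/cpro_split_mono; rewrite -yE.
    by apply: (@split_mono_comp (pro_add G)) sx; exact: (@iso_split_mono (pro_add G)).
  have [R [t syt]] := split_mono_splits sy.
  exists (cpro (R : C)), (@cpro_map C a R t \oc al); split.
    by exists R, (idm _); exact: (@iso_id (pro C)).
  apply: (@splits_iso (pro_add G) _ _ _ _ _ _ _ _ _ _ (idm _) al (idm _) _ ial _ _ _
    ((cpro_splits _ _).2 syt)).
  - exact: (@iso_id (pro C)).
  - exact: (@iso_id (pro C)).
  - by rewrite [RHS]compm1; exact: yE.
  - exact: (@comp1m (pro C)).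
have [R [g [stR fR sp]]] := @sequence_quotient_at (pro_add G) D (@finite_pro G) _ n0 x st quot.
exists (IndObj R), (g \oc d); split; first exact: discrete_of_diagram.
apply: (@splits_iso A _ _ _ _ _ _ _ _ _ _ (idm _) d (idm _) _ id _ _ _ sp).
- exact: (@iso_id IP).
- exact: (@iso_id IP).
- by rewrite [RHS]compm1; apply: (etrans xE); rewrite -germ_homE.
- exact: (@comp1m IP).
Qed.

(** Image factorisation with both factors split. It holds for finite dimensional vector spaces, and
    serves to pass from them to 1-Tate spaces. *)
Definition epi_mono_split : Prop := forall (a b : G) (f : hom a b),
  exists (c : G) (p : hom a c) (m : hom c b), [/\ split_epi p, split_mono m & f = m \oc p].
Hypothesis ss : epi_mono_split.

(** L maps into one term of Q, and a constant target sees only one term of the limit L. What remains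
    is a map z of C, whose image is S. *)
Lemma compact_discrete_factor (L Q : IP) (f : hom L Q) : is_compact L -> is_discrete Q ->
  exists (S : G) (t : hom L (const (S : C))) (k : hom (const (S : C)) Q),
    [/\ @split_epi A _ _ t, @split_mono A _ _ k & f = k \oc t].
Proof.
move=> /compact_diagram [E [stE [l [l' [l1 l2]]]]] /discrete_diagram [D [stD fin [d [d' [d1 d2]]]]].
have [n0 /(_ n0 (leqnn n0)) [g gE]] := germ_factor (d \oc (f \oc l')).
have [a [x [y [yx xy]]]] := fin n0.
have [j [z zE]] := @germ_homP (opcat C) a (IndObj E) (x \oc g).
have [S [p [m [sp sm zmp]]]] := ss (z : @hom C (E j) a).
pose cj : @hom (pro C) (IndObj E) (cpro (E j : C)) := @cin (opcat C) (IndObj E) j.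
have scj : @split_epi (pro_add G) _ _ cj.
  by have [rr rP] := @cin_split_mono (op_add G) E j stE; exists rr.
have gE2 : g = y \oc (@cpro_map C S a m \oc (@cpro_map C (E j) S p \oc cj)).
  rewrite -[g]comp1m -yx -compA; congr comp.
  rewrite [RHS]compA -cpro_map_comp -zmp; apply: etrans zE _.
  exact: (@germ_homE (opcat C)).
exists S, (cind_map (@cpro_map C (E j) S p \oc cj) \oc l),
  (d' \oc (@cin (pro C) (IndObj D) n0 \oc cind_map (y \oc @cpro_map C S a m))); split.
- apply: (@split_epi_comp A).
    apply/(@cind_split_epi (pro_add G)); apply: (@split_epi_comp (pro_add G)) => //.
    have /(@cind_split_mono (op_add G)) [rr rP] : @split_mono (op_add G) _ _ p.
      by have [q qP] := sp; exists q.
    by exists rr.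
  by exists l'.
- apply: (@split_mono_comp A); first by exists d.
  apply: (@split_mono_comp A); first exact: (@cin_split_mono (pro_add G) D n0 stD).
  apply/(@cind_split_mono (pro_add G)); apply: (@split_mono_comp (pro_add G)).
    by exists x.
  exact/cpro_split_mono.
- rewrite -[f]compm1 -l1 !compA; congr comp.
  rewrite -[f]comp1m -d1 -!compA; congr comp.
  by rewrite gE -cind_map_comp gE2 -!compA.
Qed.

Lemma compact_idempotent (N : IP) (e : hom N N) : is_compact N -> e \oc e = e ->
  exists (N1 : IP) (p : hom N N1) (i : hom N1 N),
    [/\ is_compact N1, p \oc i = idm _ & i \oc p = e].
Proof.
move=> /compact_diagram [E [stE [l [l' [l1 l2]]]]] ee.
have [x xE] := cind_full (l \oc (e \oc l')).
have xx : x \oc x = x.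
  apply: cind_faithful; rewrite cind_map_comp -xE -compA; congr comp.
  by rewrite -compA (compA l') l1 comp1m compA ee.
(* In the opposite category the epimorphism and the monomorphism of the factorisation exchange
   roles. *)
have fk (a b : op_add G) (f : hom a b) : True -> True -> @split_factor (op_add G) (fun=> True) a b f.
  move=> _ _; have [c [p [m [[q qP] [r rP] fE]]]] := ss (f : @hom C b a).
  by exists c, m, p; split=> //; [exists r|exists q].
have [E' [p [i [stE' _ pi ip]]]] :=
  @idempotent_colimit (op_add G) (fun=> True) fk E x stE (fun=> Logic.I) xx.
pose p' : @hom (pro C) (IndObj E') (IndObj E) := p.
pose i' : @hom (pro C) (IndObj E) (IndObj E') := i.
have pi' : i' \oc p' = idm _ := pi.
have ip' : p' \oc i' = x := ip.
exists (cind (IndObj E' : pro C)), (cind_map i' \oc l), (l' \oc cind_map p'); split.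
- exact: compact_of_diagram.
- by rewrite -compA (compA l) l2 comp1m -cind_map_comp pi' cind_map_id.
- rewrite -compA (compA (cind_map p')) -cind_map_comp ip' -xE.
  by rewrite -!compA l1 compm1 compA l1 comp1m.
Qed.

Lemma discrete_idempotent (Q : IP) (e : hom Q Q) : is_discrete Q -> e \oc e = e ->
  exists (Q1 : IP) (p : hom Q Q1) (i : hom Q1 Q),
    [/\ is_discrete Q1, p \oc i = idm _ & i \oc p = e].
Proof.
move=> /discrete_diagram [D [stD fin [d [d' [d1 d2]]]]] ee.
pose x : hom (IndObj D : IP) (IndObj D) := d \oc (e \oc d').
have xx : x \oc x = x.
  by rewrite /x -compA; congr comp; rewrite -compA (compA d') d1 comp1m compA ee.
have fk (a b : pro_add G) (f : hom a b) : finite_pro a -> finite_pro b ->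
    @split_factor (pro_add G) (@finite_pro G) a b f.
  move=> [a0 [al [al' [a1 a2]]]] [b0 [be [be' [b1 b2]]]].
  have [y yE] := cpro_full (be \oc (f \oc al')).
  have [c [p [m [sp sm yE']]]] := ss y.
  exists (cpro (c : C)), (@cpro_map C a0 c p \oc al), (be' \oc @cpro_map C c b0 m); split.
  - by exists c, (idm _); exact: (@iso_id (pro C)).
  - apply: (@split_epi_comp (pro_add G)); last by exists al'.
    have /(@cind_split_mono (op_add G)) [rr rP] : @split_mono (op_add G) _ _ p.
      by have [q qP] := sp; exists q.
    by exists rr.
  - apply: (@split_mono_comp (pro_add G)); first by exists be.
    exact/cpro_split_mono.
  - rewrite [RHS](esym (compA _ _ _)).
    rewrite [X in be' \oc X]compA -cpro_map_comp -yE' -yE.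
    by rewrite -!compA a1 compm1 compA b1 comp1m.
have [E [p [i [stE fE pi ip]]]] :=
  @idempotent_colimit (pro_add G) (@finite_pro G) fk D x stD fin xx.
exists (IndObj E), (p \oc d), (d' \oc i); split.
- exact: discrete_of_diagram.
- by rewrite -compA (compA d) d2 comp1m.
- rewrite -compA (compA i) ip /x -!compA d1 compm1 compA d1 comp1m //.
Qed.

End Idempotents.

Section StableExtension.
Variable A : addcat.

(* Here S is the image of L in Q under e, and N = L + S. *)
Lemma stable_extension (L V Q S Q' N : A) (X : bip L Q V) (Y : bip S Q' Q) (Z : bip L S N)
    (X' : bip N Q' V) (e : hom V V) (t : hom L S) :
  bi1 X' = bi1 X \oc bp1 Z + bi2 X \oc (bi1 Y \oc bp2 Z) -> bp2 X' = bp2 Y \oc bp2 X ->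
  e \oc e = e -> split_epi t -> bp2 X \oc (e \oc bi1 X) = bi1 Y \oc t ->
  bp2 X' \oc (e \oc bi1 X') = 0.
Proof.
move=> E1 E2 ee st f.
have eX : e \oc bi1 X = bi1 X \oc (bp1 X \oc (e \oc bi1 X)) + bi2 X \oc (bi1 Y \oc t).
  by rewrite -f !(compA (bi1 X)) !(compA (bi2 X)) -compDl bip_sum comp1m.
have q1 : bp2 X' \oc (e \oc bi1 X) = 0.
  rewrite E2 -compA f compA bp2i1 comp0l; exact.
have q2 : bp2 X' \oc (e \oc (bi2 X \oc bi1 Y)) = 0.
  apply: (split_epi_inj st); rewrite comp0l.
  have -> : bp2 X' \oc (e \oc (bi2 X \oc bi1 Y)) \oc t = bp2 X' \oc (e \oc (bi2 X \oc (bi1 Y \oc t))).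
    by rewrite !compA.
  apply: (@haddI _ _ _ (bp2 X' \oc (e \oc (bi1 X \oc (bp1 X \oc (e \oc bi1 X)))))).
  rewrite -!compDr -eX (compA e e) ee haddr0 q1.
  by rewrite (compA e (bi1 X)) (compA (bp2 X')) q1 comp0l.
rewrite E1 compDr (compA e) compDr (compA (bp2 X')) q1 comp0l hadd0.
by rewrite (compA (bi2 X)) (compA e) (compA (bp2 X')) q2 comp0l.
Qed.

Lemma triangular_blocks (V N Q : A) (e : hom V V) (X : bip N Q V) (a : hom N N) (d : hom Q Q) :
  e \oc e = e -> bp2 X \oc (e \oc bi1 X) = 0 ->
  a = bp1 X \oc (e \oc bi1 X) -> d = bp2 X \oc (e \oc bi2 X) -> a \oc a = a /\ d \oc d = d.
Proof.
move=> ee low aE dE.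
have eX : e \oc bi1 X = bi1 X \oc a.
  rewrite -[e \oc bi1 X]comp1m -(bip_sum X) compDl -!compA low comp0r haddr0.
  by rewrite aE !compA.
have Xe : bp2 X \oc e = d \oc bp2 X.
  rewrite -[bp2 X \oc e]compm1 -(bip_sum X) compDr !compA -(compA _ e) low comp0l hadd0.
  by rewrite dE !compA.
split; first by rewrite {1}aE -!compA -eX (compA e e) ee -aE.
by rewrite {2}dE compA -Xe -compA (compA e e) ee dE.
Qed.

End StableExtension.

Section LcCategory.
Variable G : gex.
Notation C := (gexcat G).
Notation IP := (ind (pro C)).
Notation A := (indpro_add G).
Hypothesis ss : epi_mono_split G.

(** A lattice L need not be stable under e. The map from L to V/L induced by e has an image S in C,
    and N = L + S is stable because e is idempotent. Hence e is block triangular for N and Q', a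
    complement of S in V/L, and its diagonal blocks are idempotents of a compact and of a discrete
    object. *)
Lemma lc_idempotent (V : IP) (e : hom V V) : is_lc V -> e \oc e = e ->
  exists (W : IP) (p : hom V W) (i : hom W V), [/\ is_lc W, p \oc i = idm W & i \oc p = e].
Proof.
move=> lV ee; have [Nn [Xn _]] := lattice_chain lV.
have [Q [q [dQ sp]]] := lattice_splits (Xn 0%N).
have cL := lattice_compact (Xn 0%N).
have [X [X1 X2]] := @bip_of_splits A _ _ _ _ _ sp.
have [S [t [k [st sk f]]]] := compact_discrete_factor ss (q \oc (e \oc sval (Xn 0%N))) cL dQ.
have [Q' [g [dQ' sp']]] := discrete_quotient dQ sk.
have [Y [Y1 Y2]] := @bip_of_splits A _ _ _ _ _ sp'.
have [N [Z _]] := lc_sum (compact_lc cL) (const_lc S).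
have cN : is_compact N := compact_splits (splits_of_bip Z) cL (const_compact S).
have [X' [X'1 X'2]] := @bip_of_splits A _ _ _ _ _ (splits_extend X Y Z).
have f' : @comp A _ _ _ (bp2 X) (@comp A _ _ _ e (bi1 X)) = @comp A _ _ _ (bi1 Y) t.
  by rewrite X1 X2 Y1; exact: f.
have low := @stable_extension A _ _ _ _ _ _ X Y Z X' e t X'1 X'2 ee st f'.
have [aa dd] := @triangular_blocks A _ _ _ e X' _ _ ee low erefl erefl.
have [N1 [pN [iN [cN1 n1 n2]]]] := compact_idempotent ss cN aa.
have [Q1 [pQ [iQ [dQ1 q1 q2]]]] := discrete_idempotent ss dQ' dd.
have [W [Z' lW]] := lc_sum (compact_lc cN1) (discrete_lc dQ1).
have [p [i [pi ip]]] := @triangular_split A _ _ _ _ _ _ e X' Z' pN iN pQ iQ ee low n1 n2 q1 q2.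
by exists W, p, i.
Qed.

Definition lc_add : addcat.
refine (@AddCat (lc_cat C) (fun X Y f g => @hadd A (sval X) (sval Y) f g)
  (fun X Y f => @hopp A (sval X) (sval Y) f) (fun X Y => @hzero A (sval X) (sval Y)) _ _ _ _ _ _).
- by move=> X Y; exact: (@haddA A).
- by move=> X Y; exact: (@haddC A).
- by move=> X Y; exact: (@hadd0 A).
- by move=> X Y; exact: (@haddN A).
- by move=> X Y Z; exact: (@hcompDl A).
- by move=> X Y Z; exact: (@hcompDr A).
Defined.

Lemma lc_add_splits (X Y Z : lc_cat C) (f : hom X Y) (g : hom Y Z) :
  @splits lc_add X Y Z f g <-> @splits A (sval X) (sval Y) (sval Z) f g.
Proof.
split=> -[r [s [h1 h2 h3 h4]]]; exists r, s; split;
  [exact: h1|exact: h2|exact: h3|exact: h4|exact: h1|exact: h2|exact: h3|exact: h4].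
Qed.

Lemma lc_sesP (X Y Z : lc_cat C) (f : hom X Y) (g : hom Y Z) :
  @lc_ses C (sval X) (sval Y) (sval Z) f g <-> @splits lc_add X Y Z f g.
Proof.
split=> [/lc_ses_splits s|/lc_add_splits s]; first exact/lc_add_splits.
exact: (splits_lc_ses s (svalP X) (svalP Z)).2.
Qed.

Lemma lc_zero : exists Z : lc_add, idm Z = hzero Z Z.
Proof.
have [z z0] := gzero G.
have e : @idm IP (const (z : C)) = hzero (const (z : C) : A) (const (z : C)).
  apply: etrans (cind_map_0 (A := pro_add G) _ _); apply: etrans (esym (cind_map_id _)) _.
  apply: f_equal; apply: etrans (esym (cpro_map_id z)) _; rewrite z0.
  exact: (cind_map_0 (A := op_add G)).
by exists (exist _ _ (const_lc z)); exact: e.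
Qed.

Lemma lc_bip (X Z : lc_add) : exists (Y : lc_add) (f : hom X Y) (g : hom Y Z), splits f g.
Proof.
have [Y [B lY]] := lc_sum (svalP X) (svalP Z).
exists (exist _ Y lY), (bi1 B), (bp2 B); apply/lc_add_splits; exact: (splits_of_bip B).
Qed.

Lemma lc_split_idempotent (X : lc_add) (e : hom X X) : e \oc e = e ->
  exists (W : lc_add) (p : hom X W) (i : hom W X), p \oc i = idm W /\ i \oc p = e.
Proof.
move=> ee; have [W [p [i [lW pi ip]]]] := @lc_idempotent (sval X) e (svalP X) ee.
by exists (exist _ W lW), p, i; split; [exact: pi|exact: ip].
Qed.

Definition lc_gex : gex :=
  @Gex lc_add (fun X Y Z f g => @lc_ses C (sval X) (sval Y) (sval Z) f g)
    lc_sesP lc_zero lc_bip lc_split_idempotent.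

End LcCategory.

Local Close Scope hom_scope.

(** * Finite dimensional vector spaces, and from them 1-Tate spaces *)

Section FiniteDimensional.
Variable k : fieldType.

Definition finvect_add : addcat.
refine (@AddCat (finvect_cat k) (fun U V (f g : 'Hom(U, V)) => (f + g)%R)
  (fun U V (f : 'Hom(U, V)) => (- f)%R) (fun U V => (0%R : 'Hom(U, V))) _ _ _ _ _ _).
- by move=> U V; exact: addrA.
- by move=> U V; exact: addrC.
- by move=> U V; exact: add0r.
- by move=> U V; exact: addNr.
- by move=> U V W f g h; exact: comp_lfunDl.
- by move=> U V W f g h; exact: comp_lfunDr.
Defined.

Lemma finvect_factor (U V : vectType k) (f : 'Hom(U, V)) :
  exists (S : vectType k) (p : 'Hom(U, S)) (m : 'Hom(S, V)),
    [/\ exists s, (p \o s)%VF = \1%VF, exists r, (r \o m)%VF = \1%VF & f = (m \o p)%VF].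
Proof.
pose S : vectType k := subvs_of (limg f).
pose m : 'Hom(S, V) := linfun vsval.
pose r : 'Hom(V, S) := linfun (vsproj (limg f)).
have rm : (r \o m)%VF = \1%VF.
  by apply/lfunP => x; rewrite comp_lfunE !lfunE /= vsvalK.
exists S, (r \o f)%VF, m; split; last 1 first.
- by apply/lfunP => x; rewrite !comp_lfunE !lfunE /= vsprojK // memv_img // memvf.
- exists (f^-1 \o m)%VF; apply/lfunP => x.
  rewrite !comp_lfunE limg_lfunVK; last by rewrite lfunE /= subvsP.
  by move/lfunP/(_ x): rm; rewrite comp_lfunE.
- by exists r.
Qed.

Lemma finvect_splits (U V W : vectType k) (f : 'Hom(U, V)) (g : 'Hom(V, W)) :
  [/\ lker f = 0%VS, limg f = lker g & limg g = fullv] <->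
  @splits finvect_add U V W f g.
Proof.
split=> [[k0 e1 e2]|[r [s [h1 h2 h3 h4]]]].
  have h1 : (f^-1 \o f)%VF = \1%VF.
    by apply/lfunP => x; rewrite comp_lfunE id_lfunE lker0_lfunK // k0.
  have h2 : (g \o g^-1)%VF = \1%VF.
    by apply/lfunP => x; rewrite comp_lfunE id_lfunE limg_lfunVK // e2 memvf.
  have h3 : (g \o f)%VF = 0%R.
    apply/lfunP => x; rewrite comp_lfunE zero_lfunE; apply/eqP.
    by rewrite -memv_ker -e1 memv_img // memvf.
  pose gg : 'End(V) := (g^-1 \o g)%VF.
  pose r : 'Hom(V, U) := (f^-1 \o (\1 - gg))%VF.
  exists r, (g^-1)%VF; split=> //.
    apply/lfunP => x; rewrite /= /r /gg !(comp_lfunE, add_lfunE, opp_lfunE, id_lfunE).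
    have -> : g (f x) = 0 by rewrite -comp_lfunE h3 zero_lfunE.
    by rewrite linear0 subr0 lker0_lfunK // k0.
  apply/lfunP => x; rewrite /= /r /gg !(add_lfunE, comp_lfunE, opp_lfunE, id_lfunE).
  rewrite limg_lfunVK ?subrK // e1 memv_ker linearB /=.
  by rewrite (limg_lfunVK (f := g)) ?subrr // e2 memvf.
split.
- apply/eqP/lker0P => x y e; have /lfunP h := h1.
  by rewrite -[x]id_lfunE -[y]id_lfunE -!h /= !comp_lfunE e.
- apply/vspaceP => x; apply/memv_imgP/idP => [[y _ ->]|].
    by rewrite memv_ker -comp_lfunE (h3 : (g \o f)%VF = 0%R) zero_lfunE.
  rewrite memv_ker => /eqP gx; exists (r x); first exact: memvf.
  have /lfunP/(_ x) := h4; rewrite /= add_lfunE !comp_lfunE gx linear0 addr0 id_lfunE.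
  by [].
- apply/vspaceP => x; rewrite memvf; apply/memv_imgP; exists (s x); first exact: memvf.
  by have /lfunP/(_ x) := h2; rewrite /= comp_lfunE id_lfunE.
Qed.

Lemma finvect_zero : exists Z : finvect_add, idm Z = hzero Z Z.
Proof.
exists ('rV[k]_0 : vectType k); apply/lfunP => x.
by rewrite [LHS]id_lfunE [RHS]zero_lfunE; apply/rowP => -[].
Qed.

Lemma finvect_bip (U V : finvect_add) :
  exists (W : finvect_add) (f : hom U W) (g : hom W V), splits f g.
Proof.
pose W : vectType k := ((U : vectType k) * (V : vectType k))%type.
have l1 : linear (fun x : (U : vectType k) => (x, 0%R) : W).
  by move=> a x y; congr pair; rewrite [(_ *: _).2]scaler0 addr0.
have l2 : linear (fun x : (V : vectType k) => (0%R, x) : W).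
  by move=> a x y; congr pair; rewrite [(_ *: _).1]scaler0 addr0.
pose i1 : {linear (U : vectType k) -> W} := HB.pack (fun x : (U : vectType k) => (x, 0%R) : W)
  (GRing.isLinear.Build _ _ _ _ _ l1).
pose i2 : {linear (V : vectType k) -> W} := HB.pack (fun x : (V : vectType k) => (0%R, x) : W)
  (GRing.isLinear.Build _ _ _ _ _ l2).
pose p1 : 'Hom(W, U) := linfun (@fst (U : vectType k) (V : vectType k)).
pose p2 : 'Hom(W, V) := linfun (@snd (U : vectType k) (V : vectType k)).
have E1 x : linfun i1 x = (x, 0) := lfunE i1 x.
have E2 x : linfun i2 x = (0, x) := lfunE i2 x.
have F1 x : p1 x = x.1 by rewrite lfunE.
have F2 x : p2 x = x.2 by rewrite lfunE.
exists W, (linfun i1), p2, p1, (linfun i2); split; apply/lfunP => x.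
- by rewrite [LHS]comp_lfunE E1 F1 [RHS]id_lfunE.
- by rewrite [LHS]comp_lfunE E2 F2 [RHS]id_lfunE.
- by rewrite [LHS]comp_lfunE E1 F2 [RHS]zero_lfunE.
- rewrite [LHS]add_lfunE [X in X + _]comp_lfunE [X in _ + X]comp_lfunE F1 F2 E1 E2 [RHS]id_lfunE.
  by case: x => x y; congr pair; [exact: addr0|exact: add0r].
Qed.

Lemma finvect_split_idempotent (U : finvect_add) (e : hom U U) : e \oc e = e ->
  exists (W : finvect_add) (p : hom U W) (i : hom W U), p \oc i = idm W /\ i \oc p = e.
Proof.
move=> ee; have [S [p [m [[s ps] [r rm] eE]]]] := finvect_factor e.
have E : e = @comp finvect_add U S U m p := eE.
exists S, p, m; split=> //.
apply: (@split_mono_inj finvect_add S S U m); first by exists r.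
apply: (@split_epi_inj finvect_add U S U p); first by exists s.
have h : @comp finvect_add S S U m (@comp finvect_add S U S p m) \oc p = e \oc e.
  by rewrite E !compA.
by rewrite compm1 h ee E.
Qed.

Definition finvect_gex : gex :=
  @Gex finvect_add (fun (U V W : vectType k) (f : 'Hom(U, V)) (g : 'Hom(V, W)) =>
    [/\ lker f = 0%VS, limg f = lker g & limg g = fullv])
    finvect_splits finvect_zero finvect_bip finvect_split_idempotent.

Lemma finvect_ss : epi_mono_split finvect_gex.
Proof.
move=> U V f; have [S [p [m [[s ps] [r rm] eE]]]] := finvect_factor f.
by exists S, p, m; split=> //; [exists s|exists r].
Qed.

Definition tate1_gex : gex := lc_gex finvect_ss.

End FiniteDimensional.

(** * Cohomology of a directed system of edges *)

Section AbelianReflection.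
Variable K : zmodType.

(** Formal linear expressions over the integers. Expressions with equal coefficients have equal
    values, and the coefficients are compared by computation. *)
Inductive zexp := ZVar of nat | ZAdd of zexp & zexp | ZOpp of zexp | ZZero.

Fixpoint zeval (env : seq K) (e : zexp) : K :=
  match e with
  | ZVar n => nth 0 env n | ZAdd a b => zeval env a + zeval env b
  | ZOpp a => - zeval env a | ZZero => 0 end.

Fixpoint zcoef (n : nat) (e : zexp) : int :=
  match e with
  | ZVar m => (m == n)%:Z | ZAdd a b => zcoef n a + zcoef n b
  | ZOpp a => - zcoef n a | ZZero => 0 end.

Lemma zevalE env e : zeval env e = \sum_(i < size env) nth 0 env i *~ zcoef i e.
Proof.
elim: e => [m|a IHa b IHb|a IH|] /=.
- have [h|h] := ltnP m (size env); last first.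
    rewrite nth_default // big1 // => i _; case: eqP => [e|]; last by rewrite mulr0z.
    by move: (ltn_ord i); rewrite -e ltnNge h.
  rewrite (bigD1 (Ordinal h)) //= eqxx mulr1z big1 ?addr0 // => i ne.
  case: eqP => [e|]; last by rewrite mulr0z.
  by case/eqP: ne; apply: val_inj.
- by rewrite IHa IHb -big_split; apply: eq_bigr => i _; rewrite mulrzDr.
- by rewrite IH -sumrN; apply: eq_bigr => i _; rewrite mulrNz.
- by rewrite big1 // => i _; rewrite mulr0z.
Qed.

Lemma zeval_eq env e e' :
  all (fun i => zcoef i e == zcoef i e') (iota 0 (size env)) -> zeval env e = zeval env e'.
Proof.
move=> /allP h; rewrite !zevalE; apply: eq_bigr => i _.
by rewrite (eqP (h _ _)) // mem_iota /= ltn_ord.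
Qed.

End AbelianReflection.

(* [zabel] decides the linear identities of a [zmodType], to which [ring] does not apply. *)
Ltac zmem x l := lazymatch l with
  | nil => constr:(false) | x :: _ => constr:(true) | _ :: ?t => zmem x t end.
Ltac zatoms t l := lazymatch t with
  | (?a + ?b)%R => let l := zatoms a l in zatoms b l
  | (- ?a)%R => zatoms a l
  | 0%R => l
  | _ => let m := zmem t l in lazymatch m with true => l | false => constr:(t :: l) end end.
Ltac zindex x l := lazymatch l with
  | x :: _ => constr:(0%N) | _ :: ?t => let n := zindex x t in constr:(n.+1) end.
Ltac zreify t l := lazymatch t with
  | (?a + ?b)%R => let a := zreify a l in let b := zreify b l in constr:(ZAdd a b)
  | (- ?a)%R => let a := zreify a l in constr:(ZOpp a)
  | 0%R => constr:(ZZero)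
  | _ => let n := zindex t l in constr:(ZVar n) end.
Ltac zabel := lazymatch goal with
  | |- @eq ?T ?a ?b => let l := zatoms a (@nil T) in let l := zatoms b l in
     let ea := zreify a l in let eb := zreify b l in
     apply: (@zeval_eq _ l ea eb); reflexivity end.

Section Cochains.
Variables (P : Type) (E : P -> P -> Type) (K : zmodType).

Definition cochain0 := P -> K.
(** A simplex consists of its vertices and of one edge for every pair of them. Parallel edges are
    allowed and no relation between the edges is imposed. *)
Definition cochain1 := forall x y, E x y -> K.
Definition cochain2 := forall x y z, E x y -> E x z -> E y z -> K.
Definition cochain3 := forall x y z w,
  E x y -> E x z -> E x w -> E y z -> E y w -> E z w -> K.

Definition cd0 (f : cochain0) : cochain1 := fun x y _ => f y - f x.
Definition cd1 (c : cochain1) : cochain2 := fun x y z xy xz yz =>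
  c _ _ yz - c _ _ xz + c _ _ xy.
Definition cd2 (b : cochain2) : cochain3 := fun x y z w xy xz xw yz yw zw =>
  b _ _ _ yz yw zw - b _ _ _ xz xw zw + b _ _ _ xy xw yw - b _ _ _ xy xz yz.
Definition cocycle3 (a : cochain3) : Prop := forall x0 x1 x2 x3 x4
    (e01 : E x0 x1) (e02 : E x0 x2) (e03 : E x0 x3) (e04 : E x0 x4) (e12 : E x1 x2)
    (e13 : E x1 x3) (e14 : E x1 x4) (e23 : E x2 x3) (e24 : E x2 x4) (e34 : E x3 x4),
  a _ _ _ _ e12 e13 e14 e23 e24 e34 - a _ _ _ _ e02 e03 e04 e23 e24 e34
  + a _ _ _ _ e01 e03 e04 e13 e14 e34 - a _ _ _ _ e01 e02 e04 e12 e14 e24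
  + a _ _ _ _ e01 e02 e03 e12 e13 e23 = 0.

Variable N : nat -> P.
Hypothesis chainN : forall m n, (m <= n)%N -> exists e : E (N m) (N n), True.
Hypothesis chainP : forall x, exists n0, forall n, (n0 <= n)%N -> exists e : E x (N n), True.

Let rk_ex x : exists n0, `[< forall n, (n0 <= n)%N -> exists e : E x (N n), True >].
Proof. by have [n0 h] := chainP x; exists n0; apply/asboolP. Qed.

(** Minimality bounds the rank of N n by n, so the vertex of a cone stays within the range of ranks
    being contracted. *)
Definition rk x := ex_minn (rk_ex x).

Lemma rkP x n : (rk x <= n)%N -> exists e : E x (N n), True.
Proof. by rewrite /rk; case: ex_minnP => m /asboolP h _; exact: h. Qed.
Lemma rkN n : (rk (N n) <= n)%N.
Proof. by rewrite /rk; case: ex_minnP => m _; apply; apply/asboolP; exact: chainN. Qed.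

Definition redge x n (h : (rk x <= n)%N) : E x (N n) := sval (cid (rkP h)).

(* Contraction of the simplices with vertices of rank at most n onto N n. *)
Definition cone1 n (c : cochain1) : cochain0 := fun x =>
  if pselect (rk x <= n)%N is left h then - c _ _ (redge h) else 0.
Definition cone2 n (b : cochain2) : cochain1 := fun x y e =>
  if pselect (rk x <= n)%N is left h then
  if pselect (rk y <= n)%N is left h' then b _ _ _ e (redge h) (redge h') else 0 else 0.
Definition cone3 n (a : cochain3) : cochain2 := fun x y z xy xz yz =>
  if pselect (rk x <= n)%N is left h then
  if pselect (rk y <= n)%N is left h' then
  if pselect (rk z <= n)%N is left h'' then
    - a _ _ _ _ xy xz (redge h) yz (redge h') (redge h'') else 0 else 0 else 0.

Lemma cone1E n c x (h : (rk x <= n)%N) : cone1 n c x = - c _ _ (redge h).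
Proof. by rewrite /cone1; case: pselect => // h'; rewrite (Prop_irrelevance h' h). Qed.
Lemma cone2E n b x y (e : E x y) (h : (rk x <= n)%N) (h' : (rk y <= n)%N) :
  cone2 n b e = b _ _ _ e (redge h) (redge h').
Proof.
rewrite /cone2; case: pselect => // i; case: pselect => // i'.
by rewrite (Prop_irrelevance i h) (Prop_irrelevance i' h').
Qed.
Lemma cone3E n a x y z (xy : E x y) (xz : E x z) (yz : E y z) (h : (rk x <= n)%N) (h' : (rk y <= n)%N) (h'' : (rk z <= n)%N) :
  cone3 n a xy xz yz = - a _ _ _ _ xy xz (redge h) yz (redge h') (redge h'').
Proof.
rewrite /cone3; case: pselect => // i; case: pselect => // i'; case: pselect => // i''.
by rewrite (Prop_irrelevance i h) (Prop_irrelevance i' h') (Prop_irrelevance i'' h'').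
Qed.

(** The integral of c along the path from N 0 up to N (rk y) and down to y. Subtracting the value at
    N 0 removes the constant by which the primitives on different ranges differ. *)
Definition htp0 (c : cochain1) : cochain0 := fun y => cone1 (rk y) c y - cone1 (rk y) c (N 0).
(** The cone of b on the ranks occurring in the edge, normalised by subtracting the coboundary of
    its own contraction; [htp2] repeats the pattern one degree higher. *)
Definition htp1 (b : cochain2) : cochain1 := fun x y e =>
  let c := cone2 (maxn (rk x) (rk y)) b in c _ _ e - cd0 (htp0 c) e.
Definition htp2 (a : cochain3) : cochain2 := fun x y z xy xz yz =>
  let b := cone3 (maxn (rk x) (maxn (rk y) (rk z))) a in b _ _ _ xy xz yz - cd1 (htp1 b) xy xz yz.

Definition agree1 n (c c' : cochain1) := forall x y e,
  (rk x <= n)%N -> (rk y <= n)%N -> c x y e = c' x y e.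
Definition agree2 n (b b' : cochain2) := forall x y z xy xz yz,
  (rk x <= n)%N -> (rk y <= n)%N -> (rk z <= n)%N -> b x y z xy xz yz = b' x y z xy xz yz.

Let rk0 x : (rk (N 0) <= rk x)%N := leq_trans (rkN 0) (leq0n _).

(** Only vertices of rank at most that of y enter, the cone vertex included. Locality allows a
    cochain to be replaced by one that agrees with it on low ranks only. *)
Lemma htp0_loc n c c' y : agree1 n c c' -> (rk y <= n)%N -> htp0 c y = htp0 c' y.
Proof.
move=> ag h; rewrite /htp0 !(cone1E _ (leqnn (rk y))) !(cone1E _ (rk0 y)).
by rewrite !ag ?(leq_trans (rkN _)) // (leq_trans (rk0 y)).
Qed.

Lemma cone2_loc m n b b' : (m <= n)%N -> agree2 n b b' -> agree1 m (cone2 m b) (cone2 m b').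
Proof.
move=> mn ag x y e h h'; rewrite !(cone2E _ _ h h') ag //; try exact: leq_trans mn.
by apply: leq_trans mn; exact: rkN.
Qed.

Lemma htp1_loc n b b' x y (e : E x y) : agree2 n b b' -> (rk x <= n)%N -> (rk y <= n)%N ->
  htp1 b e = htp1 b' e.
Proof.
move=> ag h h'; rewrite /htp1 /cd0.
have mn : (maxn (rk x) (rk y) <= n)%N by rewrite geq_max h.
have ag' := cone2_loc mn ag.
by rewrite ag' ?leq_maxl ?leq_maxr // !(htp0_loc ag') ?leq_maxl ?leq_maxr.
Qed.

Definition agree3 n (a a' : cochain3) :=
  forall x y z w (xy : E x y) (xz : E x z) (xw : E x w) (yz : E y z) (yw : E y w) (zw : E z w),
  (rk x <= n)%N -> (rk y <= n)%N -> (rk z <= n)%N -> (rk w <= n)%N ->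
  a _ _ _ _ xy xz xw yz yw zw = a' _ _ _ _ xy xz xw yz yw zw.

Lemma cone3_loc m n a a' : (m <= n)%N -> agree3 n a a' -> agree2 m (cone3 m a) (cone3 m a').
Proof.
move=> mn ag x y z xy xz yz h h' h''; rewrite !(cone3E _ _ _ _ h h' h'') ag //;
  try exact: leq_trans mn.
by apply: leq_trans mn; exact: rkN.
Qed.

Lemma htp2_loc n a a' x y z (xy : E x y) (xz : E x z) (yz : E y z) : agree3 n a a' ->
  (rk x <= n)%N -> (rk y <= n)%N -> (rk z <= n)%N -> htp2 a xy xz yz = htp2 a' xy xz yz.
Proof.
move=> ag h h' h''; rewrite /htp2; set m := maxn _ _.
have mn : (m <= n)%N by rewrite /m !geq_max h h'.
have hx : (rk x <= m)%N by exact: leq_maxl.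
have hy : (rk y <= m)%N by rewrite /m !leq_max leqnn orbT.
have hz : (rk z <= m)%N by rewrite /m !leq_max leqnn !orbT.
have ag' := cone3_loc mn ag.
by rewrite ag' // /cd1 !(htp1_loc _ ag').
Qed.

Definition csub1 (c c' : cochain1) : cochain1 := fun x y e => c x y e - c' x y e.
Definition csub2 (b b' : cochain2) : cochain2 := fun x y z xy xz yz =>
  b x y z xy xz yz - b' x y z xy xz yz.

Lemma htp0_sub c c' y : htp0 (csub1 c c') y = htp0 c y - htp0 c' y.
Proof.
rewrite /htp0 !(cone1E _ (leqnn (rk y))) !(cone1E _ (rk0 y)) /csub1; zabel.
Qed.

Lemma cone2_sub n b b' : agree1 n (cone2 n (csub2 b b')) (csub1 (cone2 n b) (cone2 n b')).
Proof. by move=> x y e h h'; rewrite /csub1 !(cone2E _ _ h h'). Qed.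

Lemma htp1_sub b b' x y (e : E x y) : htp1 (csub2 b b') e = htp1 b e - htp1 b' e.
Proof.
rewrite /htp1 /cd0; set n := maxn _ _.
have hx : (rk x <= n)%N by exact: leq_maxl.
have hy : (rk y <= n)%N by exact: leq_maxr.
rewrite (cone2_sub _ _ _ hx hy) !(htp0_loc (cone2_sub (n := n) b b')) // !htp0_sub.
rewrite /csub1; zabel.
Qed.

Lemma htp0_d f y : htp0 (cd0 f) y = f y - f (N 0).
Proof.
rewrite /htp0 (cone1E _ (leqnn (rk y))) (cone1E _ (rk0 y)) /cd0; zabel.
Qed.

(** The homotopy identity of the cone, valid on ranks at most n; the signs in [cone1], [cone2] and
    [cone3] are chosen for it. *)
Lemma cone2_d n c : agree1 n (cone2 n (cd1 c)) (csub1 c (cd0 (cone1 n c))).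
Proof.
move=> x y e h h'; rewrite (cone2E _ _ h h') /csub1 /cd0 (cone1E _ h) (cone1E _ h') /cd1.
zabel.
Qed.

Lemma cone3_d n b : agree2 n (cone3 n (cd2 b)) (csub2 b (cd1 (cone2 n b))).
Proof.
move=> x y z xy xz yz h h' h''; rewrite (cone3E _ _ _ _ h h' h'') /csub2 /cd1.
rewrite (cone2E _ _ h h') (cone2E _ _ h h'') (cone2E _ _ h' h'') /cd2; zabel.
Qed.

(** The right side is the normalised c, the left side depends on the coboundary of c alone. Hence
    primitives of one cocycle on different ranges of ranks become equal once normalised. *)
Lemma htp1_d c x y (e : E x y) : htp1 (cd1 c) e = c _ _ e - cd0 (htp0 c) e.
Proof.
rewrite /htp1; set n := maxn _ _.
have hx : (rk x <= n)%N by exact: leq_maxl.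
have hy : (rk y <= n)%N by exact: leq_maxr.
rewrite /cd0 !(htp0_loc (cone2_d (n := n) c)) // !(htp0_sub c) !htp0_d (cone2_d _ _ hx hy).
by rewrite /csub1 /cd0; zabel.
Qed.

Lemma htp2_d b x y z (xy : E x y) (xz : E x z) (yz : E y z) :
  htp2 (cd2 b) xy xz yz = b _ _ _ xy xz yz - cd1 (htp1 b) xy xz yz.
Proof.
rewrite /htp2; set n := maxn _ _.
have hx : (rk x <= n)%N by exact: leq_maxl.
have hy : (rk y <= n)%N by rewrite /n !leq_max leqnn orbT.
have hz : (rk z <= n)%N by rewrite /n !leq_max leqnn !orbT.
rewrite /cd1 !(htp1_loc _ (cone3_d (n := n) b)) // !(htp1_sub b) !htp1_d.
by rewrite (cone3_d _ _ _ _ hx hy hz) /csub2 /cd1 /cd0; zabel.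
Qed.

Lemma H0_vanish (f : cochain0) : (forall x y (e : E x y), cd0 f e = 0) -> forall x y, f x = f y.
Proof.
move=> h x y.
have e z : f z = f (N 0).
  apply/eqP; rewrite -subr_eq0 -htp0_d /htp0 (cone1E _ (leqnn (rk z))) (cone1E _ (rk0 z)).
  by rewrite !h subrr.
by rewrite e (e y).
Qed.

Lemma H1_vanish (c : cochain1) : (forall x y z (xy : E x y) (xz : E x z) (yz : E y z), cd1 c xy xz yz = 0) ->
  exists f : cochain0, forall x y (e : E x y), cd0 f e = c _ _ e.
Proof.
move=> h; exists (htp0 c) => x y e; apply/esym/eqP; rewrite -subr_eq0 -htp1_d.
(* The cone of a zero cochain vanishes; zero is written as c - c so that [htp0_sub] evaluates the
   contraction on it. *)
have z n : agree1 n (cone2 n (cd1 c)) (csub1 c c).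
  by move=> x' y' e' a b; rewrite (cone2E _ _ a b) h /csub1 subrr.
rewrite /htp1 /cd0; set n := maxn _ _.
rewrite (z n) ?leq_maxl ?leq_maxr // !(htp0_loc (z n)) ?leq_maxl ?leq_maxr //.
by rewrite !htp0_sub /csub1 !subrr.
Qed.

Lemma H2_vanish (b : cochain2) :
  (forall x y z w (xy : E x y) (xz : E x z) (xw : E x w) (yz : E y z) (yw : E y w) (zw : E z w),
    cd2 b xy xz xw yz yw zw = 0) ->
  exists c : cochain1, forall x y z (xy : E x y) (xz : E x z) (yz : E y z),
    cd1 c xy xz yz = b _ _ _ xy xz yz.
Proof.
move=> h; exists (htp1 b) => x y z xy xz yz; apply/esym/eqP; rewrite -subr_eq0 -htp2_d.
have v n : agree2 n (cone3 n (cd2 b)) (csub2 b b).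
  by move=> x' y' z' a a' a'' r r' r''; rewrite (cone3E _ _ _ _ r r' r'') h /csub2 subrr oppr0.
rewrite /htp2; set n := maxn _ _.
have hx : (rk x <= n)%N by exact: leq_maxl.
have hy : (rk y <= n)%N by rewrite /n !leq_max leqnn orbT.
have hz : (rk z <= n)%N by rewrite /n !leq_max leqnn !orbT.
rewrite (v n) // /cd1 !(htp1_loc _ (v n)) // !htp1_sub.
by rewrite /csub2 !subrr addr0 subr0.
Qed.

Lemma H3_vanish (a : cochain3) : cocycle3 a ->
  exists b : cochain2, forall x y z w (xy : E x y) (xz : E x z) (xw : E x w) (yz : E y z) (yw : E y w) (zw : E z w),
    cd2 b xy xz xw yz yw zw = a _ _ _ _ xy xz xw yz yw zw.
Proof.
move=> coc; exists (htp2 a) => x y z w xy xz xw yz yw zw.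
pose n := maxn (maxn (rk x) (rk y)) (maxn (rk z) (rk w)).
have hx : (rk x <= n)%N by rewrite /n !leq_max leqnn.
have hy : (rk y <= n)%N by rewrite /n !leq_max leqnn !orbT.
have hz : (rk z <= n)%N by rewrite /n !leq_max leqnn !orbT.
have hw : (rk w <= n)%N by rewrite /n !leq_max leqnn !orbT.
(* The cocycle identity on the simplex completed by N n says that a is, on ranks at most n, the
   coboundary of its cone. By locality [htp2 a] is there this cone minus a coboundary. *)
have ag : agree3 n a (cd2 (cone3 n a)).
  move=> x0 x1 x2 x3 e01 e02 e03 e12 e13 e23 h0 h1 h2 h3.
  have := coc _ _ _ _ _ e01 e02 e03 (redge h0) e12 e13 (redge h1) e23 (redge h2) (redge h3).
  rewrite /cd2 (cone3E _ _ _ _ h1 h2 h3) (cone3E _ _ _ _ h0 h2 h3) (cone3E _ _ _ _ h0 h1 h3).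
  rewrite (cone3E _ _ _ _ h0 h1 h2) => e; rewrite -[LHS]subr0 -e; zabel.
rewrite /cd2 !(htp2_loc _ _ _ ag) // !htp2_d /cd1 ag //.
rewrite /cd2; zabel.
Qed.

End Cochains.

(** * Determinant gerbes *)

Section WedgeOfExtension.
Variables (k : fieldType) (W01 W02 W12 : vectType k).
Variables (i : 'Hom(W01, W02)) (q : 'Hom(W02, W12)).
Hypotheses (ki : lker i = 0%VS) (iq : limg i = lker q) (qf : limg q = fullv).

Let m := \dim {:W01}.
Let n := \dim {:W12}.

Lemma dim_extension : (m + n = \dim {:W02})%N.
Proof.
rewrite -(limg_ker_dim q fullv) capfv -iq limg_dim_eq ?ki ?capv0 // qf.
by rewrite /m /n.
Qed.

Lemma wedge_cast (N : nat) (W : vectType k) (e : (N = \dim {:W})%N) (w : seq W) :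
  wedge w = \det (\matrix_(a < N, b < N) coord (vbasis {:W}) (cast_ord e b) w`_a).
Proof.
move: (e) => e'; subst N; rewrite /wedge; congr (\det _).
by apply/matrixP => a b; rewrite !mxE cast_ord_id.
Qed.

Let bas (c : 'I_(m + n)) : W02 :=
  match split c with inl a => i (vbasis {:W01})`_a | inr a => (q^-1)%VF (vbasis {:W12})`_a end.

Let crd (t : W02) : 'rV[k]_(m + n) :=
  row_mx (\row_a coord (vbasis {:W01}) a ((i^-1)%VF (t - (q^-1)%VF (q t))))
    (\row_a coord (vbasis {:W12}) a (q t)).

Lemma crdE t : t = \sum_c crd t 0 c *: bas c.
Proof.
rewrite big_split_ord /=.
under eq_bigr => a _ do rewrite row_mxEl mxE /bas (unsplitK (inl a)).
under [X in _ + X]eq_bigr => a _ do rewrite row_mxEr mxE /bas (unsplitK (inr a)).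
under eq_bigr => a _ do rewrite -linearZ.
under [X in _ + X]eq_bigr => a _ do rewrite -linearZ.
rewrite -!linear_sum -!(coord_vbasis (memvf _)) /= (limg_lfunVK (f := i)) ?subrK //.
by rewrite iq memv_ker linearB /= (limg_lfunVK (f := q)) ?subrr // qf memvf.
Qed.

Let MB : 'M[k]_(m + n) :=
  \matrix_(a, b) coord (vbasis {:W02}) (cast_ord dim_extension b) (bas a).

Lemma wedge_crd (w : seq W02) :
  wedge w = \det (\matrix_(a < m + n) crd w`_a) * \det MB.
Proof.
rewrite (wedge_cast dim_extension) -det_mulmx; congr (\det _).
apply/matrixP => a b; rewrite !mxE {1}(crdE w`_a) linear_sum.
by apply: eq_bigr => c _; rewrite linearZ /= !mxE.
Qed.

Lemma wedge_vbasis (W : vectType k) : wedge (vbasis {:W}) = 1.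
Proof.
rewrite /wedge -[RHS](det1 _ (\dim {:W})); congr (\det _).
apply/matrixP => a b; rewrite !mxE coord_free 1?eq_sym //.
exact: basis_free (vbasisP _).
Qed.

Lemma wedge_extension : exists2 c : k, c != 0 &
  forall (v : m.-tuple W01) (w : n.-tuple W02),
    wedge (map i v ++ w) = c * (wedge v * wedge (map q w)).
Proof.
exists (\det MB).
  apply/eqP => z; have := wedge_crd (vbasis {:W02}); rewrite z mulr0 wedge_vbasis.
  by move/eqP; rewrite oner_eq0.
move=> v w; rewrite wedge_crd mulrC; congr (_ * _).
have -> : (\matrix_(a < m + n) crd (map i v ++ w)`_a) =
    block_mx (\matrix_(a < m, b < m) coord (vbasis {:W01}) b v`_a) 0
      (\matrix_(a < n, b < m) crd w`_a 0 (lshift n b))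
      (\matrix_(a < n, b < n) coord (vbasis {:W12}) b (map q w)`_a).
  have qi x : q (i x) = 0 by apply/eqP; rewrite -memv_ker -iq memv_img // memvf.
  have Tl (a : 'I_m) : (map i v ++ w)`_(lshift n a) = i v`_a.
    by rewrite nth_cat size_map size_tuple /= ltn_ord (nth_map 0) // size_tuple ltn_ord.
  have Tr (a : 'I_n) : (map i v ++ w)`_(rshift m a) = w`_a.
    by rewrite nth_cat size_map size_tuple /= ltnNge leq_addr /= addKn.
  apply/matrixP => a b; rewrite mxE.
  case: (split_ordP a) => a' ->; case: (split_ordP b) => b' ->.
  - by rewrite Tl block_mxEul row_mxEl !mxE qi linear0 subr0 lker0_lfunK // ki.
  - by rewrite Tl block_mxEur row_mxEr !mxE qi linear0.
  - by rewrite Tr block_mxEdl mxE.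
  - by rewrite Tr block_mxEdr row_mxEr !mxE (nth_map 0) // size_tuple ltn_ord.
by rewrite det_lblock.
Qed.

End WedgeOfExtension.

(* G_m is written additively, as a group of coefficients for cochains. *)
HB.instance Definition _ (k : fieldType) := gen_eqMixin (gm k).
HB.instance Definition _ (k : fieldType) := gen_choiceMixin (gm k).

Section GmZmodule.
Variable k : fieldType.
Lemma gm_addA : associative (@gmM k). Proof. exact: (@gmulA (Gm k)). Qed.
Lemma gm_addC : commutative (@gmM k). Proof. exact: (@gmC k). Qed.
Lemma gm_add0 : left_id (gm1 k) (@gmM k). Proof. exact: (@gmul1 (Gm k)). Qed.
Lemma gm_addN : left_inverse (gm1 k) (@gmV k) (@gmM k). Proof. exact: (@gmulV (Gm k)). Qed.
End GmZmodule.
HB.instance Definition _ (k : fieldType) :=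
  GRing.isZmodule.Build (gm k) (@gm_addA k) (@gm_addC k) (@gm_add0 k) (@gm_addN k).

Lemma gm_addE (k : fieldType) (s t : gm k) : sval (s + t) = sval s * sval t.
Proof. by []. Qed.
Lemma gm_ne0 (k : fieldType) (s : gm k) : sval s != 0 :> k.
Proof. exact: (svalP s). Qed.

(** * The directed system of lattices *)

Section Edges.
Variables (C : excat) (V : ind (pro C)).

Definition latt := {L : ind (pro C) & @lat C V L}.

(** The quotient belongs to the edge because determinant and gerbel theories carry data for every
    choice of quotient; a cochain on edges is then exactly a family of such scalars. *)
Record edge (x y : latt) : Type := Edge {
  eu : hom (tag x) (tag y);
  eW : C;
  ep : hom (tag y) (const eW);
  eH : quo (tagged x) (tagged y) eu ep }.

Definition qedge L0 L1 (X0 : @lat C V L0) (X1 : @lat C V L1) (u : hom L0 L1) (W : C)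
    (p : hom L1 (const W)) (H : quo X0 X1 u p) :
  edge (existT _ L0 X0 : latt) (existT _ L1 X1 : latt) :=
  @Edge (existT _ L0 X0) (existT _ L1 X1) u W p H.

Definition edge_chain_spec (N : nat -> latt) : Prop :=
  (forall m n, (m <= n)%N -> exists e : edge (N m) (N n), True) /\
  forall x, exists n0, forall n, (n0 <= n)%N -> exists e : edge x (N n), True.

Definition tri_spec (x y z : latt) (a : edge x y) (b : edge x z) (c : edge y z)
    (iq : hom (eW a) (eW b) * hom (eW b) (eW c)) : Prop :=
  qtri (eu c) (ep a) (ep b) (ep c) iq.1 iq.2.

End Edges.
Arguments tri_spec {C V x y z} a b c iq.

Section EdgesOfSplitExact.
Variable G : gex.
Notation C := (gexcat G).
Variable V : ind (pro C).

Lemma edge_chain : is_lc V -> exists N, @edge_chain_spec C V N.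
Proof.
move=> lV; have [N [X [X1 X2]]] := lattice_chain lV.
have mk (x y : latt V) : lat_le (tagged x) (tagged y) -> exists e : edge x y, True.
  by move=> [u e]; have [W [p h]] := nested_quo e; exists (Edge h).
exists (fun n => existT _ (N n) (X n)); split.
  by move=> m n h; exact: (mk (existT _ (N m) (X m)) (existT _ (N n) (X n)) (X1 m n h)).
move=> x; have [n0 h] := X2 _ (tagged x); exists n0 => n hn.
exact: (mk x (existT _ (N n) (X n)) (h n hn)).
Qed.

Lemma tri_ex (x y z : latt V) (a : edge x y) (b : edge x z) (c : edge y z) :
  exists iq, tri_spec a b c iq.
Proof. by have [i [q h]] := qtri_ex (eH a) (eH b) (eH c); exists (i, q). Qed.

Lemma tri_uniq (x y z : latt V) (a : edge x y) (b : edge x z) (c : edge y z) iq iq' :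
  tri_spec a b c iq -> tri_spec a b c iq' -> iq = iq'.
Proof.
case: iq iq' => i q [i' q'] h h'.
by have [/= -> ->] := qtri_uniq (eH a) (eH b) h h'.
Qed.

Lemma tri_tet (x y z w : latt V) (a : edge x y) (b : edge x z) (c : edge x w)
    (d : edge y z) (e : edge y w) (f : edge z w) t012 t013 t023 t123 :
  tri_spec a b d t012 -> tri_spec a c e t013 -> tri_spec b c f t023 -> tri_spec d e f t123 ->
  [/\ t023.1 \oc t012.1 = t013.1, t123.2 \oc t013.2 = t023.2 &
      t013.2 \oc t023.1 = t123.1 \oc t012.2].
Proof. exact: (qtri_tet (eH a) (eH b) (eH c) (eH d) (eH e) (eH f)). Qed.

End EdgesOfSplitExact.

Section Lines.
Variable k : fieldType.

Lemma line_map_linear (U : vectType k) (u : U) : linear (fun t : k^o => t *: u).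
Proof. by move=> a x y; rewrite scalerDl -scalerA. Qed.

Definition line_map (U : vectType k) (u : U) : 'Hom(k^o, U) :=
  linfun (HB.pack (fun t : k^o => t *: u) (GRing.isLinear.Build _ _ _ _ _ (line_map_linear u))
    : {linear k^o -> U}).

Lemma line_mapE (U : vectType k) (u : U) t : line_map u t = t *: u.
Proof. exact: lfunE. Qed.

Variables (U : vectType k) (dU : \dim {:U} = 1%N).

Lemma line_vector : exists u : U, u != 0.
Proof.
exists (vpick {:U}); rewrite vpick0; apply/eqP => e.
by move: dU; rewrite e dimv0.
Qed.

Lemma line_scal (u x : U) : u != 0 -> exists t : k, x = t *: u.
Proof.
move=> u0; apply/vlineP; suff -> : (<[u]> = {:U})%VS by exact: memvf.
by apply/eqP; rewrite eqEdim subvf dU dim_vline u0.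
Qed.

Lemma line_scal_gm (u x : U) : u != 0 -> x != 0 -> exists t : gm k, x = sval t *: u.
Proof.
move=> u0 x0; have [t e] := line_scal x u0.
have t0 : t != 0 by apply/eqP => t0; move: x0; rewrite e t0 scale0r eqxx.
by exists (exist _ t t0).
Qed.

Lemma line_inj (u : U) (s t : k) : u != 0 -> s *: u = t *: u -> s = t.
Proof. by move=> u0 /eqP; rewrite -subr_eq0 -scalerBl scaler_eq0 (negPf u0) orbF subr_eq0 => /eqP. Qed.

Lemma line_map_inv (u : U) t : u != 0 -> ((line_map u)^-1)%VF (t *: u) = t.
Proof.
move=> u0; rewrite -line_mapE lker0_lfunK //; apply/lker0P => x y.
by rewrite !line_mapE; exact: line_inj.
Qed.

End Lines.

Section DetGerbe.
Variables (k : fieldType) (V : tate k 1).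
Notation G := (finvect_gex k).
Notation C := (finvect k).
Notation VV := (sval V : ind (pro C)).
Notation latt := (@latt C VV).
Notation edge := (@edge C VV).
Notation E := edge.

Lemma det_chain : exists N, @edge_chain_spec C VV N.
Proof. exact: (@edge_chain G VV (svalP V)). Qed.

Lemma det_tri_ex (x y z : latt) (a : edge x y) (b : edge x z) (c : edge y z) :
  exists iq, tri_spec a b c iq.
Proof. exact: (@tri_ex G VV). Qed.

Lemma det_tri_uniq (x y z : latt) (a : edge x y) (b : edge x z) (c : edge y z) iq iq' :
  tri_spec a b c iq -> tri_spec a b c iq' -> iq = iq'.
Proof. exact: (@tri_uniq G VV). Qed.

Lemma det_tri_tet (x y z w : latt) (a : edge x y) (b : edge x z) (c : edge x w)
    (d : edge y z) (e : edge y w) (f : edge z w) t012 t013 t023 t123 :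
  tri_spec a b d t012 -> tri_spec a c e t013 -> tri_spec b c f t023 -> tri_spec d e f t123 ->
  [/\ t023.1 \oc t012.1 = t013.1, t123.2 \oc t013.2 = t023.2 &
      t013.2 \oc t023.1 = t123.1 \oc t012.2].
Proof. exact: (@tri_tet G VV). Qed.

(** The scalar between the library bases of the determinants of W02 and of W01 and W12. Sequences
    with size equations replace tuples, so that [map] and [++] need no casts. *)
Definition wedge_comparison (al : @cochain2 latt E (gm k)) : Prop :=
  forall (x y z : latt) (a : edge x y) (b : edge x z) (c : edge y z)
    (i : 'Hom(eW a : vectType k, eW b : vectType k)) (q : 'Hom(eW b : vectType k, eW c : vectType k)),
  @tri_spec C VV _ _ _ a b c (i, q) ->
  forall (v : seq (eW a : vectType k)) (w : seq (eW b : vectType k)),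
    size v = \dim {:(eW a : vectType k)} -> size w = \dim {:(eW c : vectType k)} ->
    wedge (map i v ++ w) = sval (al _ _ _ a b c) * (wedge v * wedge (map q w)).

Lemma wedge_cochain : exists al, wedge_comparison al.
Proof.
have ex (t : {x : latt & {y : latt & {z : latt & (edge x y * edge x z * edge y z)%type}}}) :
    exists al : gm k, let: (a, b, c) := tagged (tagged (tagged t)) in
      forall (i : 'Hom(eW a : vectType k, eW b : vectType k)) (q : 'Hom(eW b : vectType k, eW c : vectType k)),
      @tri_spec C VV _ _ _ a b c (i, q) ->
      forall (v : seq (eW a : vectType k)) (w : seq (eW b : vectType k)),
        size v = \dim {:(eW a : vectType k)} -> size w = \dim {:(eW c : vectType k)} ->
      wedge (map i v ++ w) = sval al * (wedge v * wedge (map q w)).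
  case: t => x [y [z [[a b] c]]] /=.
  have [[i q] h] := det_tri_ex a b c.
  have [[ki iq qf] _ _] := h.
  have [al al0 alP] := wedge_extension ki iq qf.
  exists (exist _ al al0) => i' q' h' v w sv sw.
  have [-> ->] := det_tri_uniq h' h.
  exact: (alP (Tuple (introT eqP sv)) (Tuple (introT eqP sw))).
have [al alP] := dchoice ex.
exists (fun x y z a b c => al (existT _ x (existT _ y (existT _ z (a, b, c))))).
by move=> x y z a b c; exact: (alP (existT _ x (existT _ y (existT _ z (a, b, c))))).
Qed.

Lemma wedge_lift (W W' : vectType k) (q : 'Hom(W, W')) : limg q = fullv ->
  exists2 w : seq W, size w = \dim {:W'} & wedge (map q w) != 0.
Proof.
move=> qf; exists (map (q^-1)%VF (vbasis {:W'})); first by rewrite size_map size_tuple.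
rewrite -map_comp (eq_map (g := id)) ?map_id ?wedge_vbasis ?oner_eq0 // => x /=.
by rewrite limg_lfunVK // qf memvf.
Qed.

(** For a filtration of length three, the wedge of lifts of vectors of the three graded pieces is
    expanded in both orders. The vectors are chosen with nonzero wedges, so these cancel and leave
    the relation between the scalars. *)
Lemma wedge_cocycle al : wedge_comparison al ->
  forall x y z w (a : edge x y) (b : edge x z) (c : edge x w) (d : edge y z) (e : edge y w)
    (f : edge z w), cd2 al a b c d e f = 0.
Proof.
move=> alP x y z w a b c d e f.
have [[i012 q012] h012] := det_tri_ex a b d.
have [[i013 q013] h013] := det_tri_ex a c e.
have [[i023 q023] h023] := det_tri_ex b c f.
have [[i123 q123] h123] := det_tri_ex d e f.
have [/= t1 t2 t3] := det_tri_tet h012 h013 h023 h123.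
have [[_ _ qf012] _ _] := h012; have [[_ _ qf023] _ _] := h023.
have [[k123 iq123 qf123] _ _] := h123; have [[k012 iq012 _] _ _] := h012.
have [s2 ss2 s20] := wedge_lift qf012.
have [s3 ss3 s30] := wedge_lift qf023.
have [s1 ss1 s10] : exists2 v : seq (eW a : vectType k), size v = \dim {:(eW a : vectType k)} & wedge v != 0.
  by exists (vbasis {:(eW a : vectType k)}); rewrite ?size_tuple // wedge_vbasis oner_eq0.
have e1 : wedge (map i013 s1 ++ (map i023 s2 ++ s3)) =
    sval (al _ _ _ a c e) * (wedge s1 * (sval (al _ _ _ d e f) *
      (wedge (map q012 s2) * wedge (map q023 s3)))).
  rewrite (alP _ _ _ _ _ _ _ _ h013) //; last first.
    by rewrite size_cat size_map ss2 ss3 -(dim_extension k123 iq123 qf123).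
  congr (_ * (_ * _)); rewrite map_cat -map_comp.
  have -> : map (q013 \o i023) s2 = map i123 (map q012 s2).
    rewrite -map_comp; apply: eq_map => u /=.
    by have /lfunP/(_ u) := t3; rewrite /= !comp_lfunE.
  rewrite (alP _ _ _ _ _ _ _ _ h123) ?size_map //; congr (_ * (_ * wedge _)).
  rewrite -map_comp; apply: eq_map => u /=.
  by have /lfunP/(_ u) := t2; rewrite /= !comp_lfunE.
have e2 : wedge (map i013 s1 ++ (map i023 s2 ++ s3)) =
    sval (al _ _ _ b c f) * ((sval (al _ _ _ a b d) * (wedge s1 * wedge (map q012 s2)))
       * wedge (map q023 s3)).
  rewrite -(alP _ _ _ _ _ _ _ _ h012) // -(alP _ _ _ _ _ _ _ _ h023) //; last first.
    by rewrite size_cat size_map ss1 ss2 -(dim_extension k012 iq012 qf012).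
  rewrite map_cat catA; have -> : map i013 s1 = map i023 (map i012 s1) => //.
  by rewrite -map_comp; apply: eq_map => u /=; have /lfunP/(_ u) := t1; rewrite /= !comp_lfunE.
have e3 : al _ _ _ a c e + al _ _ _ d e f = al _ _ _ b c f + al _ _ _ a b d.
  apply: gm_ext; rewrite !gm_addE.
  have nz : wedge s1 * wedge (map q012 s2) * wedge (map q023 s3) != 0.
    by rewrite !mulf_neq0.
  apply: (mulIf nz); move: e1; rewrite e2 => e0.
  rewrite -!mulrA; rewrite -!mulrA in e0; rewrite e0.
  by congr (_ * _); rewrite mulrCA.
rewrite /cd2.
have -> : al _ _ _ a c e = al _ _ _ b c f + al _ _ _ a b d - al _ _ _ d e f.
  by rewrite -e3 addrK.
zabel.
Qed.

Lemma det_scalarE (W : vectType k) (t : gm k) (x : k^o) (d : Det W) :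
  (line_map (sval t *: (\1 : 'End(k^o)))%VF : 'Hom(k^o, 'Hom(Det W, k^o))) x d = x * (sval t * d).
Proof. by rewrite line_mapE !scale_lfunE id_lfunE. Qed.

(** Every line is k, and [dphi] multiplies by a 1-cochain c; the axiom [dphi_comp] becomes the
    equation dc = al. *)
Lemma dettheory_ex : exists D : dettheory V, True.
Proof.
have [al alP] := wedge_cochain.
have [N [ch1 ch2]] := det_chain.
have [c cP] := @H2_vanish latt E (gm k) N ch1 ch2 al (wedge_cocycle alP).
pose ph L0 L1 (X0 : @lat C VV L0) (X1 : @lat C VV L1) (u : hom L0 L1) (W : vectType k)
    (p : hom L1 (const (W : finvect k))) (H : quo X0 X1 u p) : 'Hom(k^o, 'Hom(Det W, k^o)) :=
  line_map (sval (c _ _ (qedge H)) *: (\1 : 'End(k^o)))%VF.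
have phE L0 L1 X0 X1 u W p H x d : @ph L0 L1 X0 X1 u W p H x d = x * (sval (c _ _ (qedge H)) * d).
  exact: det_scalarE.
suff h2 L0 L1 L2 (X0 : @lat C VV L0) (X1 : @lat C VV L1) (X2 : @lat C VV L2)
      (u01 : hom L0 L1) (u02 : hom L0 L2) (u12 : hom L1 L2) (W01 W02 W12 : vectType k)
      (p01 : hom L1 (const (W01 : finvect k))) (p02 : hom L2 (const (W02 : finvect k)))
      (p12 : hom L2 (const (W12 : finvect k)))
      (i : 'Hom(W01, W02)) (q : 'Hom(W02, W12))
      (H01 : quo X0 X1 u01 p01) (H02 : quo X0 X2 u02 p02) (H12 : quo X1 X2 u12 p12) :
    @qtri C L1 L2 u12 W01 W02 W12 p01 p02 p12 i q ->
    forall (x : k^o) (v : (\dim {:W01}).-tuple W01) (w : (\dim {:W12}).-tuple W02),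
    ph _ _ _ _ _ _ _ H12 (ph _ _ _ _ _ _ _ H01 x (wedge v)) (wedge (map q w)) =
    ph _ _ _ _ _ _ _ H02 x (wedge (map i v ++ w)).
  unshelve eexists; last by [].
  refine (@DetTheory k V (fun L X => k^o) (fun L X => _) ph _ h2).
    by rewrite dimvf.
  move=> L0 L1 X0 X1 u W p H x d x0 d0; rewrite phE.
  by rewrite !mulf_neq0 // gm_ne0.
move=> t x v w; rewrite !phE (alP _ _ _ (qedge H01) (qedge H02) (qedge H12) i q t) ?size_tuple //.
have e : c _ _ (qedge H12) + c _ _ (qedge H01) =
    c _ _ (qedge H02) + al _ _ _ (qedge H01) (qedge H02) (qedge H12).
  by rewrite -cP /cd1; zabel.
have := f_equal sval e; rewrite !gm_addE => e'.
rewrite (mulrA (sval (c _ _ (qedge H02)))) -e'.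
have ac (r m n o z : k) : r * (m * n) * (o * z) = r * (o * m * (n * z)).
  by rewrite -mulrA mulrACA (mulrC m).
exact: ac.
Qed.

(* In a basis of the lines of D, the maps [dphi] become a 1-cochain whose coboundary is
   the wedge comparison. *)
Lemma dettheory_cochain (D : dettheory V) al : wedge_comparison al ->
  exists (b : forall x : latt, dl D (tagged x)) (c : @cochain1 latt E (gm k)),
  [/\ forall x, b x != 0,
     forall x y (e : edge x y) (d : Det (eW e)),
       dphi D (eH e) (b x) d = (sval (c _ _ e) * d) *: b y &
     forall x y z (e01 : edge x y) (e02 : edge x z) (e12 : edge y z),
       cd1 c e01 e02 e12 = al _ _ _ e01 e02 e12].
Proof.
move=> alP.
have [b b0] : exists b : forall x : latt, dl D (tagged x), forall x, b x != 0.
  exact: (@dchoice latt (fun x => dl D (tagged x)) (fun _ v => v != 0)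
    (fun x => line_vector (dl1 D (tagged x)))).
have ex (t : {x : latt & {y : latt & edge x y}}) : exists s : gm k,
    dphi D (eH (tagged (tagged t))) (b (tag t)) (1 : k^o) = sval s *: b (tag (tagged t)).
  case: t => x [y e] /=.
  apply: (line_scal_gm (dl1 D _) (b0 y)).
  exact: (@dphi_iso k V D _ _ _ _ _ _ _ (eH e) (b x) (1 : k^o) (b0 x) (oner_neq0 k)).
have [c0 c0P] := dchoice ex.
pose c : @cochain1 latt E (gm k) := fun x y e => c0 (existT _ x (existT _ y e)).
have cP x y (e : edge x y) (d : Det (eW e)) :
    dphi D (eH e) (b x) d = (sval (c _ _ e) * d) *: b y.
  have dE : d = (d : k) *: (1 : k^o) by exact: esym (mulr1 (d : k)).
  have e0 : dphi D (eH e) (b x) (1 : k^o) = sval (c _ _ e) *: b y.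
    exact: (c0P (existT _ x (existT _ y e))).
  transitivity ((d : k) *: dphi D (eH e) (b x) (1 : k^o)).
    by rewrite [in LHS]dE; exact: linearZ.
  rewrite e0 scalerA.
  by rewrite (mulrC (d : k)).
exists b, c; split=> // x y z a bb cc.
have [[i q] h] := det_tri_ex a bb cc.
have [[_ _ qf] _ _] := h.
have [s ss s0] := wedge_lift qf.
have tv : size (vbasis {:(eW a : vectType k)}) = \dim {:(eW a : vectType k)} by rewrite size_tuple.
have := @dphi_comp k V D _ _ _ _ _ _ _ _ _ _ _ _ _ _ _ i q
  (eH a) (eH bb) (eH cc) h (b x) (Tuple (introT eqP tv)) (Tuple (introT eqP ss)).
rewrite (alP _ _ _ a bb cc i q h) // wedge_vbasis mul1r cP linearZ /= scale_lfunE.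
rewrite cP cP scalerA => /(line_inj (b0 z)) e.
have e' : c _ _ a + c _ _ cc = c _ _ bb + al _ _ _ a bb cc.
  apply: gm_ext; apply: (mulIf s0); rewrite !gm_addE.
  by move: e; rewrite mulr1 !mulrA.
by rewrite /cd1 -[al _ _ _ _ _ _](addKr (c _ _ bb)) -e'; zabel.
Qed.

(** Existence, connectedness and the computation of automorphisms are the vanishing in degrees 2, 1
    and 0. *)
Lemma det_gerbe_gerbe : is_gerbe (det_gerbe V).
Proof.
have [al alP] := wedge_cochain.
have [N [ch1 ch2]] := det_chain.
split.
- by have [D _] := dettheory_ex; exact: (inhabits (D : det_gerbe V)).
- move=> D D'.
  have [b [c [b0 cP cd]]] := dettheory_cochain D alP.
  have [b' [c' [b'0 c'P cd']]] := dettheory_cochain D' alP.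
  (* Both structure cochains bound the wedge comparison, so their difference is a cocycle. Its
     primitive gives the scalars by which the basis vectors of the lines are to be matched. *)
  have [|f fP] := @H1_vanish latt E (gm k) N ch1 ch2 (fun x y e => c' x y e - c x y e).
    move=> x y z e01 e02 e12; have := cd' _ _ _ e01 e02 e12; rewrite -(cd _ _ _ e01 e02 e12).
    by rewrite /cd1 => /eqP; rewrite -subr_eq0 => /eqP e; rewrite -[RHS]e; zabel.
  pose mor L (X : @lat C VV L) : 'Hom(dl D X, dl D' X) :=
    let x := existT _ L X : latt in
    (sval (f x) *: (line_map (b' x) \o (line_map (b x))^-1))%VF.
  have morE (x : latt) t : mor _ (tagged x) (t *: b x) = (sval (f x) * t) *: b' x.
    case: x t => L X t /=; rewrite /mor /= scale_lfunE comp_lfunE.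
    by rewrite (line_map_inv t (b0 (existT _ L X))) line_mapE scalerA.
  have mor_iso L (X : @lat C VV L) : lker (mor L X) = 0%VS.
    pose x := existT _ L X : latt.
    apply/eqP/lker0P => u v.
    have [s ->] := line_scal (dl1 D X) u (b0 x); have [t ->] := line_scal (dl1 D X) v (b0 x).
    rewrite !(morE x) => /(line_inj (b'0 x)) e.
    by rewrite (mulfI (gm_ne0 (f x)) e).
  have mor_phi (x y : latt) (e : edge x y) (v : dl D (tagged x)) d :
      mor _ (tagged y) (dphi D (eH e) v d) = dphi D' (eH e) (mor _ (tagged x) v) d.
    have [t ->] := line_scal (dl1 D _) v (b0 x).
    have sc (F : dettheory V) (w : dl F (tagged x)) : dphi F (eH e) (t *: w) d = t *: dphi F (eH e) w d.
      by rewrite linearZ; exact: scale_lfunE.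
    rewrite sc cP scalerA !morE.
    have -> : dphi D' (eH e) ((sval (f x) * t) *: b' x) d = ((sval (f x) * t) * (sval (c' _ _ e) * d)) *: b' y.
      by rewrite linearZ; apply: etrans (scale_lfunE _ _ _) _; rewrite c'P scalerA.
    have e1 : f y + c _ _ e = f x + c' _ _ e.
      have <- : f y - f x + (f x + c _ _ e) = f y + c _ _ e by zabel.
      by rewrite [f y - f x](fP x y e); zabel.
    have := f_equal sval e1; rewrite !gm_addE => e2.
    have ac (m n o r : k) : m * (n * (o * r)) = (m * o) * (n * r).
      by rewrite mulrCA (mulrA m) mulrCA.
    have ac' (m n o r : k) : m * n * (o * r) = (m * o) * (n * r) by rewrite mulrACA.
    by congr (_ *: _); rewrite ac e2 ac'.
  exact: (inhabits (@DetMor k V D D' mor mor_iso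
    (fun _ _ _ _ _ _ _ H => mor_phi _ _ (qedge H)))).
- move=> D f.
  have [b [c [b0 cP _]]] := dettheory_cochain D alP.
  have fsc (x : latt) (s : k) (v : dl D (tagged x)) : dmor f (tagged x) (s *: v) = s *: dmor f (tagged x) v.
    exact: linearZ.
  have [t tP] : exists t : latt -> gm k, forall x, dmor f (tagged x) (b x) = sval (t x) *: b x.
    apply: (@dchoice latt (fun=> gm k) (fun x t => dmor f (tagged x) (b x) = sval t *: b x)) => x.
    apply: (line_scal_gm (dl1 D _) (b0 x)).
    have /eqP/lker0P inj := dmor_iso f (tagged x).
    by apply: contra_neq (b0 x) => e; apply: inj; rewrite e linear0.
  have tN x : t x = t (N 0%N).
    apply: (@H0_vanish latt E (gm k) N ch1 ch2 t) => y z e.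
    have sc (w : dl D (tagged y)) (s : k) d : dphi D (eH e) (s *: w) d = s *: dphi D (eH e) w d.
      by rewrite linearZ; exact: scale_lfunE.
    have := dmor_phi f (eH e) (b y) (1 : k^o).
    rewrite tP sc !cP fsc tP !scalerA => /(line_inj (b0 z)) e1.
    apply/eqP; rewrite subr_eq0; apply/eqP/gm_ext.
    apply: (mulfI (mulf_neq0 (gm_ne0 (c _ _ e)) (oner_neq0 k))).
    by rewrite [LHS]e1 mulrC.
  exists (t (N 0%N)); split.
    apply: detmor_ext => L X v /=; pose x := existT _ L X : latt.
    have [s ->] := line_scal (dl1 D X) v (b0 x).
    have tx : dmor f X (b x) = sval (t (N 0%N)) *: b x by rewrite -(tN x); exact: tP x.
    by rewrite scale_lfunE id_lfunE (fsc x) tx !scalerA mulrC.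
  move=> s e; apply: gm_ext; apply: (line_inj (b0 (N 0%N))).
  by apply: etrans (esym (tP _)) _; rewrite -e /= scale_lfunE id_lfunE.
Qed.

End DetGerbe.

(** * Gerbes and charges *)

Section Charges.
Variable k : fieldType.
Implicit Types G H : gpd k.

(* A charge is an equivalence of G with the trivial gerbe. *)
Record charge G : Type := Charge {
  chi : forall a b : G, hom a b -> gm k;
  chi_comp : forall (a b c : G) (f : hom b c) (g : hom a b), chi (f \oc g) = chi f + chi g;
  chi_scal : forall t (a : G), chi (scal t a) = t;
  chi_inj : forall (a b : G) (f g : hom a b), chi f = chi g -> f = g;
  chi_surj : forall (a b : G) t, {f : hom a b | chi f = t};
  cbase : G }.
Arguments chi {G} _ {a b} f.
Arguments chi_inj {G} _ {a b f g} _.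

(** Isomorphisms j a from a base object a0 to each object a are chosen; conjugating f by them gives
    an automorphism of a0, that is, a scalar. *)
Lemma gerbe_charge G : is_gerbe G -> charge G.
Proof.
move=> [nG cG aG]; have [a0 _] : {a : G | True} by apply: cid; case: nG => a; exists a.
have pj (a : G) : {j : hom a0 a & {j' : hom a a0 | j' \oc j = idm a0 /\ j \oc j' = idm a}}.
  have [j _] : {j : hom a0 a | True} by apply: cid; case: (cG a0 a) => j; exists j.
  by exists j; apply: cid; exact: gpd_iso.
pose j a := tag (pj a); pose j' a := sval (tagged (pj a)).
have j1 a : j' a \oc j a = idm a0 := proj1 (svalP (tagged (pj a))).
have j2 a : j a \oc j' a = idm a := proj2 (svalP (tagged (pj a))).
clearbody j j'.
have pt (f : hom a0 a0) : {t : gm k | scal t a0 = f}.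
  by apply: cid; have [t [e _]] := aG a0 f; exists t.
have scal_inj (s t : gm k) : scal s a0 = scal t a0 -> s = t.
  by move=> e; have [u [_ h]] := aG a0 (scal t a0); rewrite -(h s e) -(h t erefl).
pose ch (a b : G) (f : hom a b) : gm k := sval (pt (j' b \oc f \oc j a)).
have chE (a b : G) (f : hom a b) : scal (ch a b f) a0 = j' b \oc f \oc j a.
  exact: svalP (pt _).
have chE' (a b : G) (f : hom a b) : f = j b \oc scal (ch a b f) a0 \oc j' a.
  by rewrite chE -!compA j2 compm1 compA j2 comp1m.
clearbody ch.
unshelve refine (@Charge G ch _ _ _ _ a0).
- move=> a b c f g; apply: scal_inj; rewrite (scalM (ch b c f) (ch a b g)) !chE.
  by rewrite -!compA (compA (j b)) j2 comp1m.
- move=> t a; apply: scal_inj; rewrite chE -compA scal_nat compA j1 comp1m //.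
- by move=> a b f g e; rewrite (chE' _ _ f) (chE' _ _ g) e.
- move=> a b t; exists (j b \oc scal t a0 \oc j' a); apply: scal_inj.
  by rewrite chE -!compA j1 compm1 compA j1 comp1m.
Qed.

Section Charge.
Variables (G : gpd k) (c : charge G).

Lemma chi_id (a : G) : chi c (idm a) = 0.
Proof. by rewrite -(scal1 a) chi_scal. Qed.

Definition cmor (a b : G) t : hom a b := sval (chi_surj c a b t).
Lemma chi_mor a b t : chi c (cmor a b t) = t.
Proof. by rewrite /cmor; case: (chi_surj c a b t). Qed.

Lemma charge_gerbe : is_gerbe G.
Proof.
split; first exact: inhabits (cbase c).
- by move=> a b; exact: inhabits (cmor a b 0).
- move=> a f; exists (chi c f); split; first by apply: (chi_inj c); rewrite chi_scal.
  by move=> t <-; rewrite chi_scal.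
Qed.

End Charge.

Section Functors.
Variables (G H : gpd k) (cG : charge G) (cH : charge H).

(** The charges on G and H are unrelated to F, so F preserves them only up to a coboundary. Its
    primitive at a is the charge of the image of the chosen morphism from the base object to a. *)
Lemma defect_ex (F : gfun G H) : {n : G -> gm k |
  forall (a b : G) (f : hom a b), chi cH (fmap F f) = n b + chi cG f - n a}.
Proof.
pose j a := cmor cG (cbase cG) a 0.
exists (fun a => chi cH (fmap F (j a))) => a b f.
have e : f \oc j a = j b \oc scal (chi cG f) (cbase cG).
  by apply: (chi_inj cG); rewrite !chi_comp chi_scal !chi_mor; zabel.
have := f_equal (fun x => chi cH (fmap F x)) e.
rewrite !fmap_comp !chi_comp fmap_scal chi_scal => <-.
zabel.
Qed.

Definition defect (F : gfun G H) : G -> gm k := sval (defect_ex F).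
Lemma chi_fmap (F : gfun G H) (a b : G) (f : hom a b) :
  chi cH (fmap F f) = defect F b + chi cG f - defect F a.
Proof. exact: (svalP (defect_ex F) a b f). Qed.

(** The defect formula is affine in the charge of f, hence invertible on every set of morphisms. *)
Lemma gfun_equiv (F : gfun G H) : is_equiv F.
Proof.
split; last by move=> b; exists (cbase cG); exact: inhabits (cmor cH _ _ 0).
move=> a b; exists (fun g => cmor cG a b (chi cH g + defect F a - defect F b)) => f.
  by apply: (chi_inj cG); rewrite chi_mor chi_fmap; zabel.
by apply: (chi_inj cH); rewrite chi_fmap chi_mor; zabel.
Qed.

Definition charge_functor (o : G -> H) : gfun G H.
refine (@GFun k G H o (fun a b f => cmor cH (o a) (o b) (chi cG f)) _ _ _).
- by move=> a; apply: (chi_inj cH); rewrite chi_mor !chi_id.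
- by move=> a b c f g; apply: (chi_inj cH); rewrite !(chi_comp, chi_mor).
- by move=> t a; apply: (chi_inj cH); rewrite chi_mor !chi_scal.
Defined.

Lemma chi_charge_functor o (a b : G) (f : hom a b) : chi cH (fmap (charge_functor o) f) = chi cG f.
Proof. exact: chi_mor. Qed.

End Functors.

Section Tensor.
Variables (A B : gpd k) (cA : charge A) (cB : charge B).

(** A representative pair is chosen; the sum of charges is invariant under the antidiagonal
    action. *)
Definition tchi (x y : gtens A B) (P : hom x y) : gm k :=
  let p := sval (cid (tensP2 P)) in chi cA p.1 + chi cB p.2.

Lemma tchiE (x y : gtens A B) (f : hom x.1 y.1) (g : hom x.2 y.2) :
  @tchi x y (tens f g) = chi cA f + chi cB g.
Proof.
rewrite /tchi; case: (cid _) => -[f' g'] /= e.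
have [t [-> ->]] := tens_inj e; rewrite !chi_comp !chi_scal; zabel.
Qed.

Definition tensor_charge : charge (gtens A B).
unshelve refine (@Charge (gtens A B) tchi _ _ _ _ (cbase cA, cbase cB)).
- move=> x y z P Q; have [f [g ->]] := tensP P; have [f' [g' ->]] := tensP Q.
  by rewrite [_ \oc _]thom_compE !tchiE !chi_comp; zabel.
- by move=> t a; rewrite tchiE chi_scal chi_id addr0.
- move=> x y P Q; have [f [g ->]] := tensP P; have [f' [g' ->]] := tensP Q.
  rewrite !tchiE => e; pose t := chi cA f - chi cA f'.
  have -> : f = scal t _ \oc f'.
    by apply: (chi_inj cA); rewrite chi_comp chi_scal /t; zabel.
  rewrite tens_scal; congr (tens _ _); apply: (chi_inj cB).
  have -> : chi cB g' = chi cA f' + chi cB g' - chi cA f' by zabel.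
  by rewrite chi_comp chi_scal /t -e; zabel.
- move=> x y t; exists (tens (cmor cA x.1 y.1 t) (cmor cB x.2 y.2 0)).
  by rewrite tchiE !chi_mor addr0.
Defined.

Variables (G : gpd k) (cG : charge G) (F : gfun (gtens A B) G).

Definition bdefect (a : A) (b : B) : gm k := defect tensor_charge cG F (a, b).

Lemma chi_bmap (a a' : A) (b b' : B) (f : hom a a') (g : hom b b') :
  chi cG (bmap F f g) = bdefect a' b' + (chi cA f + chi cB g) - bdefect a b.
Proof.
rewrite /bmap (chi_fmap tensor_charge) /bdefect; congr (_ + _ - _).
exact: (@tchiE (a, b) (a', b')).
Qed.

End Tensor.

Definition bgm_charge : charge (bgm k).
unshelve refine (@Charge (bgm k) (fun _ _ f => f) _ _ _ _ tt) => //.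
by move=> a b t; exists t.
Defined.

End Charges.
Arguments chi {k G} _ {a b} f.
Arguments chi_inj {k G} _ {a b f g} _.

(** * The 2-groupoid of gerbel theories *)

(** A consequence of a single equation is reduced to an identity of abelian groups, which [zabel]
    decides. *)
Lemma eq_of_sub (K : zmodType) (a b c d : K) : a = b -> c - d = a - b -> c = d.
Proof. by move=> ->; rewrite subrr => /eqP; rewrite subr_eq0 => /eqP. Qed.

Section GerbelCharges.
Variables (k : fieldType) (M : detmult k) (V : tate k 2).
Notation C := (tate k 1).
Notation DD := (@det_gerbe k).
Notation VV := (sval V : ind (pro C)).
Notation latt := (@latt C VV).
Notation edge := (@edge C VV).
Notation E := edge.

Lemma gerbel_chain : exists N, @edge_chain_spec C VV N.
Proof. exact: (@edge_chain (tate1_gex k) VV (svalP V)). Qed.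

Lemma gerbel_tri_ex (x y z : latt) (a : edge x y) (b : edge x z) (c : edge y z) :
  exists iq, tri_spec a b c iq.
Proof. exact: (@tri_ex (tate1_gex k) VV). Qed.

Lemma gerbel_tri_uniq (x y z : latt) (a : edge x y) (b : edge x z) (c : edge y z) iq iq' :
  tri_spec a b c iq -> tri_spec a b c iq' -> iq = iq'.
Proof. exact: (@tri_uniq (tate1_gex k) VV). Qed.

Lemma gerbel_tet (x y z w : latt) (a : edge x y) (b : edge x z) (c : edge x w)
    (d : edge y z) (e : edge y w) (f : edge z w) t012 t013 t023 t123 :
  tri_spec a b d t012 -> tri_spec a c e t013 -> tri_spec b c f t023 -> tri_spec d e f t123 ->
  @tet k (eW a) (eW b) (eW c) (eW d) (eW e) (eW f)
    t012.1 t012.2 t013.1 t013.2 t023.1 t023.2 t123.1 t123.2.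
Proof. exact: (@tri_tet (tate1_gex k) VV). Qed.

Definition dcharge (W : C) : charge (DD W) := gerbe_charge (det_gerbe_gerbe W).

Definition ddefect (A B W : C) (i : hom A B) (p : hom B W) (s : ses i p) : DD A -> DD W -> gm k :=
  bdefect (dcharge A) (dcharge W) (dcharge B) (dm M s).

Lemma chi_dm (A B W : C) (i : hom A B) (p : hom B W) (s : ses i p) (a a' : DD A) (b b' : DD W)
    (f : hom a a') (g : hom b b') :
  chi (dcharge B) (bmap (dm M s) f g) =
  ddefect s a' b' + (chi (dcharge A) f + chi (dcharge W) g) - ddefect s a b.
Proof. exact: chi_bmap. Qed.

(* By naturality, the charge of [da] corrected by the defects of [dm] does not depend on
   the objects. *)
Lemma da_charge (A01 A02 A03 A12 A13 A23 : C)
    (i012 : hom A01 A02) (p012 : hom A02 A12) (i013 : hom A01 A03) (p013 : hom A03 A13)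
    (i023 : hom A02 A03) (p023 : hom A03 A23) (i123 : hom A12 A13) (p123 : hom A13 A23)
    (s012 : ses i012 p012) (s013 : ses i013 p013) (s023 : ses i023 p023) (s123 : ses i123 p123)
    (t : tet i012 p012 i013 p013 i023 p023 i123 p123) :
  exists al : gm k, forall (a : DD A01) (b : DD A12) (c : DD A23),
    chi (dcharge A03) (da M s012 s013 s023 s123 t a b c) =
    al + (ddefect s013 a (bob (dm M s123) b c) + ddefect s123 b c)
       - (ddefect s023 (bob (dm M s012) a b) c + ddefect s012 a b).
Proof.
pose r a b c := chi (dcharge A03) (da M s012 s013 s023 s123 t a b c)
  - (ddefect s013 a (bob (dm M s123) b c) + ddefect s123 b c)
  + (ddefect s023 (bob (dm M s012) a b) c + ddefect s012 a b).
suff rE a b c a' b' c' : r a b c = r a' b' c'.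
  exists (r (cbase (dcharge A01)) (cbase (dcharge A12)) (cbase (dcharge A23))) => a b c.
  by rewrite (rE _ _ _ a b c) /r; zabel.
pose f := cmor (dcharge A01) a a' 0; pose g := cmor (dcharge A12) b b' 0.
pose h := cmor (dcharge A23) c c' 0.
have := f_equal (chi (dcharge A03)) (da_nat M s012 s013 s023 s123 t f g h).
rewrite !chi_comp !chi_dm !chi_mor /r => /esym e.
apply: (eq_of_sub e); zabel.
Qed.

Definition assoc_spec (al : @cochain3 latt E (gm k)) : Prop :=
  forall (x y z w : latt) (e01 : edge x y) (e02 : edge x z) (e03 : edge x w)
    (e12 : edge y z) (e13 : edge y w) (e23 : edge z w) t012 t013 t023 t123,
  tri_spec e01 e02 e12 t012 -> tri_spec e01 e03 e13 t013 ->
  tri_spec e02 e03 e23 t023 -> tri_spec e12 e13 e23 t123 ->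
  forall (s012 : ses t012.1 t012.2) (s013 : ses t013.1 t013.2)
    (s023 : ses t023.1 t023.2) (s123 : ses t123.1 t123.2)
    (t : @tet k (eW e01) (eW e02) (eW e03) (eW e12) (eW e13) (eW e23)
      t012.1 t012.2 t013.1 t013.2 t023.1 t023.2 t123.1 t123.2)
    (a : DD (eW e01)) (b : DD (eW e12)) (c : DD (eW e23)),
    chi (dcharge (eW e03)) (da M s012 s013 s023 s123 t a b c) =
    al _ _ _ _ e01 e02 e03 e12 e13 e23
       + (ddefect s013 a (bob (dm M s123) b c) + ddefect s123 b c)
       - (ddefect s023 (bob (dm M s012) a b) c + ddefect s012 a b).

(** Packs all vertices and edges of a simplex into one index, for a single application of choice. *)
Record tetrahedron : Type := Tetrahedron {
  tx : latt; ty : latt; tz : latt; tw : latt;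
  t01 : edge tx ty; t02 : edge tx tz; t03 : edge tx tw;
  t12 : edge ty tz; t13 : edge ty tw; t23 : edge tz tw }.

Lemma assoc_cochain : exists al, assoc_spec al.
Proof.
suff ex (T : tetrahedron) : exists al : gm k, forall t012 t013 t023 t123,
  tri_spec (t01 T) (t02 T) (t12 T) t012 -> tri_spec (t01 T) (t03 T) (t13 T) t013 ->
  tri_spec (t02 T) (t03 T) (t23 T) t023 -> tri_spec (t12 T) (t13 T) (t23 T) t123 ->
  forall (s012 : ses t012.1 t012.2) (s013 : ses t013.1 t013.2)
    (s023 : ses t023.1 t023.2) (s123 : ses t123.1 t123.2)
    (t : @tet k (eW (t01 T)) (eW (t02 T)) (eW (t03 T)) (eW (t12 T)) (eW (t13 T)) (eW (t23 T))
      t012.1 t012.2 t013.1 t013.2 t023.1 t023.2 t123.1 t123.2)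
    (a : DD (eW (t01 T))) (b : DD (eW (t12 T))) (c : DD (eW (t23 T))),
    chi (dcharge (eW (t03 T))) (da M s012 s013 s023 s123 t a b c) =
    al + (ddefect s013 a (bob (dm M s123) b c) + ddefect s123 b c)
       - (ddefect s023 (bob (dm M s012) a b) c + ddefect s012 a b).
  have [al alP] := dchoice ex.
  exists (fun x y z w e01 e02 e03 e12 e13 e23 => al (Tetrahedron e01 e02 e03 e12 e13 e23)).
  by move=> x y z w e01 e02 e03 e12 e13 e23; exact: (alP (Tetrahedron e01 e02 e03 e12 e13 e23)).
have [u012 h012] := gerbel_tri_ex (t01 T) (t02 T) (t12 T).
have [u013 h013] := gerbel_tri_ex (t01 T) (t03 T) (t13 T).
have [u023 h023] := gerbel_tri_ex (t02 T) (t03 T) (t23 T).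
have [u123 h123] := gerbel_tri_ex (t12 T) (t13 T) (t23 T).
have [s012 _ _] := h012; have [s013 _ _] := h013.
have [s023 _ _] := h023; have [s123 _ _] := h123.
have t := gerbel_tet h012 h013 h023 h123.
have [al alP] := da_charge s012 s013 s023 s123 t.
exists al => v012 v013 v023 v123 g012 g013 g023 g123.
have e012 := gerbel_tri_uniq g012 h012; have e013 := gerbel_tri_uniq g013 h013.
have e023 := gerbel_tri_uniq g023 h023; have e123 := gerbel_tri_uniq g123 h123.
subst v012 v013 v023 v123 => r012 r013 r023 r123 r.
rewrite (Prop_irrelevance r012 s012) (Prop_irrelevance r013 s013).
rewrite (Prop_irrelevance r023 s023) (Prop_irrelevance r123 s123) (Prop_irrelevance r t).
exact: alP.
Qed.

(** The pentagon [da_cube] evaluated in charges at base objects: the five associativity constraints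
    give the five faces and all defects cancel. *)
Lemma assoc_cocycle al : assoc_spec al -> cocycle3 al.
Proof.
move=> alP x0 x1 x2 x3 x4 e01 e02 e03 e04 e12 e13 e14 e23 e24 e34.
have [u012 h012] := gerbel_tri_ex e01 e02 e12; have [u013 h013] := gerbel_tri_ex e01 e03 e13.
have [u014 h014] := gerbel_tri_ex e01 e04 e14; have [u023 h023] := gerbel_tri_ex e02 e03 e23.
have [u024 h024] := gerbel_tri_ex e02 e04 e24; have [u034 h034] := gerbel_tri_ex e03 e04 e34.
have [u123 h123] := gerbel_tri_ex e12 e13 e23; have [u124 h124] := gerbel_tri_ex e12 e14 e24.
have [u134 h134] := gerbel_tri_ex e13 e14 e34; have [u234 h234] := gerbel_tri_ex e23 e24 e34.
have [s012 _ _] := h012; have [s013 _ _] := h013; have [s014 _ _] := h014.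
have [s023 _ _] := h023; have [s024 _ _] := h024; have [s034 _ _] := h034.
have [s123 _ _] := h123; have [s124 _ _] := h124; have [s134 _ _] := h134.
have [s234 _ _] := h234.
have t0123 := gerbel_tet h012 h013 h023 h123; have t0124 := gerbel_tet h012 h014 h024 h124.
have t0134 := gerbel_tet h013 h014 h034 h134; have t0234 := gerbel_tet h023 h024 h034 h234.
have t1234 := gerbel_tet h123 h124 h134 h234.
pose a := cbase (dcharge (eW e01)); pose b := cbase (dcharge (eW e12)).
pose c := cbase (dcharge (eW e23)); pose d := cbase (dcharge (eW e34)).
have := f_equal (chi (dcharge (eW e04))) (@da_cube k M _ _ _ _ _ _ _ _ _ _ _ _ _ _ _ _ _ _ _ _
  _ _ _ _ _ _ _ _ _ _ s012 s013 s014 s023 s024 s034 s123 s124 s134 s234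
  t0123 t0124 t0134 t0234 t1234 a b c d).
rewrite !chi_comp !chi_dm !chi_id.
rewrite (alP _ _ _ _ _ _ _ _ _ _ _ _ _ _ h012 h013 h023 h123).
rewrite (alP _ _ _ _ _ _ _ _ _ _ _ _ _ _ h012 h014 h024 h124).
rewrite (alP _ _ _ _ _ _ _ _ _ _ _ _ _ _ h013 h014 h034 h134).
rewrite (alP _ _ _ _ _ _ _ _ _ _ _ _ _ _ h023 h024 h034 h234).
rewrite (alP _ _ _ _ _ _ _ _ _ _ _ _ _ _ h123 h124 h134 h234).
by move=> e; apply: (eq_of_sub e); zabel.
Qed.

Definition gcharge (D : gerbel M V) (x : latt) : charge (gob D (tagged x)) :=
  gerbe_charge (gob_gerbe D (tagged x)).

Definition gdefect (D : gerbel M V) (x y : latt) (e : edge x y) :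
    gob D (tagged x) -> DD (eW e) -> gm k :=
  bdefect (gcharge D x) (dcharge (eW e)) (gcharge D y) (gphi D (eH e)).

Lemma chi_gphi (D : gerbel M V) (x y : latt) (e : edge x y) (u u' : gob D (tagged x))
    (a a' : DD (eW e)) (f : hom u u') (g : hom a a') :
  chi (gcharge D y) (bmap (gphi D (eH e)) f g) =
  gdefect u' a' + (chi (gcharge D x) f + chi (dcharge (eW e)) g) - gdefect u a.
Proof. exact: chi_bmap. Qed.

Definition gnat_spec (D : gerbel M V) (be : @cochain2 latt E (gm k)) : Prop :=
  forall (x y z : latt) (e01 : edge x y) (e02 : edge x z) (e12 : edge y z) iq
    (t : tri_spec e01 e02 e12 iq) (s : ses iq.1 iq.2)
    (u : gob D (tagged x)) (a : DD (eW e01)) (b : DD (eW e12)),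
  chi (gcharge D z) (gnat D (eH e01) (eH e02) (eH e12) s t u a b) =
    be _ _ _ e01 e02 e12 + (gdefect u (bob (dm M s) a b) + ddefect s a b)
      - (gdefect (bob (gphi D (eH e01)) u a) b + gdefect u a).

(** Naturality with respect to morphisms of charge 0 between any two triples of objects shows that
    the corrected charge is constant. *)
Lemma gnat_charge (D : gerbel M V) (x y z : latt) (e01 : edge x y) (e02 : edge x z)
    (e12 : edge y z) iq (t : tri_spec e01 e02 e12 iq) (s : ses iq.1 iq.2) :
  exists be : gm k, forall (u : gob D (tagged x)) (a : DD (eW e01)) (b : DD (eW e12)),
  chi (gcharge D z) (gnat D (eH e01) (eH e02) (eH e12) s t u a b) =
    be + (gdefect u (bob (dm M s) a b) + ddefect s a b)
      - (gdefect (bob (gphi D (eH e01)) u a) b + gdefect u a).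
Proof.
pose r u a b := chi (gcharge D z) (gnat D (eH e01) (eH e02) (eH e12) s t u a b)
  - (gdefect u (bob (dm M s) a b) + ddefect s a b)
  + (gdefect (bob (gphi D (eH e01)) u a) b + gdefect u a).
suff rE u a b u' a' b' : r u a b = r u' a' b'.
  exists (r (cbase (gcharge D x)) (cbase (dcharge (eW e01))) (cbase (dcharge (eW e12)))) => u a b.
  by rewrite (rE _ _ _ u a b) /r; zabel.
pose f := cmor (gcharge D x) u u' 0; pose g := cmor (dcharge (eW e01)) a a' 0.
pose h := cmor (dcharge (eW e12)) b b' 0.
have := f_equal (chi (gcharge D z)) (gnat_nat (eH e01) (eH e02) (eH e12) s t f g h).
rewrite !chi_comp !chi_gphi !chi_dm !chi_mor /r => /esym e.
by apply: (eq_of_sub e); zabel.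
Qed.

Record triangle : Type := Triangle {
  rx : latt; ry : latt; rz : latt; r01 : edge rx ry; r02 : edge rx rz; r12 : edge ry rz }.

Lemma gnat_cochain (D : gerbel M V) : exists be, gnat_spec D be.
Proof.
suff ex (T : triangle) : exists be : gm k, forall iq
    (t : tri_spec (r01 T) (r02 T) (r12 T) iq) (s : ses iq.1 iq.2)
    (u : gob D (tagged (rx T))) (a : DD (eW (r01 T))) (b : DD (eW (r12 T))),
  chi (gcharge D (rz T)) (gnat D (eH (r01 T)) (eH (r02 T)) (eH (r12 T)) s t u a b) =
    be + (gdefect u (bob (dm M s) a b) + ddefect s a b)
      - (gdefect (bob (gphi D (eH (r01 T))) u a) b + gdefect u a).
  have [be beP] := dchoice ex.
  exists (fun x y z e01 e02 e12 => be (Triangle e01 e02 e12)).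
  by move=> x y z e01 e02 e12; exact: (beP (Triangle e01 e02 e12)).
have [iq h] := gerbel_tri_ex (r01 T) (r02 T) (r12 T).
have [s _ _] := h; have [be beP] := gnat_charge D h s.
exists be => iq' h'; have e := gerbel_tri_uniq h' h; subst iq' => s'.
by rewrite (Prop_irrelevance s' s) (Prop_irrelevance h' h); exact: beP.
Qed.

(** In [gcube] the associativity constraint contributes al and the four transformations [gnat]
    contribute the faces of the simplex; the defects cancel. *)
Lemma gnat_coboundary al D be : assoc_spec al -> gnat_spec D be ->
  forall x y z w (e01 : edge x y) (e02 : edge x z) (e03 : edge x w)
    (e12 : edge y z) (e13 : edge y w) (e23 : edge z w),
  cd2 be e01 e02 e03 e12 e13 e23 = al _ _ _ _ e01 e02 e03 e12 e13 e23.
Proof.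
move=> alP beP x y z w e01 e02 e03 e12 e13 e23.
have [u012 h012] := gerbel_tri_ex e01 e02 e12; have [u013 h013] := gerbel_tri_ex e01 e03 e13.
have [u023 h023] := gerbel_tri_ex e02 e03 e23; have [u123 h123] := gerbel_tri_ex e12 e13 e23.
have [s012 _ _] := h012; have [s013 _ _] := h013.
have [s023 _ _] := h023; have [s123 _ _] := h123.
have t := gerbel_tet h012 h013 h023 h123.
have := f_equal (chi (gcharge D w)) (gcube (eH e01) (eH e02) (eH e03) (eH e12) (eH e13) (eH e23)
  s012 s013 s023 s123 h012 h013 h023 h123 t
  (cbase (gcharge D x)) (cbase (dcharge (eW e01))) (cbase (dcharge (eW e12)))
  (cbase (dcharge (eW e23)))).
rewrite !chi_comp !chi_gphi !chi_id.
rewrite (alP _ _ _ _ _ _ _ _ _ _ _ _ _ _ h012 h013 h023 h123).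
rewrite (beP _ _ _ _ _ _ _ h012) (beP _ _ _ _ _ _ _ h013).
rewrite (beP _ _ _ _ _ _ _ h023) (beP _ _ _ _ _ _ _ h123) /cd2 => /esym e.
by apply: (eq_of_sub e); zabel.
Qed.

Section Arrows.
Variables D D' : gerbel M V.

Definition fdefect (f : garr D D') (x : latt) : gob D (tagged x) -> gm k :=
  defect (gcharge D x) (gcharge D' x) (af f (tagged x)).

Lemma chi_af (f : garr D D') (x : latt) (u u' : gob D (tagged x)) (h : hom u u') :
  chi (gcharge D' x) (fmap (af f (tagged x)) h) =
  fdefect f u' + chi (gcharge D x) h - fdefect f u.
Proof. exact: chi_fmap. Qed.

Definition ac_spec (f : garr D D') (ga : @cochain1 latt E (gm k)) : Prop :=
  forall (x y : latt) (e : edge x y) (u : gob D (tagged x)) (a : DD (eW e)),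
  chi (gcharge D' y) (ac f (eH e) u a) =
    ga _ _ e + gdefect (af f (tagged x) u) a + fdefect f u
      - fdefect f (bob (gphi D (eH e)) u a) - gdefect u a.

Lemma ac_cochain (f : garr D D') : exists ga, ac_spec f ga.
Proof.
pose r x y (e : edge x y) u a := chi (gcharge D' y) (ac f (eH e) u a)
    - gdefect (af f (tagged x) u) a - fdefect f u
      + fdefect f (bob (gphi D (eH e)) u a) + gdefect u a.
exists (fun x y e => r x y e (cbase (gcharge D x)) (cbase (dcharge (eW e)))).
suff rE x y (e : edge x y) u a u' a' : r x y e u a = r x y e u' a'.
  by move=> x y e u a; rewrite (rE _ _ _ _ _ u a) /r; zabel.
pose h := cmor (gcharge D x) u u' 0; pose g := cmor (dcharge (eW e)) a a' 0.
have := f_equal (chi (gcharge D' y)) (ac_nat f (eH e) h g).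
rewrite !chi_comp chi_af !chi_gphi chi_af !chi_mor /r => /esym e'.
by apply: (eq_of_sub e'); zabel.
Qed.

Lemma ac_coboundary f ga be be' : ac_spec f ga -> gnat_spec D be -> gnat_spec D' be' ->
  forall x y z (e01 : edge x y) (e02 : edge x z) (e12 : edge y z),
  cd1 ga e01 e02 e12 = be _ _ _ e01 e02 e12 - be' _ _ _ e01 e02 e12.
Proof.
move=> gaP beP be'P x y z e01 e02 e12.
have [iq h] := gerbel_tri_ex e01 e02 e12; have [s _ _] := h.
have := f_equal (chi (gcharge D' z)) (ac_tri f (eH e01) (eH e02) (eH e12) s h
  (cbase (gcharge D x)) (cbase (dcharge (eW e01))) (cbase (dcharge (eW e12)))).
rewrite !chi_comp !chi_gphi !chi_id chi_af !gaP.
rewrite (beP _ _ _ _ _ _ _ h) (be'P _ _ _ _ _ _ _ h) /cd1 => e.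
by apply: (eq_of_sub e); zabel.
Qed.

Lemma garr_exists ga be be' : gnat_spec D be -> gnat_spec D' be' ->
  (forall x y z (e01 : edge x y) (e02 : edge x z) (e12 : edge y z),
     cd1 ga e01 e02 e12 = be _ _ _ e01 e02 e12 - be' _ _ _ e01 e02 e12) ->
  exists f : garr D D', True.
Proof.
move=> beP be'P cga.
pose F (x : latt) : gfun (gob D (tagged x)) (gob D' (tagged x)) :=
  charge_functor (gcharge D x) (gcharge D' x) (fun=> cbase (gcharge D' x)).
have FE (x : latt) (u u' : gob D (tagged x)) (h : hom u u') :
    chi (gcharge D' x) (fmap (F x) h) = chi (gcharge D x) h.
  exact: chi_charge_functor.
clearbody F.
(* The charge required by [ac_spec], the functors F having zero defect. *)
pose c (x y : latt) (e : edge x y) u a := cmor (gcharge D' y)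
  (F y (bob (gphi D (eH e)) u a)) (bob (gphi D' (eH e)) (F x u) a)
  (ga _ _ e + gdefect (F x u) a - gdefect u a).
have cE (x y : latt) (e : edge x y) u a :
    chi (gcharge D' y) (c x y e u a) = ga _ _ e + gdefect (F x u) a - gdefect u a.
  exact: chi_mor.
clearbody c.
have h1 (x y : latt) (e : edge x y) (u u' : gob D (tagged x)) (a a' : DD (eW e))
    (f : hom u u') (g : hom a a') :
    c x y e u' a' \oc fmap (F y) (bmap (gphi D (eH e)) f g) =
    bmap (gphi D' (eH e)) (fmap (F x) f) g \oc c x y e u a.
  apply: (chi_inj (gcharge D' y)).
  by rewrite !chi_comp !cE FE !chi_gphi FE; zabel.
have h2 (x y z : latt) (e01 : edge x y) (e02 : edge x z) (e12 : edge y z) iq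
    (s : ses iq.1 iq.2) (t : tri_spec e01 e02 e12 iq)
    (u : gob D (tagged x)) (a : DD (eW e01)) (b : DD (eW e12)) :
    gnat D' (eH e01) (eH e02) (eH e12) s t (F x u) a b
      \oc (bmap (gphi D' (eH e12)) (c x y e01 u a) (idm b)
        \oc c y z e12 (bob (gphi D (eH e01)) u a) b) =
    c x z e02 u (bob (dm M s) a b)
      \oc fmap (F z) (gnat D (eH e01) (eH e02) (eH e12) s t u a b).
  apply: (chi_inj (gcharge D' z)).
  rewrite !chi_comp chi_gphi chi_id !cE FE (beP _ _ _ _ _ _ _ t) (be'P _ _ _ _ _ _ _ t).
  have e := cga _ _ _ e01 e02 e12.
  by apply: (eq_of_sub e); rewrite /cd1; zabel.
exists (@GArr k M V D D' (fun L X => F (existT _ L X))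
  (fun _ _ _ _ _ _ _ H => c _ _ (qedge H))
  (fun _ _ _ _ _ _ _ H => h1 _ _ (qedge H))
  (fun _ _ _ _ _ _ _ _ _ _ _ _ _ _ _ i q H01 H02 H12 s t =>
     h2 _ _ _ (qedge H01) (qedge H02) (qedge H12) (i, q) s t)).
by [].
Qed.

Lemma garr_connected : exists f : garr D D', True.
Proof.
have [al alP] := assoc_cochain; have [N [ch1 ch2]] := gerbel_chain.
have [be beP] := gnat_cochain D; have [be' be'P] := gnat_cochain D'.
have [|ga gaP] := @H2_vanish latt E (gm k) N ch1 ch2
  (fun x y z e01 e02 e12 => be x y z e01 e02 e12 - be' x y z e01 e02 e12).
  move=> x y z w e01 e02 e03 e12 e13 e23.
  have e := gnat_coboundary alP beP e01 e02 e03 e12 e13 e23.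
  rewrite -(gnat_coboundary alP be'P e01 e02 e03 e12 e13 e23) in e.
  by apply: (eq_of_sub e); rewrite /cd2; zabel.
exact: (garr_exists beP be'P gaP).
Qed.

Lemma garr2_exists (f g : garr D D') ga ga' ta : ac_spec f ga -> ac_spec g ga' ->
  (forall x y (e : edge x y), cd0 ta e = ga _ _ e - ga' _ _ e) -> exists t : garr2 f g, True.
Proof.
move=> gaP ga'P cta.
(* The defects of f and g are built in so that naturality holds identically; what remains of [a2_ac]
   is the equation for the coboundary of ta. *)
pose t (x : latt) (u : gob D (tagged x)) := cmor (gcharge D' x)
  (af f (tagged x) u) (af g (tagged x) u) (ta x - fdefect f u + fdefect g u).
have tE (x : latt) (u : gob D (tagged x)) :
    chi (gcharge D' x) (t x u) = ta x - fdefect f u + fdefect g u.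
  exact: chi_mor.
clearbody t.
have h1 (x : latt) (u v : gob D (tagged x)) (h : hom u v) :
    t x v \oc fmap (af f (tagged x)) h = fmap (af g (tagged x)) h \oc t x u.
  by apply: (chi_inj (gcharge D' x)); rewrite !chi_comp !chi_af !tE; zabel.
have h2 (x y : latt) (e : edge x y) (u : gob D (tagged x)) (a : DD (eW e)) :
    bmap (gphi D' (eH e)) (t x u) (idm a) \oc ac f (eH e) u a =
    ac g (eH e) u a \oc t y (bob (gphi D (eH e)) u a).
  apply: (chi_inj (gcharge D' y)).
  rewrite !chi_comp chi_gphi chi_id !tE gaP ga'P.
  by have /esym e' := cta _ _ e; apply: (eq_of_sub e'); rewrite /cd0; zabel.
exists (@GArr2 k M V D D' f g (fun L X => t (existT _ L X)) (fun L X => h1 (existT _ L X))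
  (fun _ _ _ _ _ _ _ H => h2 _ _ (qedge H))).
by [].
Qed.

Lemma garr2_connected (f g : garr D D') : exists t : garr2 f g, True.
Proof.
have [N [ch1 ch2]] := gerbel_chain.
have [be beP] := gnat_cochain D; have [be' be'P] := gnat_cochain D'.
have [ga gaP] := ac_cochain f; have [ga' ga'P] := ac_cochain g.
have [|ta taP] := @H1_vanish latt E (gm k) N ch1 ch2 (fun x y e => ga x y e - ga' x y e).
  move=> x y z e01 e02 e12.
  have e := ac_coboundary gaP beP be'P e01 e02 e12.
  rewrite -(ac_coboundary ga'P beP be'P e01 e02 e12) in e.
  by apply: (eq_of_sub e); rewrite /cd1; zabel.
exact: (garr2_exists gaP ga'P taP).
Qed.

Definition garr2_scal (s : Gm k) (f : garr D D') : garr2 f f.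
refine (@GArr2 k M V D D' f f (fun L X u => scal s (af f X u)) _ _).
- by move=> L X u v h; exact: scal_nat.
- move=> L0 L1 X0 X1 u W p H x a; rewrite /bmap.
  rewrite -[tens _ _]/(scal s (_ : gtens _ _)) fmap_scal; exact: scal_nat.
Defined.

(** The charge of an endomorphism of f does not depend on the object over a fixed lattice, by
    naturality, nor on the lattice, by vanishing in degree 0. Its value at N 0 is the inverse
    map. *)
Lemma garr2_scal_bij (f : garr D D') : bijective (fun s => garr2_scal s f).
Proof.
have [N [ch1 ch2]] := gerbel_chain.
have [ga gaP] := ac_cochain f.
pose base := cbase (gcharge D (N 0%N)).
exists (fun t => chi (gcharge D' (N 0%N)) (a2 t (X := tagged (N 0%N)) base)) => [s|t].
  exact: chi_scal.
have tu (x : latt) (u v : gob D (tagged x)) :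
    chi (gcharge D' x) (a2 t u) = chi (gcharge D' x) (a2 t v).
  have := f_equal (chi (gcharge D' x)) (a2_nat t (cmor (gcharge D x) u v 0)).
  by rewrite !chi_comp !chi_af chi_mor => /esym e; apply: (eq_of_sub e); zabel.
have te (x y : latt) (e : edge x y) :
    cd0 (fun x => chi (gcharge D' x) (a2 t (cbase (gcharge D x)))) e = 0.
  have := f_equal (chi (gcharge D' y)) (a2_ac t (eH e) (cbase (gcharge D x))
    (cbase (dcharge (eW e)))).
  rewrite !chi_comp chi_gphi chi_id (tu y _ (cbase (gcharge D y))) => /esym e'.
  by rewrite /cd0; apply: (eq_of_sub e'); zabel.
have tc := @H0_vanish latt E (gm k) N ch1 ch2 _ te.
apply: garr2_ext => L X u; pose x := existT _ L X : latt.
apply: (chi_inj (gcharge D' x)); rewrite chi_scal.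
by rewrite (tu x u (cbase (gcharge D x))) (tc x (N 0%N)).
Qed.

(** Some 2-arrow t' runs in the opposite direction, and t' t is an endomorphism of f, hence a
    scalar; t' is corrected by its inverse. *)
Lemma garr2_inv (f g : garr D D') (t : garr2 f g) :
  exists t' : garr2 g f, garr2_comp t' t = garr2_id f /\ garr2_comp t t' = garr2_id g.
Proof.
have [t' _] := garr2_connected g f.
have [h hK hK'] := garr2_scal_bij f; have [h' h'K h'K'] := garr2_scal_bij g.
pose s := h (garr2_comp t' t); pose s' := ginv s.
have sE : garr2_comp t' t = garr2_scal s f by rewrite hK'.
have l : garr2_comp (garr2_comp (garr2_scal s' f) t') t = garr2_id f.
  apply: garr2_ext => L X u; have := f_equal (fun t => a2 t u) sE => /= e.
  by rewrite -compA e -scalM gmulV scal1.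
exists (garr2_comp (garr2_scal s' f) t'); split=> //.
set t'' := garr2_comp _ t' in l *.
apply: garr2_ext => L X u; have := f_equal (fun t => a2 t u) l => /= e.
have [v [e1 e2]] := gpd_iso (a2 t u).
have -> : scal s' (af f X u) \oc a2 t' u = v.
  by rewrite -[LHS]compm1 -e2 compA e comp1m.
exact: e2.
Qed.

End Arrows.

(** All gerbes are taken to be [bgm]. A 2-cochain bounding the associativity cocycle then provides
    [gnat], and the bounding equation is [gcube]. *)
Lemma trivial_gerbel : exists D : gerbel M V, forall L (X : @lat C VV L), trivialized X D.
Proof.
have [al alP] := assoc_cochain; have [N [ch1 ch2]] := gerbel_chain.
have [be beP] := @H3_vanish latt E (gm k) N ch1 ch2 al (assoc_cocycle alP).
pose B := bgm k; pose cB := bgm_charge k.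
pose F (W : C) : gfun (gtens B (DD W)) B :=
  charge_functor (tensor_charge cB (dcharge W)) cB (fun=> tt : B).
have FE (W : C) (u u' : B) (a a' : DD W) (f : hom u u') (g : hom a a') :
    chi cB (bmap (F W) f g) = chi cB f + chi (dcharge W) g.
  apply: etrans (chi_charge_functor (tensor_charge cB (dcharge W)) cB _ _) _.
  exact: (@tchiE _ _ _ _ _ (u, a) (u', a')).
clearbody F.
(* The functors F preserve charges exactly, so only be and the defect of [dm] enter. *)
pose n (x y z : latt) (e01 : edge x y) (e02 : edge x z) (e12 : edge y z)
    (iq : hom (eW e01) (eW e02) * hom (eW e02) (eW e12)) (s : ses iq.1 iq.2) (u : B)
    (a : DD (eW e01)) (b : DD (eW e12)) :=
  cmor cB (bob (F _) (bob (F _) u a) b) (bob (F _) u (bob (dm M s) a b))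
    (be _ _ _ e01 e02 e12 + ddefect s a b).
have nE x y z e01 e02 e12 iq s u a b :
    chi cB (@n x y z e01 e02 e12 iq s u a b) = be _ _ _ e01 e02 e12 + ddefect s a b.
  exact: chi_mor.
clearbody n.
have h1 (x y z : latt) (e01 : edge x y) (e02 : edge x z) (e12 : edge y z)
    (iq : hom (eW e01) (eW e02) * hom (eW e02) (eW e12)) (s : ses iq.1 iq.2) (u u' : B)
    (a a' : DD (eW e01)) (b b' : DD (eW e12)) (f : hom u u') (g : hom a a') (h : hom b b') :
    n _ _ _ e01 e02 e12 iq s u' a' b' \oc bmap (F _) (bmap (F _) f g) h =
    bmap (F _) f (bmap (dm M s) g h) \oc n _ _ _ e01 e02 e12 iq s u a b.
  by apply: (chi_inj cB); rewrite !chi_comp !nE !FE chi_dm; zabel.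
have h2 (x y z w : latt) (e01 : edge x y) (e02 : edge x z) (e03 : edge x w)
    (e12 : edge y z) (e13 : edge y w) (e23 : edge z w) t012 t013 t023 t123
    (s012 : ses t012.1 t012.2) (s013 : ses t013.1 t013.2)
    (s023 : ses t023.1 t023.2) (s123 : ses t123.1 t123.2) :
    tri_spec e01 e02 e12 t012 -> tri_spec e01 e03 e13 t013 ->
    tri_spec e02 e03 e23 t023 -> tri_spec e12 e13 e23 t123 ->
    forall (t : @tet k (eW e01) (eW e02) (eW e03) (eW e12) (eW e13) (eW e23)
      t012.1 t012.2 t013.1 t013.2 t023.1 t023.2 t123.1 t123.2)
    (u : B) (a : DD (eW e01)) (b : DD (eW e12)) (c : DD (eW e23)),
    bmap (F _) (idm u) (da M s012 s013 s023 s123 t a b c)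
      \oc (n _ _ _ e02 e03 e23 t023 s023 u (bob (dm M s012) a b) c
      \oc bmap (F _) (n _ _ _ e01 e02 e12 t012 s012 u a b) (idm c)) =
    n _ _ _ e01 e03 e13 t013 s013 u a (bob (dm M s123) b c)
      \oc n _ _ _ e12 e13 e23 t123 s123 (bob (F _) u a) b c.
  move=> h012 h013 h023 h123 t u a b c; apply: (chi_inj cB).
  rewrite !chi_comp !FE !nE !chi_id.
  rewrite (alP _ _ _ _ _ _ _ _ _ _ _ _ _ _ h012 h013 h023 h123).
  have /esym e := beP _ _ _ _ e01 e02 e03 e12 e13 e23.
  by apply: (eq_of_sub e); rewrite /cd2; zabel.
have gB := charge_gerbe cB.
have eqF W := gfun_equiv (tensor_charge cB (dcharge W)) cB (F W).
exists (@Gerbel k M V (fun _ _ => B) (fun _ _ => gB)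
  (fun _ _ _ _ _ W _ _ => F W) (fun _ _ _ _ _ W _ _ => eqF W)
  (fun _ _ _ _ _ _ _ _ _ _ _ _ _ _ _ i q H01 H02 H12 s _ =>
     n _ _ _ (qedge H01) (qedge H02) (qedge H12) (i, q) s)
  (fun _ _ _ _ _ _ _ _ _ _ _ _ _ _ _ i q H01 H02 H12 s _ =>
     h1 _ _ _ (qedge H01) (qedge H02) (qedge H12) (i, q) s)
  (fun _ _ _ _ _ _ _ _ _ _ _ _ _ _ _ _ _ _ _ _ _ _ _ _ _ _
     i012 q012 i013 q013 i023 q023 i123 q123 H01 H02 H03 H12 H13 H23 s012 s013 s023 s123
     t012 t013 t023 t123 t =>
     h2 _ _ _ _ (qedge H01) (qedge H02) (qedge H03) (qedge H12) (qedge H13) (qedge H23)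
       (i012, q012) (i013, q013) (i023, q023) (i123, q123) s012 s013 s023 s123
       t012 t013 t023 t123 t)).
move=> L X; exists (gfun_id B : gfun (bgm k) B); split; last by move=> b; exists b; exact: inhabits (idm b).
by move=> a b; exists id.
Qed.

End GerbelCharges.

(** * Coherence of the 2-group *)

Section Packed.
Variable C : category.

(* Equality of packed morphisms is equality up to equalities of the end points. *)
Definition pk (a b : C) (f : hom a b) : {a : C & {b : C & hom a b}} :=
  existT _ a (existT _ b f).

Lemma pk_inj (a b : C) (f g : hom a b) : pk f = pk g -> f = g.
Proof.
pose R (p q : {a : C & {b : C & hom a b}}) := forall (ea : tag q = tag p)
  (eb : tag (tagged q) = tag (tagged p)),
  eqhom eb \oc tagged (tagged q) = tagged (tagged p) \oc eqhom ea.
move=> e; have : R (pk f) (pk g).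
  by rewrite e => ea eb; rewrite !eqhom_id comp1m compm1.
by move=> /(_ erefl erefl); rewrite /= comp1m compm1 => ->.
Qed.

(** Packed equality is a congruence, so equations whose end points agree only propositionally can be
    treated factor by factor. *)
Lemma pk_comp (a b c a' b' c' : C) (f : hom b c) (g : hom a b) (f' : hom b' c') (g' : hom a' b') :
  pk f = pk f' -> pk g = pk g' -> pk (f \oc g) = pk (f' \oc g').
Proof.
move=> ef eg; have eb : b = b' := f_equal (@tag _ _) ef; subst b'.
have ec : c = c' := f_equal (fun p => tag (tagged p)) ef; subst c'.
have ea : a = a' := f_equal (@tag _ _) eg; subst a'.
by rewrite (pk_inj ef) (pk_inj eg).
Qed.

Lemma pk_eqhoml (a b c : C) (e : b = c) (f : hom a b) : pk (eqhom e \oc f) = pk f.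
Proof. by case: c / e; rewrite comp1m. Qed.
Lemma pk_eqhomr (a b c : C) (e : a = b) (f : hom b c) : pk (f \oc eqhom e) = pk f.
Proof. by case: b / e f => f; rewrite compm1. Qed.

Lemma eqhom_trans (a b c : C) (e : a = b) (e' : b = c) : eqhom e' \oc eqhom e = eqhom (etrans e e').
Proof. by case: c / e'; exact: comp1m. Qed.

Lemma eqhom_square (a a' b b' : C) (f : hom a a') (g : hom b b') (e : a = b) (e' : a' = b') :
  pk f = pk g -> eqhom e' \oc f = g \oc eqhom e.
Proof. by move=> h; apply: pk_inj; rewrite pk_eqhoml pk_eqhomr. Qed.

End Packed.

Lemma pk_fmap (k : fieldType) (G H : gpd k) (F : gfun G H) (a b a' b' : G)
    (f : hom a b) (f' : hom a' b') : pk f = pk f' -> pk (fmap F f) = pk (fmap F f').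
Proof.
move=> e; have ea : a = a' := f_equal (@tag _ _) e; subst a'.
have eb : b = b' := f_equal (fun p => tag (tagged p)) e; subst b'.
by rewrite (pk_inj e).
Qed.

Section ActionCoherence.
Variables (k : fieldType) (M : detmult k) (V : tate k 2).
Notation gerbel := (gerbel M V).
Implicit Types D E : gerbel.

Lemma pk_a2 D E (f g : garr D E) (t : garr2 f g) L (X : @lat _ (sval V) L) (x y : gob D X) :
  x = y -> pk (a2 t x) = pk (a2 t y).
Proof. by move=> ->. Qed.

Lemma af_eq D E (f g : garr D E) L (X : @lat _ (sval V) L) (x : gob D X) :
  f = g -> af f X x = af g X x.
Proof. by move=> ->. Qed.

Lemma pull2_nat s t D E (f g : garr D E) (r : garr2 f g) (es : s = t)
    (eD : pull t D = pull s D) (eE : pull t E = pull s E) L (X : @lat _ (sval V) L)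
    (x : gob (pull t D) X) :
  pk (a2 (pull2 s r) (af (garr_cast eD) X x)) = pk (fmap (af (garr_cast eE) X) (a2 (pull2 t r) x)).
Proof. by case: t / es eD eE x => eD eE x; rewrite !garr_castid. Qed.

Lemma gactM_nat2 g h D E (f f' : garr D E) (r : garr2 f f') L (X : @lat _ (sval V) L)
    (x : gob (gact (gmul g h) D) X) :
  pk (a2 (gact_arr2 g (gact_arr2 h r)) (af (garr_cast (gactM g h D)) X x)) =
  pk (fmap (af (garr_cast (gactM g h E)) X) (a2 (gact_arr2 (gmul g h) r) x)).
Proof.
refine (@pull2_nat (ltr_comp (lact (ginv h)) (lact (ginv g))) (lact (ginv (gmul g h))) D E f f' r _ _ _ L X x).
by rewrite ginvM lactM.
Qed.

Lemma pull2_id_nat s D E (f f' : garr D E) (r : garr2 f f') (es : ltr_id V = s)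
    (eD : pull s D = D) (eE : pull s E = E) L (X : @lat _ (sval V) L) (x : gob (pull s D) X) :
  pk (a2 r (af (garr_cast eD) X x)) = pk (fmap (af (garr_cast eE) X) (a2 (pull2 s r) x)).
Proof.
case: s / es eD eE x => eD eE x.
(* The translated quotient data are generalised and replaced by the identity through proof
   irrelevance; once all records are destructed, pulling back along the identity is convertible to
   doing nothing. *)
rewrite /pull2 /pull1 /pull in eD eE x *; move: (@quo_ltr _ V (ltr_id V)) eD eE x => Q.
rewrite (Prop_irrelevance Q (fun _ _ _ _ _ _ _ H => H)) {Q}.
case: D E f f' r => ? ? ? ? ? ? ? [? ? ? ? ? ? ?] [? ? ? ?] [? ? ? ?] [? ? ?] eD eE x.
have -> : garr_cast eD = garr_id _ := garr_castid eD.
by have -> : garr_cast eE = garr_id _ := garr_castid eE.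
Qed.

Lemma gact1_nat2 D E (f f' : garr D E) (r : garr2 f f') L (X : @lat _ (sval V) L)
    (x : gob (gact gone D) X) :
  pk (a2 r (af (garr_cast (gact1 D)) X x)) =
  pk (fmap (af (garr_cast (gact1 E)) X) (a2 (gact_arr2 gone r) x)).
Proof.
refine (@pull2_id_nat (lact (ginv gone)) D E f f' r _ _ _ L X x).
by rewrite ginv1 lact1.
Qed.

End ActionCoherence.

Section StabLaws.
Variables (k : fieldType) (M : detmult k) (V : tate k 2) (D : gerbel M V).
Notation sob := (sob D).
Notation S := (stab_cat D).
Notation cast := garr_cast.

Lemma a2_hcomp (E F H : gerbel M V) (g g' : garr F H) (f f' : garr E F) (t : garr2 g g')
    (s : garr2 f f') L (X : @lat _ (sval V) L) (x : gob E X) :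
  a2 (garr2_hcomp t s) x = a2 t (af f' X x) \oc fmap (af g X) (a2 s x).
Proof. by []. Qed.

Lemma a2_hcomp_id (E F H : gerbel M V) (g g' : garr F H) (f : garr E F) (t : garr2 g g')
    L (X : @lat _ (sval V) L) (x : gob E X) :
  a2 (garr2_hcomp t (garr2_id f)) x = a2 t (af f X x).
Proof. by rewrite a2_hcomp fmap_id compm1. Qed.

Lemma SOb_inj (g : GL V) (f f' : garr (gact g D) D) : SOb f = SOb f' -> f = f'.
Proof.
move=> e; have h (a b : sob) (e' : a = b) : strans (f_equal (@sg _ _ _ D) e') (sf a) = sf b.
  by case: b / e'.
by move: (h _ _ e); rewrite (Prop_irrelevance (f_equal (@sg _ _ _ D) e : g = g) erefl).
Qed.

(** Equality of the objects identifies g with g', after which the cast is an identity and 2-arrows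
    are compared componentwise. *)
Lemma pk_shom (g g' : GL V) (f1 f2 : garr (gact g D) D) (f1' f2' : garr (gact g' D) D)
    (t : garr2 f1 f2) (t' : garr2 f1' f2') : SOb f1 = SOb f1' -> SOb f2 = SOb f2' ->
  (forall (c : gact g D = gact g' D) L (X : @lat _ (sval V) L) x,
     pk (a2 t x) = pk (a2 t' (af (cast c) X x))) ->
  pk (@SHom k M V D (SOb f1) (SOb f2) erefl t : @hom S _ _) =
  pk (@SHom k M V D (SOb f1') (SOb f2') erefl t' : @hom S _ _).
Proof.
move=> e1 e2; have e : g = g' := f_equal (@sg _ _ _ D) e1; subst g'.
have ef1 := SOb_inj e1; have ef2 := SOb_inj e2; subst f1' f2' => h.
have -> // : t = t'; apply: garr2_ext => L X x; apply: pk_inj; exact: (h erefl).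
Qed.

(** The tensor product over fixed group elements. It isolates the part of [stens] and [stensm] in
    which no transport along an equality of group elements occurs. *)
Definition sten (g h : GL V) (f : garr (gact g D) D) (m : garr (gact h D) D) :
    garr (gact (gmul g h) D) D :=
  garr_comp f (garr_comp (gact_arr g m) (cast (gactM g h D))).
Definition sten2 (g h : GL V) (f f' : garr (gact g D) D) (m m' : garr (gact h D) D)
    (s : garr2 f f') (t : garr2 m m') : garr2 (sten f m) (sten f' m') :=
  garr2_hcomp s (garr2_hcomp (gact_arr2 g t) (garr2_id _)).
Definition serefl (g : GL V) (f f' : garr (gact g D) D) (t : garr2 f f') :
    @hom S (SOb f) (SOb f') := @SHom k M V D (SOb f) (SOb f') erefl t.

Lemma shom_ind_erefl (P : forall a b : sob, shom a b -> Prop) :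
  (forall g (f f' : garr (gact g D) D) (t : garr2 f f'), P _ _ (serefl t)) ->
  forall a b (s : shom a b), P a b s.
Proof.
move=> h [g f] [g' f'] [/= e t]; move: f' t; case: g' / e => f' t; exact: (h _ _ _ t).
Qed.

Lemma a2_sten2 (g h : GL V) (f f' : garr (gact g D) D) (m m' : garr (gact h D) D)
    (s : garr2 f f') (t : garr2 m m') L (X : @lat _ (sval V) L) x :
  a2 (sten2 s t) x = a2 s (af (gact_arr g m') X (af (cast (gactM g h D)) X x))
    \oc fmap (af f X) (a2 (gact_arr2 g t) (af (cast (gactM g h D)) X x)).
Proof. by rewrite a2_hcomp a2_hcomp_id. Qed.

Lemma fmap_sten (g h : GL V) (f : garr (gact g D) D) (m : garr (gact h D) D)
    L (X : @lat _ (sval V) L) x y (r : @hom (gob (gact (gmul g h) D) X) x y) :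
  fmap (af (sten f m) X) r =
  fmap (af f X) (fmap (af (gact_arr g m) X) (fmap (af (cast (gactM g h D)) X) r)).
Proof. by []. Qed.

Lemma stensmE (g h : GL V) (f f' : garr (gact g D) D) (m m' : garr (gact h D) D)
    (s : garr2 f f') (t : garr2 m m') :
  stensm (serefl s) (serefl t) = serefl (sten2 s t).
Proof. by []. Qed.

Lemma sten_assoc (g h l : GL V) (f : garr (gact g D) D) (m : garr (gact h D) D)
    (n : garr (gact l D) D) : SOb (sten (sten f m) n) = SOb (sten f (sten m n)).
Proof. exact: (stensA (SOb f) (SOb m) (SOb n)). Qed.

(** Both sides are composites of casts, hence casts along proofs of one equality, which coincide. *)
Lemma cast_assoc (g h l : GL V) (c : gact (gmul (gmul g h) l) D = gact (gmul g (gmul h l)) D)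
    L (X : @lat _ (sval V) L) x :
  af (cast (gactM g h (gact l D))) X (af (cast (gactM (gmul g h) l D)) X x) =
  af (gact_arr g (cast (gactM h l D))) X (af (cast (gactM g (gmul h l) D)) X (af (cast c) X x)).
Proof.
refine (@af_eq k M V _ _ (garr_comp _ _) (garr_comp _ (garr_comp _ (cast c))) L X x _).
by rewrite gact_cast !garr_cast_comp; exact: garr_cast_irr.
Qed.

(** Both sides are composites of components of s, t and r. The components of s and t are matched
    through equalities of objects, that of r through naturality of the strict action,
    [gactM_nat2]. *)
Lemma sten2_assoc (g h l : GL V) (f f' : garr (gact g D) D) (m m' : garr (gact h D) D)
    (n n' : garr (gact l D) D) (s : garr2 f f') (t : garr2 m m') (r : garr2 n n') :
  pk (serefl (sten2 (sten2 s t) r)) = pk (serefl (sten2 s (sten2 t r))).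
Proof.
apply: pk_shom; [exact: sten_assoc | exact: sten_assoc | move=> c L X x].
have hz := cast_assoc c x.
set z := af (cast (gactM (gmul g h) l D)) X x in hz.
set z' := af (gact_arr g _) X _ in hz.
have hv : af (cast (gactM g h D)) X (af (gact_arr (gmul g h) n') X z) =
    af (gact_arr g (gact_arr h n')) X z'.
  rewrite -hz; exact: (esym (@af_eq k M V _ _ (garr_comp _ _) (garr_comp _ _) L X z (gactM_nat g h n'))).
have ho : pk (fmap (af (cast (gactM g h D)) X) (a2 (gact_arr2 (gmul g h) r) z)) =
    pk (a2 (gact_arr2 g (gact_arr2 h r)) z').
  by rewrite -gactM_nat2 hz.
rewrite !a2_sten2.
have eR : a2 (gact_arr2 g (sten2 t r)) (af (cast (gactM g (gmul h l) D)) X (af (cast c) X x)) =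
    a2 (gact_arr2 g t) (af (gact_arr g (gact_arr h n')) X z') \oc
    fmap (af (gact_arr g m) X) (a2 (gact_arr2 g (gact_arr2 h r)) z').
  refine (@a2_sten2 h l m m' n n' t r L (lact (ginv g) L X) (af (cast (gactM g (gmul h l) D)) X (af (cast c) X x))).
rewrite eR fmap_comp fmap_sten; apply: etrans _ (f_equal (@pk _ _ _) (esym (compA _ _ _))).
apply: pk_comp; first apply: pk_comp.
- by apply: pk_a2; rewrite hv.
- refine (@pk_fmap k _ _ (af f X) _ _ _ _ _ _ _); exact: (@pk_a2 k M V _ _ _ _ (gact_arr2 g t) L X).
- refine (@pk_fmap k _ _ (af f X) _ _ _ _ _ _ _); exact: pk_fmap ho.
Qed.

Lemma stensm_assoc (a a' b b' c c' : sob) (s : shom a a') (t : shom b b') (r : shom c c') :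
  pk (stensm (stensm s t) r : @hom S _ _) = pk (stensm s (stensm t r) : @hom S _ _).
Proof.
elim/shom_ind_erefl: s => g f f' s; elim/shom_ind_erefl: t => h m m' t.
elim/shom_ind_erefl: r => l n n' r.
have e1 : pk (stensm (serefl s) (stensm (serefl t) (serefl r)) : @hom S _ _) =
    pk (serefl (sten2 s (sten2 t r)) : @hom S _ _).
  have q : pk (stensm (serefl s) (stensm (serefl t) (serefl r)) : @hom S _ _) =
    pk (stensm (serefl s) (serefl (sten2 t r)) : @hom S _ _).
    exact: (f_equal (fun w => pk (stensm (serefl s) w : @hom S _ _)) (stensmE t r)).
  by rewrite q (stensmE s (sten2 t r)).
have e2 : pk (stensm (stensm (serefl s) (serefl t)) (serefl r) : @hom S _ _) =
    pk (serefl (sten2 (sten2 s t) r) : @hom S _ _).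
  have q : pk (stensm (stensm (serefl s) (serefl t)) (serefl r) : @hom S _ _) =
    pk (stensm (serefl (sten2 s t)) (serefl r) : @hom S _ _).
    exact: (f_equal (fun w => pk (stensm w (serefl r) : @hom S _ _)) (stensmE s t)).
  by rewrite q (stensmE (sten2 s t) r).
exact: (etrans e2 (etrans (sten2_assoc s t r) (esym e1))).
Qed.
End StabLaws.

Lemma comp_interchange (C : category) (a b c c' d e : C) (p : hom d e) (q : hom c d) (q' : hom b c')
    (r : hom b c) (r' : hom c' d) (t : hom a b) :
  q \oc r = r' \oc q' -> (p \oc q) \oc (r \oc t) = (p \oc r') \oc (q' \oc t).
Proof. by move=> h; rewrite -!compA (compA q) h !compA. Qed.

(** * The central extension *)

Section StabTwoGroup.
Variables (k : fieldType) (M : detmult k) (V : tate k 2) (D : gerbel M V).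
Notation sob := (sob D).
Notation S := (stab_cat D).
Notation cast := garr_cast.

Lemma stens_one_l (g : GL V) (f : garr (gact g D) D) : SOb (sten (cast (gact1 D)) f) = SOb f.
Proof. exact: (stens1l (SOb f)). Qed.
Lemma stens_one_r (g : GL V) (f : garr (gact g D) D) : SOb (sten f (cast (gact1 D))) = SOb f.
Proof. exact: (stens1r (SOb f)). Qed.

Lemma sten2_id (g h : GL V) (f : garr (gact g D) D) (m : garr (gact h D) D) :
  sten2 (garr2_id f) (garr2_id m) = garr2_id (sten f m).
Proof.
apply: garr2_ext => L X x; rewrite a2_sten2 [LHS]comp1m; exact: (fmap_id (af f X) _).
Qed.

Lemma sten2_comp (g h : GL V) (f f' f'' : garr (gact g D) D) (m m' m'' : garr (gact h D) D)
    (s : garr2 f' f'') (s' : garr2 f f') (t : garr2 m' m'') (t' : garr2 m m') :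
  sten2 (garr2_comp s s') (garr2_comp t t') = garr2_comp (sten2 s t) (sten2 s' t').
Proof.
apply: garr2_ext => L X x; rewrite a2_sten2.
apply: etrans _ (esym (f_equal2 (@comp _ _ _ _) (a2_sten2 s t x) (a2_sten2 s' t' x))).
set w := af (cast _) X x.
refine (etrans (f_equal (comp _) (fmap_comp (af f X) (a2 (gact_arr2 g t) w) (a2 (gact_arr2 g t') w))) _).
exact: (comp_interchange _ _ (a2_nat s' (a2 (gact_arr2 g t) w))).
Qed.

Lemma sten2_lun (g : GL V) (f f' : garr (gact g D) D) (t : garr2 f f') :
  pk (serefl (sten2 (garr2_id (cast (gact1 D))) t)) = pk (serefl t).
Proof.
apply: pk_shom; [exact: stens_one_l | exact: stens_one_l | move=> c L X x].
rewrite a2_sten2.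
apply: etrans (f_equal (@pk _ _ _) (comp1m _)) _.
apply: etrans (esym (gact1_nat2 t (af (cast (gactM gone g D)) X x))) _.
apply: pk_a2.
refine (@af_eq k M V _ _ (garr_comp (cast _) (cast _)) (cast c) L X x _).
rewrite garr_cast_comp; exact: garr_cast_irr.
Qed.

Lemma sten2_run (g : GL V) (f f' : garr (gact g D) D) (t : garr2 f f') :
  pk (serefl (sten2 t (garr2_id (cast (gact1 D))))) = pk (serefl t).
Proof.
apply: pk_shom; [exact: stens_one_r | exact: stens_one_r | move=> c L X x].
rewrite a2_sten2.
apply: etrans (f_equal (fun u => pk (_ \oc u)) (fmap_id (af f X) _)) _.
apply: etrans (f_equal (@pk _ _ _) (compm1 _)) _.
apply: pk_a2.
refine (@af_eq k M V _ _ (garr_comp (gact_arr g (cast _)) (cast _)) (cast c) L X x _).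
rewrite gact_cast garr_cast_comp; exact: garr_cast_irr.
Qed.

Lemma stensm_id (a b : sob) : stensm (shom_id a) (shom_id b) = shom_id (stens a b).
Proof.
case: a b => g f [h m]; apply: etrans (stensmE (garr2_id f) (garr2_id m)) _.
by rewrite sten2_id.
Qed.

Lemma serefl_comp (g : GL V) (f f' f'' : garr (gact g D) D) (s : garr2 f' f'') (t : garr2 f f') :
  shom_comp (serefl s) (serefl t) = serefl (garr2_comp s t).
Proof. by []. Qed.

Lemma shom_ind_erefl2 (P : forall a b c : sob, shom b c -> shom a b -> Prop) :
  (forall g (f f' f'' : garr (gact g D) D) (t : garr2 f' f'') (t' : garr2 f f'),
    P _ _ _ (serefl t) (serefl t')) ->
  forall a b c (s : shom b c) (s' : shom a b), P a b c s s'.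
Proof.
move=> h [g f] [g' f'] [g'' f''] [/= e t] [/= e' s].
move: f'' t; case: g'' / e => f'' t; move: f' f'' s t; case: g' / e' => f' f'' s t.
exact: (h _ _ _ _ t s).
Qed.

Lemma stensm_comp (a a' a'' b b' b'' : sob) (s : shom a' a'') (s' : shom a a')
    (t : shom b' b'') (t' : shom b b') :
  stensm (shom_comp s s') (shom_comp t t') = shom_comp (stensm s t) (stensm s' t').
Proof.
move: a a' a'' s s'; apply: shom_ind_erefl2 => g f f' f'' s s'.
move: b b' b'' t t'; apply: shom_ind_erefl2 => h m m' m'' t t'.
apply: etrans (stensmE (garr2_comp s s') (garr2_comp t t')) _.
rewrite sten2_comp.
exact: (esym (serefl_comp (sten2 s t) (sten2 s' t'))).
Qed.

Lemma stensm_eqhom_r (a b b' : sob) (e : b = b') :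
  stensm (shom_id a) (@eqhom S _ _ e) = @eqhom S _ _ (f_equal (stens a) e).
Proof. case: b' / e; exact: stensm_id. Qed.
Lemma stensm_eqhom_l (a a' b : sob) (e : a = a') :
  stensm (@eqhom S _ _ e) (shom_id b) = @eqhom S _ _ (f_equal (fun a => stens a b) e).
Proof. case: a' / e; exact: stensm_id. Qed.

Lemma stab_connected (a b : sob) : sg a = sg b -> exists s : shom a b, True.
Proof.
case: a b => g f [g' f'] /= e; move: f'; case: g' / e => f'.
by have [t _] := garr2_connected f f'; exists (serefl t).
Qed.

Lemma stab_surj (g : GL V) : exists a : sob, sg a = g.
Proof. by have [f _] := garr_connected (gact g D) D; exists (SOb f). Qed.

Lemma shom_iso (a b : sob) (s : shom a b) : @is_iso S a b s.
Proof.
elim/shom_ind_erefl: s => g f f' t; have [t' [e e']] := garr2_inv t.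
exists (serefl t'); split.
  by apply: etrans (serefl_comp t' t) _; rewrite e.
by apply: etrans (serefl_comp t t') _; rewrite e'.
Qed.

Lemma eqhom_irr (C : category) (a b : C) (e e' : a = b) : eqhom e = eqhom e'.
Proof. by rewrite (Prop_irrelevance e e'). Qed.

(** Associators and unitors come from equalities of objects, so pentagon and triangle compare proofs
    of one equality, while naturality is packed equality. Inverses exist because each group element
    underlies an object and objects over one element are isomorphic. *)
Lemma stab_2group : is_2group (stab D).
Proof.
split.
- exact: shom_iso.
- exact: stensm_id.
- exact: stensm_comp.
- move=> a a' b b' c c' f g h; apply: eqhom_square; exact: stensm_assoc.
- move=> a a' f; apply: (@eqhom_square S).
  elim/shom_ind_erefl: f => g f f' t.
  apply: etrans (f_equal (@pk S _ _) (stensmE (garr2_id (cast (gact1 D))) t)) _.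
  exact: sten2_lun.
- move=> a a' f; apply: (@eqhom_square S).
  elim/shom_ind_erefl: f => g f f' t.
  apply: etrans (f_equal (@pk S _ _) (stensmE t (garr2_id (cast (gact1 D))))) _.
  exact: sten2_run.
- move=> a b c d.
  apply: etrans (f_equal2 (@comp S _ _ _) (stensm_eqhom_r a (stensA b c d))
    (f_equal (@comp S _ _ _ _) (stensm_eqhom_l d (stensA a b c)))) _.
  rewrite !(@eqhom_trans S); exact: (@eqhom_irr S _ _ _ _).
- move=> a b.
  apply: etrans (f_equal (fun u => @comp S _ _ _ u _) (stensm_eqhom_r a (stens1l b))) _.
  apply: etrans _ (esym (stensm_eqhom_l b (stens1r a))).
  rewrite (@eqhom_trans S); exact: (@eqhom_irr S _ _ _ _).
- move=> a; have [b e] := stab_surj (ginv (sg a)).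
  exists b; split.
    have [|s _] := @stab_connected (stens a b) (sone D); last exact: inhabits s.
    by rewrite /= e; exact: (@gmulVr (GL V)).
  have [|s _] := @stab_connected (stens b a) (sone D); last exact: inhabits s.
  by rewrite /= e; exact: (@gmulV (GL V)).
Qed.

(** The equality of group elements inside a morphism is a proof of g = g; proof irrelevance turns it
    into [erefl], so the 2-arrow can be recovered. *)
Lemma serefl_inj (g : GL V) (f f' : garr (gact g D) D) (t t' : garr2 f f') :
  serefl t = serefl t' -> t = t'.
Proof.
move=> e; have h (s : shom (SOb f) (SOb f')) (es : se s = erefl) : serefl t = s ->
    t = match es in _ = c return garr2 (strans c f) f' with erefl => s2 s end.
  by move=> e'; move: es; case: s / e' => es; rewrite (Prop_irrelevance es erefl).
exact: (h (serefl t') erefl e).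
Qed.

Lemma serefl_surj (g : GL V) (f f' : garr (gact g D) D) (s : shom (SOb f) (SOb f')) :
  exists t : garr2 f f', serefl t = s.
Proof.
case: s => /= e t; move: t; rewrite (Prop_irrelevance e erefl) => t; by exists t.
Qed.

(** Surjectivity onto GL(V) is the existence of 1-arrows from g . D to D, injectivity on components
    that of 2-arrows between parallel 1-arrows; the automorphisms of the unit are the scalars acting
    on its 1-arrow. *)
Lemma stab_extension : @is_central_extension (Gm k) (GL V) (stab D) (fun a => sg a).
Proof.
split.
- exact: stab_2group.
- by [].
- exact: stab_surj.
- move=> a b; split; first by case=> s; exact: se s.
  by move=> /stab_connected [s _]; exact: inhabits s.
- exists (fun x => serefl (garr2_scal x (cast (gact1 D)))); split.
    have [h hK hK'] := garr2_scal_bij (cast (gact1 D)).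
    have [j jP] := dchoice (@serefl_surj gone (cast (gact1 D)) (cast (gact1 D))).
    exists (fun s => h (j s)) => [x|s].
      by rewrite (serefl_inj (jP _)) hK.
    by rewrite hK' jP.
  move=> x y; apply: etrans _ (esym (serefl_comp _ _)).
  by apply: f_equal; apply: garr2_ext => L X u; exact: scalM.
Qed.

End StabTwoGroup.

Theorem theorem6 (k : fieldType) (M : detmult k) (V : tate k 2)
    (L : ind (pro (tate k 1))) (X : @lat (tate k 1) (sval V) L) :
  (exists D : gerbel M V, trivialized X D) /\
  (forall D : gerbel M V, trivialized X D ->
    @is_central_extension (Gm k) (GL V) (stab D) (fun a => sg a)).
Proof.
split; first by have [D h] := trivial_gerbel M V; exists D.
by move=> D _; exact: stab_extension.
Qed.
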